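(* Fix $p\in(0,2)$ and let $(u_k)$ be a sequence of radial solutions to $$-\Delta u_k=(1-|x|^p)e^{2u_k}\ \text{ in }\mathbb{R}^2,\qquad \int_{\mathbb{R}^2}(1-|x|^p)e^{2u_k}\,dx=\Lambda_k,$$ with $\Lambda_k\uparrow 4\pi$ as $k\to+\infty$. Then $$(1-|x|^p)e^{2u_k}\,dx\rightharpoonup 4\pi\,\delta_0\quad\text{as }k\to+\infty$$ weakly in the sense of measures. Moreover, setting $\mu_k:=2e^{-u_k(0)}$ and $$\eta_k(x):=u_k(\mu_kx)-u_k(0)+\log 2,$$ we have $$\eta_k(x)\to\log\frac{2}{1+|x|^2}\quad\text{in }C^1_{loc}(\mathbb{R}^2)\ \text{ as }k\to\infty .$$
   Context: A solution is a function $u\in L^1_{loc}(\mathbb{R}^2)$ with $(1-|x|^p)e^{2u}\in L^1(\mathbb{R}^2)$ which satisfies the equation in the sense of distributions on $\mathbb{R}^2$ and has the prescribed value of the integral. (Every such $u$ is of class $C^1$ after modification on a null set, so $u_k(0)$ makes sense.) Radial means radially symmetric about the origin. $\delta_0$ is the Dirac mass at the origin; weak convergence in the sense of measures is convergence when tested against continuous compactly supported functions on $\mathbb{R}^2$. *)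

(* Defs.v *)
From HB Require Import structures.
From mathcomp Require Import all_boot all_order all_algebra.
From mathcomp Require Import all_classical all_reals all_analysis.

Set Implicit Arguments.
Unset Strict Implicit.
Unset Printing Implicit Defensive.
Import Order.TTheory GRing.Theory Num.Theory.
Import numFieldNormedType.Exports.
Local Open Scope classical_set_scope.
Local Open Scope ring_scope.

(* Points of the plane are pairs. The library norm on [R * R] is the sup norm,
   which only matters for the topology; |x| is [enorm x]. *)
Definition enorm (R : realType) (x : R * R) : R :=
  Num.sqrt (x.1 ^+ 2 + x.2 ^+ 2).

Definition lebesgue2 (R : realType) :
    {measure set (measurableTypeR R * measurableTypeR R) -> \bar R} :=
  (@lebesgue_measure R \x @lebesgue_measure R)%E.

(* [partial false] and [partial true] are the two coordinate derivatives. *)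
Definition partial (R : realType) (i : bool) (f : R * R -> R) (x : R * R) : R :=
  'D_(if i then (0, 1) else (1, 0)) f x.

Definition has_partial (R : realType) (i : bool) (f : R * R -> R) : Prop :=
  forall x, derivable f x (if i then (0, 1) else (1, 0)).

Fixpoint of_class_C (R : realType) (n : nat) (f : R * R -> R) : Prop :=
  if n is m.+1 then
    continuous f /\ forall i, has_partial i f /\ of_class_C m (partial i f)
  else continuous f.

Definition laplacian (R : realType) (f : R * R -> R) (x : R * R) : R :=
  partial false (partial false f) x + partial true (partial true f) x.

Definition compactly_supported (R : realType) (f : R * R -> R) : Prop :=
  compact (closure [set x | f x != 0]).

Definition test_function (R : realType) (phi : R * R -> R) : Prop :=
  (forall n, of_class_C n phi) /\ compactly_supported phi.

Definition loc_integrable (R : realType) (u : R * R -> R) : Prop :=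
  forall K : set (R * R), compact K ->
    (@lebesgue2 R).-integrable K (EFin \o u).

(* Functions are identified when they agree almost everywhere, so radial
   symmetry is that of the almost everywhere class. *)
Definition radial (R : realType) (u : R * R -> R) : Prop :=
  exists w : R -> R, {ae @lebesgue2 R, forall x, u x = w (enorm x)}.

Definition curvature_density (R : realType) (p : R) (u : R * R -> R)
    (x : R * R) : R :=
  (1 - enorm x `^ p) * expR (2 * u x).

Definition solution (R : realType) (p Lambda : R) (u : R * R -> R) : Prop :=
  [/\ loc_integrable u,
      (@lebesgue2 R).-integrable [set: R * R] (EFin \o curvature_density p u),
      forall phi : R * R -> R, test_function phi ->
        \int[@lebesgue2 R]_x (u x * - laplacian phi x)%:E
        = \int[@lebesgue2 R]_x (curvature_density p u x * phi x)%:E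
    & \int[@lebesgue2 R]_x (curvature_density p u x)%:E = Lambda%:E]%E.

(* The signed measures [f k x dx] converge weakly to [nu]. *)
Definition densities_cvg_weakly (R : realType) (f : nat -> R * R -> R)
    (nu : {measure set (measurableTypeR R * measurableTypeR R) -> \bar R}) :
    Prop :=
  forall phi : R * R -> R, continuous phi -> compactly_supported phi ->
    (fun k => \int[@lebesgue2 R]_x (phi x * f k x)%:E)%E @ \oo
      --> (\int[nu]_x (phi x)%:E)%E.

Definition C1_representative (R : realType) (u v : R * R -> R) : Prop :=
  of_class_C 1 v /\ {ae @lebesgue2 R, forall x, u x = v x}.

Definition C1_loc_cvg (R : realType) (F : nat -> R * R -> R)
    (f : R * R -> R) : Prop :=
  [/\ forall k, of_class_C 1 (F k),
      of_class_C 1 f,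
      {family compact, F @ \oo --> f}
    & forall i, {family compact, (fun k => partial i (F k)) @ \oo
                                   --> partial i f}].

Definition blowup_scale (R : realType) (v : R * R -> R) : R :=
  2 * expR (- v 0).

Definition blowup (R : realType) (v : R * R -> R) (x : R * R) : R :=
  v (blowup_scale v *: x) - v 0 + ln 2.

Lemma four_pi_ge0 (R : realType) : 0 <= 4 * pi :> R.
Proof. by rewrite mulr_ge0 ?pi_ge0. Qed.

(* Main.v *)
(* In the variable [s = |x|^2], with [q = p / 2], a radial solution [u x = v s] solves
   [4 (s v')' = - (1 - s^q) e^{2v}]. If [pi M s] is the mass of the disc [|x|^2 <= s], then
   the Pohozaev quantity [4 M - M^2 - 4 s (1 - s^q) e^{2v}] vanishes at [0], has derivative
   [4 q s^q e^{2v}] and is at most [m (4 - m)], where [m = Lambda / pi]. When [m -> 4] it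
   therefore tends to [0] uniformly. Hence the integral of [|x|^p e^{2u}] tends to [0], so
   that the mass cannot stay away from the origin and [u 0] is unbounded. The second
   derivative of [e^{-v}] is [- e^{-v}] times the Pohozaev quantity over [16 s^2]: after
   rescaling, [e^{-v}] becomes affine in [s], and its limit is [(1 + s) / 2]. *)

Require Import Defs.
From HB Require Import structures.
From mathcomp Require Import all_boot all_order all_algebra.
From mathcomp Require Import all_classical all_reals all_analysis.
From mathcomp Require Import measurable_realfun ring lra.
Set Implicit Arguments.
Unset Strict Implicit.
Unset Printing Implicit Defensive.
Import Order.TTheory GRing.Theory Num.Theory.
Import numFieldNormedType.Exports.
Local Open Scope classical_set_scope.
Local Open Scope ring_scope.

(** * Smooth ramp functions *)

(** The overview starts from the radial equation, but [solution] only gives a locally integrable u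
    that agrees almost everywhere with a function of |x|, and that function need not be measurable.
    Fubini supplies a measurable profile g. Smooth test functions of s whose second derivatives
    concentrate at two points a < b then give, at Lebesgue points of s g, an integrated form of the
    equation; its right side defines a representative that is differentiable for s > 0. The second
    obstacle is the origin, where the equation in s degenerates: on s > 0 alone it allows v to
    behave like a multiple of log s. The test functions are constant, not zero, near the origin,
    which forces M to vanish there and excludes such a singularity. Nothing is known at s = 0
    itself, so estimates start from limits at 0+. In the blow-up the division of the Pohozaev
    quantity by s^2 needs a rate at 0: it is O(s^(1+q)), which leaves the integrable s^(q-1). The
    final error is of order e^(-2 q v0), with v0 the value of u at 0. *)

Lemma is_derive_mvt (R : realType) (f df : R -> R) (a b : R) : a < b ->
  (forall x : R, a <= x <= b -> is_derive x 1 f (df x)) ->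
  exists2 c, a < c < b & f b - f a = df c * (b - a).
Proof.
move=> ab fdf; have [| |c cab fE] := @MVT R f df a b ab.
- by move=> x; rewrite in_itv/= => /andP[ax xb]; apply: fdf; rewrite !ltW.
- apply: derivable_within_continuous => x; rewrite in_itv/= => xab.
  by have [] := fdf x xab.
- by exists c => //; move: cab; rewrite in_itv.
Qed.

Lemma is_derive_ge0_le (R : realType) (f df : R -> R) (a b : R) : a <= b ->
  (forall x : R, a <= x <= b -> is_derive x 1 f (df x)) ->
  (forall x, a < x < b -> 0 <= df x) -> f a <= f b.
Proof.
rewrite le_eqVlt => /predU1P[-> //|ab] fdf df0.
have [c cab fE] := @is_derive_mvt R f df a b ab fdf.
by rewrite -subr_ge0 fE mulr_ge0// ?df0// subr_ge0 ltW.
Qed.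

Lemma is_derive_eq0_const (R : realType) (f df : R -> R) (a b : R) : a <= b ->
  (forall x : R, a <= x <= b -> is_derive x 1 f (df x)) ->
  (forall x, a < x < b -> df x = 0) -> f a = f b.
Proof.
rewrite le_eqVlt => /predU1P[-> //|ab] fdf df0.
have [c cab fE] := @is_derive_mvt R f df a b ab fdf.
by apply/esym/eqP; rewrite -subr_eq0 fE df0// mul0r.
Qed.

Lemma is_derive_continuous (R : realType) (f : R -> R) (x df : R) :
  is_derive x 1 f df -> {for x, continuous f}.
Proof.
by move=> [fx _]; apply/differentiable_continuous; apply/derivable1_diffP.
Qed.

Lemma near_is_derive (R : realType) (f g : R -> R) (x df : R) :
  (\forall y \near x, f y = g y) -> is_derive x 1 f df -> is_derive x 1 g df.
Proof. exact: near_eq_is_derive. Qed.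

Lemma antiderivative (R : realType) (f : R -> R) (L : R) :
  continuous f -> (forall x, x <= L -> f x = 0) ->
  exists2 P : R -> R, (forall x : R, is_derive x 1 P (f x)) &
    (forall x, x <= L -> P x = 0).
Proof.
move=> cf f0; pose mu := @lebesgue_measure R.
(* The base point L - 1, rather than L, makes x = L an interior point, where the fundamental theorem
   applies. *)
pose P x := (\int[mu]_(t in `[(L - 1)%R, x]) f t)%R.
have P0 x : x <= L -> P x = 0.
  move=> xL; rewrite /P (@eq_Rintegral _ _ _ _ _ (cst 0)) ?Rintegral_cst ?mul0r// => t; rewrite inE/= in_itv/= => /andP[_ tx].
  by rewrite f0// (le_trans tx).
exists P => // x; have [xL|Lx] := ltP x L; last first.
  have [] := @continuous_FTC1_closed R f (L - 1) x (x + 1) _ _ _ (cf x).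
  - by rewrite ltrDl.
  - apply: continuous_compact_integrable; first exact: segment_compact.
    exact: continuous_subspaceT.
  - by lra.
  - rewrite -[fun _ => _]/P => dP PE; split; first exact: dP.
    by rewrite -derive1E.
rewrite f0 ?(ltW xL)//.
apply: (@near_is_derive _ (cst 0)).
near=> y; rewrite P0//; near: y.
by apply: filterS (lt_nbhsl xL) => y /ltW.
Unshelve. all: by end_near. Qed.

(** Only the existence of n derivatives is recorded. Their continuity is not: one more derivative
    yields it, and only functions that satisfy this for all n matter. *)
Fixpoint Ck (R : realType) (n : nat) (f : R -> R) : Prop :=
  if n is m.+1 then (forall x, derivable f x 1) /\ Ck m (derive1 f) else True.

Section Ck.
Variable R : realType.
Implicit Types f g : R -> R.

Lemma CkS n f : Ck n.+1 f -> Ck n f.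
Proof. by elim: n f => [//|n IH] f [df /IH]. Qed.

Lemma CkD n f g : Ck n f -> Ck n g -> Ck n (f \+ g).
Proof.
elim: n f g => [//|n IH] f g [df Cf] [dg Cg]; split=> [x|]; first exact: derivableD.
have -> : (f \+ g)^`()%classic = (derive1 f) \+ (derive1 g).
  by apply/funext => x; rewrite /= !derive1E deriveD.
exact: IH.
Qed.

Lemma CkM n f g : Ck n f -> Ck n g -> Ck n (f \* g).
Proof.
elim: n f g => [//|n IH] f g /[dup] Cf [df Cf'] /[dup] Cg [dg Cg'].
split=> [x|]; first exact: derivableM.
have -> : (f \* g)^`()%classic = (f \* (derive1 g)) \+ (g \* (derive1 f)).
  by apply/funext => x; rewrite /= !derive1E deriveM.
by apply: CkD; apply: IH => //; exact: CkS.
Qed.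

Lemma Ck_cst n (c : R) : Ck n (fun _ : R => c).
Proof.
elim: n c => [//|n IH] c; split=> [x|]; first exact: derivable_cst.
have -> : (@cst R R c)^`()%classic = cst 0.
  by apply/funext => x; rewrite derive1_cst.
exact: IH.
Qed.

Lemma is_derive_affine (c d x : R) : is_derive x 1 (fun y => c * y + d) c.
Proof.
by apply: is_derive_eq; rewrite addr0 /GRing.scale/= mulr1.
Qed.

Lemma Ck_affine n f c d : Ck n f -> Ck n (fun x => f (c * x + d)).
Proof.
elim: n f => [//|n IH] f [df Cf]; split=> [x|].
  have h1 := is_derive_affine c d x.
  have h2 : is_derive (c * x + d) 1 f ((derive1 f) (c * x + d)).
    by rewrite derive1E; apply: DeriveDef.
  by have [] := @is_derive1_comp R f _ x _ _ h2 h1.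
have -> : (fun x => f (c * x + d))^`()%classic = (cst c) \* (fun x => (derive1 f) (c * x + d)).
  apply/funext => x; rewrite derive1E.
  have h1 := is_derive_affine c d x.
  have h2 : is_derive (c * x + d) 1 f ((derive1 f) (c * x + d)).
    by rewrite derive1E; apply: DeriveDef.
  by have [_ ->] := @is_derive1_comp R f _ x _ _ h2 h1; rewrite /= mulrC.
by apply: CkM; [exact: Ck_cst|exact: IH].
Qed.

Lemma Ck_antiderivative n f g : (forall x : R, is_derive x 1 f (g x)) ->
  Ck n g -> Ck n.+1 f.
Proof.
move=> fg Cg; split=> [x|]; first by have [] := fg x.
suff -> : (derive1 f) = g by [].
by apply/funext => x; rewrite derive1E; have [] := fg x.
Qed.

End Ck.

Section flat_functions.
Variable R : realType.

(* The functions [x^-k exp (-1/x)] on [x > 0] are closed under derivation up to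
   linear combinations, and all of them extend by [0]. *)
Definition flat (k : nat) (x : R) : R :=
  if 0 < x then x ^- k * expR (- x^-1) else 0.

Lemma flat_ge0 k x : 0 <= flat k x.
Proof.
rewrite /flat; case: ifPn => // x0.
by rewrite mulr_ge0// ?expR_ge0// invr_ge0 exprn_ge0// ltW.
Qed.

(** The term of degree k + 1 in the exponential series at 1/x outweighs x^-k and leaves a spare
    factor x, which makes the difference quotients at 0 tend to 0. *)
Lemma flat_le k x : 0 < x -> flat k x <= (k.+1)`!%:R * x.
Proof.
move=> x0; rewrite /flat x0 expRN.
have := @expR_ge1Dxn R x^-1 k; rewrite invr_ge0 (ltW x0) => /(_ isT).
set e := expR _; rewrite exprVn => h.
have e0 : 0 < e by exact: expR_gt0.
have xk : 0 < x ^+ k by rewrite exprn_gt0.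
have fk : 0 < (k.+1)`!%:R :> R by rewrite ltr0n fact_gt0.
rewrite ler_pdivrMr// -ler_pdivrMl//; last by rewrite mulr_gt0.
have {}h := le_trans (ltW (ltr_pwDl ltr01 (lexx _))) h.
apply: le_trans h; rewrite exprS le_eqVlt; apply/orP; left; apply/eqP; field; rewrite ?gt_eqF//.
Qed.

Lemma is_derive_flat k (x : R) :
  is_derive x 1 (flat k) (flat k.+2 x - k%:R * flat k.+1 x).
Proof.
have [x0|x0|->] := ltgtP x 0.
- rewrite /flat !ltNge (ltW x0)/= mulr0 subr0.
  apply: (@near_is_derive _ (cst 0)).
  near=> y; rewrite ltNge (_ : y <= 0)//; near: y.
  by apply: filterS (lt_nbhsl x0) => y /ltW.
- have -> : flat k.+2 x - k%:R * flat k.+1 x =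
      (x ^+ k)^-1 * (expR (- x^-1) * (x ^- 2)) + expR (- x^-1) * (- k%:R * (x^-1) ^+ k.-1 * x ^- 2).
    rewrite /flat x0; case: k => [|k]; last first.
      by rewrite /= !exprVn !exprS; field; rewrite ?expf_neq0// !gt_eqF.
    by rewrite /=; field; rewrite gt_eqF.
  apply: (@near_is_derive _ (fun x => (x ^+ k)^-1 * expR (- x^-1))).
    near=> y; rewrite /flat (_ : 0 < y)//; near: y.
    exact: lt_nbhsr.
  have hV : is_derive x 1 (fun y : R => y^-1) (- x ^- 2).
    have := @is_deriveV R id x 1 1; rewrite gt_eqF//= => /(_ isT _).
    by move=> h; apply: is_derive_eq; rewrite /GRing.scale/= mulr1.
  have hE : is_derive x 1 (fun y : R => expR (- y^-1)) (expR (- x^-1) * x ^- 2).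
    have h : is_derive x 1 (fun y : R => - y^-1) (x ^- 2).
      by apply: is_derive_eq; rewrite opprK.
    exact: (@is_derive1_comp R expR _ x _ _ (is_derive_expR _) h).
  have hX : is_derive x 1 (fun y : R => (y ^+ k)^-1) (- k%:R * (x^-1) ^+ k.-1 * x ^- 2).
    have -> : (fun y : R => (y ^+ k)^-1) = (fun y : R => y^-1) ^+ k.
      by apply/funext => y; rewrite fctE exprVn.
    by apply: is_derive_eq; rewrite /GRing.scale/= -[in LHS]mulr_natl; ring.
  by apply: is_derive_eq.
- rewrite /flat ltxx mulr0 subr0.
  have d0 : h^-1 *: (flat k (h *: 1 + 0) - flat k 0) @[h --> 0^'] --> (0 : R).
    apply/cvgrPdist_le => e e0; near=> h.
    rewrite sub0r normrN /GRing.scale/= mulr1 addr0 {2}/flat ltxx subr0.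
    have h0 : h != 0 by near: h; exact: nbhs_dnbhs_neq.
    have [hp|hn] := ltP 0 h; last first.
      by rewrite /flat ltNge hn/= mulr0 normr0 ltW.
    (* The difference quotient at 0 is the next function of the family, so the linear bound applies
       again. *)
    have -> : h^-1 * flat k h = flat k.+1 h.
      by rewrite /flat hp exprS; field; rewrite h0 gt_eqF// exprn_gt0.
    rewrite ger0_norm ?flat_ge0//; apply: le_trans (flat_le _ hp) _.
    rewrite -ler_pdivlMl ?ltr0n ?fact_gt0// -[h]ger0_norm ?(ltW hp)//.
    near: h; apply: dnbhs0_le.
    by rewrite mulr_gt0// invr_gt0 ltr0n fact_gt0.
  by split; [apply/cvg_ex; exists 0|apply/cvg_lim].
Unshelve. all: by end_near. Qed.

Lemma Ck_flat n k : Ck n (flat k).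
Proof.
elim: n k => [//|n IH] k; apply: (Ck_antiderivative (is_derive_flat k)).
have -> : (fun x => flat k.+2 x - k%:R * flat k.+1 x) =
    flat k.+2 \+ (cst (- k%:R) \* flat k.+1).
  by apply/funext => x /=; rewrite mulNr.
by apply: CkD => //; apply: CkM => //; exact: Ck_cst.
Qed.

End flat_functions.

Section smooth_ramp.
Variable R : realType.
Implicit Types D : nat -> R -> R.

(** A smooth function is carried together with all its derivatives, so that later computations only
    shift an index. *)
Definition derivative_seq D := forall n (x : R), is_derive x 1 (D n) (D n.+1 x).

Lemma Ck_derivative_seq (f : R -> R) : (forall n, Ck n f) ->
  derivative_seq (fun n => derive1n n f).
Proof.
move=> Cf n x; rewrite derive1nS; split; last by rewrite derive1E.
elim: n f Cf => [|n IH] f Cf.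
  by have [] := Cf 1%N.
rewrite derive1Sn; apply: IH => m.
by have [] := Cf m.+1.
Qed.

(** A smoothed positive part: [D 0] stands for max(t, 0), [D 1] for the Heaviside step and [D 2] for
    a Dirac mass, with all transitions inside [-1, 1]. *)
Definition ramp_like D (C : R) :=
  [/\ forall t, t <= -1 -> D 0 t = 0 /\ D 1 t = 0,
      forall t, 1 <= t -> D 1 t = 1,
      forall t, 0 <= D 1 t <= 1,
      forall t, 0 <= D 2 t <= C &
      forall t, 1 <= `|t| -> D 2 t = 0].

(** The bump exp(-1/(1+t)) exp(-1/(1-t)) on ]-1, 1[ is divided by its integral [P 1] and integrated
    twice from the left. As the bump is at most 1, the constant C is the inverse of [P 1]. *)
Lemma smooth_ramp_exists : exists D C, derivative_seq D /\ ramp_like D C.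
Proof.
pose b0 (t : R) : R := flat 0 (1 * t + 1) * flat 0 (-1 * t + 1).
have Cb0 n : Ck n b0 by apply: CkM; apply: Ck_affine; exact: Ck_flat.
have flat1 (t : R) : flat 0 t <= 1.
  rewrite /flat; case: ifPn => // t0; rewrite expr0 invr1 mul1r.
  by rewrite -expR0 ler_expR oppr_le0 invr_ge0 ltW.
have b00 t : 0 <= b0 t by rewrite mulr_ge0// flat_ge0.
have b01 t : b0 t <= 1 by rewrite mulr_ile1// flat_ge0.
have b0p t : -1 < t < 1 -> 0 < b0 t.
  move=> t1; rewrite /b0 /flat !ifT; [|by lra|by lra].
  by rewrite !expr0 invr1 !mul1r mulr_gt0// expR_gt0.
have b0out t : 1 <= `|t| -> b0 t = 0.
  rewrite ler_normr /b0 /flat => /orP[t1|t1].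
    by rewrite [X in _ * X]ifF ?mulr0//; apply/negbTE; rewrite -leNgt; lra.
  by rewrite ifF ?mul0r//; apply/negbTE; rewrite -leNgt; lra.
have cb0 : continuous b0.
  move=> x; have [dx _] := Cb0 1%N.
  by apply/differentiable_continuous/derivable1_diffP.
have [P dP P0] : exists2 P : R -> R, (forall x : R, is_derive x 1 P (b0 x)) &
    (forall x, x <= -1 -> P x = 0).
  by apply: antiderivative => // x x1; apply: b0out; rewrite ler_normr; lra.
have P1 : 0 < P 1.
  have [|c cc] := @is_derive_mvt R P b0 (-1) 1 _ (fun x _ => dP x); first by lra.
  by rewrite (P0 (-1))// subr0 => ->; rewrite mulr_gt0 ?b0p//; lra.
have PR t : 1 <= t -> P t = P 1.
  move=> t1; apply/esym; apply: (@is_derive_eq0_const _ _ b0) => // x /andP[x1 _].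
  by apply: b0out; rewrite ler_normr; lra.
have Pmono s t : s <= t -> P s <= P t.
  by move=> st; apply: (@is_derive_ge0_le _ _ b0).
pose B t := (P 1)^-1 * P t.
have dB (x : R) : is_derive x 1 B ((P 1)^-1 * b0 x).
  by apply: is_derive_eq; rewrite /GRing.scale/=; ring.
have B0 x : x <= -1 -> B x = 0 by move=> x1; rewrite /B (P0 x)// mulr0.
have [B2 dB2 B20] : exists2 P : R -> R, (forall x : R, is_derive x 1 P (B x)) &
    (forall x, x <= -1 -> P x = 0).
  apply: antiderivative => // x; exact: (is_derive_continuous (dB x)).
have CB2 n : Ck n B2.
  apply: CkS; apply: (Ck_antiderivative dB2).
  apply: CkS; apply: (Ck_antiderivative dB).
  by apply: CkM => //; exact: Ck_cst.
exists (fun n => derive1n n B2), (P 1)^-1; split; first exact: Ck_derivative_seq.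
have E1 : derive1n 1 B2 = B.
  by apply/funext => x; rewrite derive1n1 derive1E; have [] := dB2 x.
have E2 : derive1n 2 B2 = (fun x => (P 1)^-1 * b0 x).
  by apply/funext => x; rewrite derive1nS E1 derive1E; have [] := dB x.
split.
- by move=> t t1; rewrite E1 derive1n0 B0// B20.
- by move=> t t1; rewrite E1 /B PR// mulVf// gt_eqF.
- move=> t; rewrite E1 /B ler_pdivrMl// mulr1 mulr_ge0/= ?invr_ge0 ?(ltW P1)//.
    by have [t1|/ltW/PR->//] := leP t 1; exact: Pmono.
  by have [t1|t1] := leP t (-1); [rewrite P0|rewrite -(P0 (-1))// Pmono// ltW].
- move=> t; rewrite E2 mulr_ge0//= ?invr_ge0 ?(ltW P1)//.
  by rewrite ler_piMr// invr_ge0 ltW.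
- by move=> t t1; rewrite E2 b0out// mulr0.
Qed.

(** Both [D 0 t] and [t - D 0 t] are nondecreasing. Hence [D 0] stays between 0 and t + 1 on the
    transition zone, and beyond t = 1 the difference [t - D 0 t] is frozen. *)
Lemma ramp_like_dist D C (t : R) : derivative_seq D -> ramp_like D C ->
  `|D 0 t - Num.max t 0| <= 2.
Proof.
move=> dD [D0 D1 D01 _ _].
have up s u : s <= u -> D 0 s <= D 0 u.
  move=> su; apply: (@is_derive_ge0_le _ _ (D 1)) => // x _.
  by have /andP[] := D01 x.
have lip s u : s <= u -> u - D 0 u >= s - D 0 s.
  move=> su; apply: (@is_derive_ge0_le _ (fun x => x - D 0 x) (fun x => 1 - D 1%N x)) => // x _.
    have h := dD 0%N x; exact: is_derive_eq.
  by rewrite subr_ge0; have /andP[] := D01 x.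
have Dm1 : D 0 (-1) = 0 by have [] := D0 (-1) (lexx _).
have [t1|t1] := leP t (-1).
  by have [-> _] := D0 _ t1; rewrite max_r ?subrr ?normr0//; lra.
have [t1'|t1'] := leP t 1.
  have := up _ _ (ltW t1); have := lip _ _ (ltW t1); rewrite Dm1.
  by move=> ? ?; case: (leP t 0) => ?; rewrite ler_norml; lra.
have -> : D 0 t = t - (1 - D 0 1).
  suff : t - D 0 t = 1 - D 0 1 by lra.
  apply/esym; apply: (@is_derive_eq0_const _ (fun x => x - D 0 x) (fun x => 1 - D 1%N x)) ; first exact: ltW.
    by move=> x _; have h := dD 0%N x; exact: is_derive_eq.
  by move=> x /andP[x1 _]; rewrite D1 ?subrr// ltW.
have := up (-1) 1; have := lip (-1) 1; rewrite Dm1 => h1 h2.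
have {}h1 : -1 <= 1 - D 0 1 by have := h1 ltac:(lra); lra.
have {}h2 : 0 <= D 0 1 by apply: h2; lra.
by rewrite max_l; [rewrite ler_norml; lra|lra].
Qed.

End smooth_ramp.

(** * Radial test functions *)

Section radial_test_functions.
Variable R : realType.
Implicit Types (f : R * R -> R) (z : R * R).

Definition sqn z : R := z.1 ^+ 2 + z.2 ^+ 2.

Lemma sqn_ge0 z : 0 <= sqn z.
Proof. by rewrite /sqn addr_ge0// sqr_ge0. Qed.

Lemma enorm_ge0 z : 0 <= enorm z. Proof. exact: sqrtr_ge0. Qed.

Lemma sqr_enorm z : enorm z ^+ 2 = sqn z.
Proof. by rewrite sqr_sqrtr// sqn_ge0. Qed.

Lemma continuous_sqn : continuous sqn.
Proof.
by move=> z; apply: cvgD; rewrite expr2; apply: cvgM;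
  first [exact: cvg_fst|exact: cvg_snd].
Qed.

Definition slice (i : bool) f z : R -> R :=
  fun t => f (if i then (z.1, t) else (t, z.2)).

Definition coord (i : bool) z : R := if i then z.2 else z.1.

(** The difference quotient along a coordinate axis is that of the slice, so every partial
    derivative below is computed in one variable. *)
Lemma is_derive_slice (i : bool) f z (d : R) :
  is_derive (coord i z) 1 (slice i f z) d ->
  derivable f z (if i then (0, 1) else (1, 0)) /\ partial i f z = d.
Proof.
set v : R * R := if i then _ else _.
have H : (fun h : R => h^-1 *: (f (h *: v + z) - f z)) =
   (fun h : R => h^-1 *: (slice i f z (h *: (1 : R) + coord i z) - slice i f z (coord i z))).
  apply/funext => h; rewrite /slice /coord /v; case: i v => v; congr (_ *: (f _ - f _)).
  - apply: injective_projections => //.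
    by rewrite -[LHS]/(h * 0 + z.1) mulr0 add0r.
  - by case: z.
  - apply: injective_projections => //.
    by rewrite -[LHS]/(h * 0 + z.2) mulr0 add0r.
  - by case: z.
by move=> [dv <-]; rewrite /derivable /partial /derive -/v H.
Qed.

Variables (E : nat -> R -> R) (dE : derivative_seq E).

(* A class closed under partial derivatives that contains the functions of [|z|^2]. *)
Inductive radial_poly : (R * R -> R) -> Prop :=
| RPbase a b j : radial_poly (fun z => z.1 ^+ a * z.2 ^+ b * E j (sqn z))
| RPadd f g : radial_poly f -> radial_poly g -> radial_poly (fun z => f z + g z)
| RPscale c f : radial_poly f -> radial_poly (fun z => c * f z).

Lemma radial_poly_continuous f : radial_poly f -> continuous f.
Proof.
elim=> [a b j|{}f g _ cf _ cg|c {}f _ cf] z.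
- have cE := is_derive_continuous (dE j (sqn z)).
  have cpow (h : R * R -> R) n : h @ z --> h z -> (h y ^+ n) @[y --> z] --> h z ^+ n.
    by move=> hz; apply: (@continuous_comp _ _ _ h (fun x => x ^+ n)) => //; exact: exprn_continuous.
  apply: cvgM; first by apply: cvgM; apply: cpow; [exact: cvg_fst|exact: cvg_snd].
  by apply: (@continuous_comp _ _ _ sqn (E j)); [exact: continuous_sqn|exact: cE].
- by apply: cvgD; [exact: cf|exact: cg].
- by apply: cvgM; [exact: cvg_cst|exact: cf].
Qed.

Lemma radial_poly_partial f : radial_poly f -> forall i,
  exists2 g, radial_poly g &
    forall z, is_derive (coord i z) 1 (slice i f z) (g z).
Proof.
have dEc j (c x : R) :
    is_derive x 1 (fun t => E j (t ^+ 2 + c)) (E j.+1 (x ^+ 2 + c) * (2 * x)).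
  have h : is_derive x 1 (fun t => t ^+ 2 + c) (2 * x).
    by apply: is_derive_eq; rewrite /GRing.scale/=; ring.
  exact: (@is_derive1_comp R (E j) _ x _ _ (dE j _) h).
have dpow (x : R) n : is_derive x 1 (fun t : R => t ^+ n) (n%:R * x ^+ n.-1).
  have -> : (fun t : R => t ^+ n) = (id : R -> R) ^+ n by apply/funext => t; rewrite fctE.
  by apply: is_derive_eq; rewrite /GRing.scale/= -[in LHS]mulr_natl; ring.
elim=> [a b j|{}f g _ df _ dg|c {}f _ df] i.
- case: i.
    (* For b = 0 the truncated exponent [b.-1] is harmless: its coefficient is 0. *)
    exists (fun z => b%:R * (z.1 ^+ a * z.2 ^+ b.-1 * E j (sqn z)) +
                     2 * (z.1 ^+ a * z.2 ^+ b.+1 * E j.+1 (sqn z))).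
      by apply: RPadd; apply: RPscale; exact: RPbase.
    move=> [x y]; rewrite /slice /sqn/=.
    have -> : (fun t => x ^+ a * t ^+ b * E j (x ^+ 2 + t ^+ 2)) =
              (fun t => x ^+ a * (t ^+ b * E j (t ^+ 2 + x ^+ 2))).
      by apply/funext => t; rewrite mulrA [_ + t ^+ 2]addrC.
    have h1 := dpow y b; have h2 := dEc j (x ^+ 2) y.
    by apply: is_derive_eq; rewrite /GRing.scale/= [x ^+ 2 + _]addrC [y ^+ b.+1]exprS; ring.
  exists (fun z => a%:R * (z.1 ^+ a.-1 * z.2 ^+ b * E j (sqn z)) +
                   2 * (z.1 ^+ a.+1 * z.2 ^+ b * E j.+1 (sqn z))).
    by apply: RPadd; apply: RPscale; exact: RPbase.
  move=> [x y]; rewrite /slice /sqn/=.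
  have -> : (fun t => t ^+ a * y ^+ b * E j (t ^+ 2 + y ^+ 2)) =
            (fun t => y ^+ b * (t ^+ a * E j (t ^+ 2 + y ^+ 2))).
    by apply/funext => t; rewrite mulrA [y ^+ b * _]mulrC.
  have h1 := dpow x a; have h2 := dEc j (y ^+ 2) x.
  by apply: is_derive_eq; rewrite /GRing.scale/= [x ^+ a.+1]exprS; ring.
- have [f' rf' ff'] := df i; have [g' rg' gg'] := dg i.
  exists (fun z => f' z + g' z); first exact: RPadd.
  by move=> z; have h1 := ff' z; have h2 := gg' z; apply: is_derive_eq.
- have [f' rf' ff'] := df i; exists (fun z => c * f' z); first exact: RPscale.
  move=> z; have h1 := ff' z; apply: is_derive_eq; rewrite /GRing.scale/=; ring.
Qed.

Lemma radial_poly_of_class_C n f : radial_poly f -> of_class_C n f.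
Proof.
elim: n f => [|n IH] f rf; first exact: radial_poly_continuous.
split=> [|i]; first exact: radial_poly_continuous.
have [g rg fg] := radial_poly_partial rf i.
split; first by move=> z; have [] := is_derive_slice (fg z).
suff -> : partial i f = g by exact: IH.
by apply/funext => z; have [] := is_derive_slice (fg z).
Qed.

Lemma compact_square (S : R) : compact (`[- S, S] `*` `[- S, S]).
Proof. by apply: compact_setX; exact: segment_compact. Qed.

(** The half-side S + 1 avoids a square root: x^2 <= S forces |x| <= S + 1. *)
Lemma sqn_le_square (S : R) z : sqn z <= S -> (`[- (S + 1), S + 1] `*` `[- (S + 1), S + 1]) z.
Proof.
case: z => x y; rewrite /sqn/= => xyS.
by split; rewrite /= in_itv/= -ler_norml; apply: le_trans (_ : S + 1 >= _) => //;
  rewrite ler_norml; nra.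
Qed.

(** E is smooth on the whole line and may be nonzero at s = 0, so these test functions see the
    origin. The Laplacian of E(|z|^2) is 4 (s E')' at s = |z|^2. *)
Lemma radial_test_function (S : R) : (forall s, S <= s -> E 0 s = 0) ->
  test_function (fun z => E 0 (sqn z)) /\
  laplacian (fun z => E 0 (sqn z)) =
    (fun z => 4 * (E 1 (sqn z) + sqn z * E 2 (sqn z))).
Proof.
move=> E0; pose phi a b j z := z.1 ^+ a * z.2 ^+ b * E j (sqn z).
have phiE : (fun z => E 0 (sqn z)) = phi 0%N 0%N 0%N.
  by apply/funext => z; rewrite /phi !mul1r.
split.
- split=> [n|].
    by rewrite phiE; apply: radial_poly_of_class_C; exact: RPbase.
  apply: (subclosed_compact _ (@compact_square (S + 1))); first exact: closed_closure.
  have cS : closed (`[- (S + 1), S + 1] `*` `[- (S + 1), S + 1] : set (R * R)).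
    apply: compact_closed; [exact: norm_hausdorff|exact: compact_square].
  rewrite closureE => z; apply; split=> // w /= w0; apply: sqn_le_square.
  by rewrite leNgt; apply: contra w0 => /ltW/E0 ->.
- have dEc j (c x : R) :
      is_derive x 1 (fun t => E j (t ^+ 2 + c)) (E j.+1 (x ^+ 2 + c) * (2 * x)).
    have h : is_derive x 1 (fun t => t ^+ 2 + c) (2 * x).
      by apply: is_derive_eq; rewrite /GRing.scale/=; ring.
    exact: (@is_derive1_comp R (E j) _ x _ _ (dE j _) h).
  have p1 i : partial i (fun z => E 0 (sqn z)) = (fun z => E 1 (sqn z) * (2 * coord i z)).
    apply/funext => z; apply: (is_derive_slice _).2.
    rewrite /slice /coord /sqn; case: i => /=.
      rewrite (_ : (fun t => _) = (fun t => E 0 (t ^+ 2 + z.1 ^+ 2))); last first.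
        by apply/funext => t; rewrite addrC.
      by rewrite [_ + z.2 ^+ 2]addrC; exact: dEc.
    exact: dEc.
  have p2 i : partial i (fun z => E 1 (sqn z) * (2 * coord i z)) =
     (fun z => 2 * E 1 (sqn z) + 4 * (coord i z) ^+ 2 * E 2 (sqn z)).
    apply/funext => z; apply: (is_derive_slice _).2.
    rewrite /slice /coord /sqn; case: i => /=.
      rewrite (_ : (fun t => _) = (fun t => E 1 (t ^+ 2 + z.1 ^+ 2) * (2 * t))); last first.
        by apply/funext => t; rewrite addrC.
      rewrite [_ + z.2 ^+ 2]addrC; have h := dEc 1%N (z.1 ^+ 2) z.2.
      by apply: is_derive_eq; rewrite /GRing.scale/=; ring.
    have h := dEc 1%N (z.2 ^+ 2) z.1.
    by apply: is_derive_eq; rewrite /GRing.scale/=; ring.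
  apply/funext => z; rewrite /laplacian !p1 !p2 /= /sqn; ring.
Qed.

End radial_test_functions.

(** * Polar coordinates *)

Section polar.
Variable R : realType.
Local Notation lam := (@lebesgue_measure R).
Local Notation lam2 := (@lebesgue2 R).
Local Notation plane := (measurableTypeR R * measurableTypeR R)%type.
Local Open Scope ereal_scope.

(** The uniqueness of Lebesgue measure concerns the whole line, so m / c on the half line is
    completed by Lebesgue measure itself on the complement. *)
Lemma measure_half_line (m : {measure set (measurableTypeR R) -> \bar R}) (c e : R) :
  (0 < c)%R ->
  (forall a b : R, (e <= a)%R -> (a <= b)%R -> m `]a, b]%classic = (c * (b - a))%:E) ->
  forall A : set (measurableTypeR R), measurable A -> A `<=` `]e, +oo[%classic -> m A = c%:E * lam A.
Proof.
move=> c0 mE.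
have mD : measurable (`]e, +oo[%classic : set (measurableTypeR R)) by [].
have mC : measurable (~` `]e, +oo[%classic : set (measurableTypeR R)) by exact: measurableC.
have ci0 : (0 <= c^-1)%R by rewrite invr_ge0 ltW.
pose m' : {measure set (measurableTypeR R) -> \bar R} :=
  measure_add (mscale (NngNum ci0) (mrestr m mD)) (mrestr lam mC).
have m'E A : m' A = (c^-1)%:E * m (A `&` `]e, +oo[%classic) + lam (A `&` ~` `]e, +oo[%classic).
  by rewrite [LHS]measure_addE.
have lamE A : measurable A -> lam A = m' A.
  apply: lebesgue_measure_unique => _ [[a b] _ <-] /=.
  have [ba|/ltW ab] := leP b a; first by rewrite set_itv_ge ?bnd_simp -?leNgt// !measure0.
  have [a0|a0] := leP e a.
    rewrite m'E (_ : _ `&` _ = `]a, b]%classic); last first.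
      apply/seteqP; split=> x /=; rewrite !in_itv/= ?andbT; first by case.
      by move=> /andP[ax xb]; rewrite ax xb (le_lt_trans a0).
    rewrite (_ : _ `&` _ = set0); last first.
      apply/seteqP; split=> x //=; rewrite !in_itv/= andbT => -[/andP[ax _]]; apply.
      exact: le_lt_trans ax.
    rewrite measure0 adde0 mE// lebesgue_measure_itv/= lte_fin.
    rewrite -EFinM mulKf ?gt_eqF//.
    by case: ltgtP ab => // -> _; rewrite subrr.
  have [b0|b0] := leP b e.
    rewrite m'E (_ : _ `&` _ = set0); last first.
      apply/seteqP; split=> x //=; rewrite !in_itv/= andbT => -[/andP[_ xb]].
      by rewrite ltNge (le_trans xb).
    rewrite measure0 mule0 add0e (_ : _ `&` _ = `]a, b]%classic)//.
    apply/seteqP; split=> x /=; first by case.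
    move=> xab; split=> //; move: xab; rewrite !in_itv/= andbT => /andP[_ xb].
    by apply/negP; rewrite -leNgt (le_trans xb).
  rewrite m'E (_ : _ `&` _ = `]e, b]%classic); last first.
    apply/seteqP; split=> x /=; rewrite !in_itv/= ?andbT.
      by move=> [/andP[_ ->] ->].
    by move=> /andP[x0 xb]; rewrite x0 xb (lt_trans a0).
  rewrite (_ : _ `&` _ = `]a, e]%classic); last first.
    apply/seteqP; split=> x /=; rewrite !in_itv/= ?andbT.
      by move=> [/andP[-> _]] /negP; rewrite -leNgt.
    by move=> /andP[ax x0]; rewrite ax (le_trans x0 (ltW b0)); split=> //; apply/negP; rewrite -leNgt.
  rewrite mE// ?ltW// !lebesgue_measure_itv/= !lte_fin a0 (lt_trans a0 b0).
  by rewrite -EFinM mulKf ?gt_eqF// -!EFinD; congr EFin; ring.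
move=> A mA A0; rewrite lamE// m'E.
rewrite (_ : A `&` ~` _ = set0); last first.
  by apply/seteqP; split=> x //= [/A0].
rewrite measure0 adde0 (_ : _ `&` _ = A); last first.
  by apply/seteqP; split=> x /=; [case|move=> Ax; split=> //; exact: A0].
by rewrite muleA -EFinM mulfV ?mul1e// gt_eqF.
Qed.

Lemma measurable_sqn : measurable_fun [set: plane] (@sqn R : plane -> measurableTypeR R).
Proof.
apply: measurable_funD; apply: measurable_funX.
  exact: measurable_fst.
exact: measurable_snd.
Qed.

(** The substitution x = r sin t turns the integrand into 2 r^2 cos^2 t, with antiderivative r^2 (t
    + sin t cos t). *)
Let half_disc_integral (r : R) : (0 < r)%R ->
  \int[lam]_(x in `[(- r)%R, r]) (2 * Num.sqrt (r ^+ 2 - x ^+ 2))%:E = (pi * r ^+ 2)%:E.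
Proof.
move=> r0.
pose F (t : R) := (r * sin t)%R.
have dF (t : R) : is_derive t (1:R)%R F (r * cos t)%R.
  by apply: is_derive_eq; rewrite /GRing.scale/=; ring.
have F' : derive1 F = (fun t => r * cos t)%R.
  by apply/funext => t; rewrite derive1E; have [] := dF t.
have cF' : continuous (derive1 F).
  by rewrite F' => t; apply: cvgM; [exact: cvg_cst|exact: continuous_cos].
have cF : continuous F by move=> t; exact: (is_derive_continuous (dF t)).
have pi0 := pi_gt0 R.
have Fa : F (- (pi / 2))%R = (- r)%R by rewrite /F sinN sin_pihalf mulrN1.
have Fb : F (pi / 2)%R = r by rewrite /F sin_pihalf mulr1.
have Lo (f df : R -> R) (a b : R) : (forall t : R, is_derive t (1:R)%R f (df t)) ->
    derivable_oo_LRcontinuous f a b.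
  move=> df'; have cf t := is_derive_continuous (df' t); split.
  - by move=> t _; have [] := df' t.
  - exact/cvg_at_right_filter/cf.
  - exact/cvg_at_left_filter/cf.
rewrite -[X in `[X, _]]Fa -[X in `[_, X]]Fb.
rewrite integration_by_substitution_increasing; last 7 first.
- lra.
- by move=> x y xI yI xy; rewrite /F ltr_pM2l// ltr_sin.
- by move=> x _; exact: cF'.
- by apply: cvgP; apply: cvg_at_right_filter; exact: cF'.
- by apply: cvgP; apply: cvg_at_left_filter; exact: cF'.
- exact: Lo.
- apply: continuous_subspaceT => x; apply: cvgM; first exact: cvg_cst.
  apply: (@continuous_comp _ _ _ (fun x : R => (r ^+ 2 - x ^+ 2)%R) Num.sqrt).
    by apply: cvgB; [exact: cvg_cst|rewrite expr2; apply: cvgM].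
  exact: sqrt_continuous.
pose G (t : R) := (r ^+ 2 * (t + sin t * cos t))%R.
have dG (t : R) : is_derive t (1:R)%R G (2 * r ^+ 2 * cos t ^+ 2)%R.
  by apply: is_derive_eq; rewrite /GRing.scale/=; have := cos2Dsin2 t; nra.
rewrite (eq_integral (fun t : measurableTypeR R => (2 * r ^+ 2 * cos t ^+ 2)%:E)); last first.
  move=> t; rewrite inE/= in_itv/= => tI; rewrite F' fctE/= /F.
  have c0 : (0 <= cos t)%R by exact: cos_ge0_pihalf.
  rewrite (_ : r ^+ 2 - (r * sin t) ^+ 2 = (r * cos t) ^+ 2)%R; last first.
    by rewrite !exprMn cos2sin2; ring.
  rewrite sqrtr_sqr ger0_norm; last by rewrite mulr_ge0// ltW.
  by congr EFin; ring.
rewrite (@continuous_FTC2 _ _ G); last 4 first.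
- lra.
- apply: continuous_subspaceT => t; apply: cvgM; first exact: cvg_cst.
  by rewrite expr2; apply: cvgM; exact: continuous_cos.
- exact: Lo.
- by move=> t _; rewrite derive1E; have [] := dG t.
by rewrite /G sinN sin_pihalf cosN cos_pihalf -EFinD; congr EFin; field.
Qed.

Lemma disc_area (t : R) : (0 <= t)%R ->
  lam2 [set z : plane | (sqn z <= t)%R] = (pi * t)%:E.
Proof.
move=> t0; rewrite /lebesgue2/= /product_measure1.
(* The formula covers the empty sections too, as the square root of a negative number is 0 by
   convention. *)
rewrite (eq_integral (fun x : measurableTypeR R => (2 * Num.sqrt (t - x ^+ 2))%:E)); last first.
  move=> x _ /=; have [xt|xt] := leP (x ^+ 2)%R t.
    rewrite (_ : xsection _ _ = `[(- Num.sqrt (t - x ^+ 2))%R, Num.sqrt (t - x ^+ 2)%R]%classic).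
      rewrite lebesgue_measure_itv/= lte_fin.
      move: (Num.sqrt _) (sqrtr_ge0 (t - x ^+ 2)) => s s0.
      case: ifPn => [_|]; first by rewrite -EFinD; congr EFin; ring.
      by rewrite -leNgt => s1; congr EFin; lra.
    rewrite xsectionE; apply/seteqP; split=> y /=; rewrite /sqn/= in_itv/= -ler_norml => h.
      by rewrite -sqrtr_sqr ler_wsqrtr// lerBrDl.
    rewrite -lerBrDl -[leRHS]sqr_sqrtr ?subr_ge0// -[leLHS]real_normK ?num_real//.
    by rewrite ler_sqr// nnegrE ?sqrtr_ge0.
  rewrite (_ : xsection _ _ = set0) ?measure0.
    by rewrite ler0_sqrtr ?mulr0// subr_le0 ltW.
  rewrite xsectionE; apply/seteqP; split=> y //=; rewrite /sqn/=.
  by move=> /(lt_le_trans (lt_le_trans xt _)); rewrite lerDl sqr_ge0 ltxx => /(_ isT).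
have [t_gt0|] := ltP 0%R t; last first.
  move=> t_le0; have -> : t = 0%R by lra.
  rewrite mulr0 integral0_eq// => x _; rewrite ler0_sqrtr ?mulr0//.
  by rewrite sub0r oppr_le0 sqr_ge0.
pose r := Num.sqrt t; have r0 : (0 < r)%R by rewrite sqrtr_gt0.
have tE : t = (r ^+ 2)%R by rewrite sqr_sqrtr.
rewrite tE -half_disc_integral// [RHS]integral_mkcond; apply: eq_integral => x _.
rewrite patchE; case: ifPn => //; rewrite notin_setE/= in_itv/= -ler_norml => /negP.
rewrite -ltNge => rx; rewrite ler0_sqrtr ?mulr0//.
rewrite subr_le0 -[leRHS]real_normK ?num_real// ler_sqr ?nnegrE ?normr_ge0 ?(ltW r0)//.
exact: ltW.
Qed.

Definition radial_measure : {measure set (measurableTypeR R) -> \bar R} :=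
  measure_function_pushforward__canonical__measure_function_Measure lam2 measurable_sqn.

(** An annulus a < |z|^2 <= b has area pi (b - a): in the variable s = |z|^2 polar coordinates carry
    the constant density pi, which is the reason for preferring s to |z|. *)
Lemma pushforward_sqn (A : set (measurableTypeR R)) : measurable A ->
  A `<=` `]0%R, +oo[%classic -> radial_measure A = pi%:E * lam A.
Proof.
move=> mA A0.
apply: (measure_half_line (m := radial_measure) (e := 0%R) (pi_gt0 R)) => // a b a0 ab.
rewrite -[LHS]/(lam2 (_ @^-1` _)).
have mle t : measurable [set z : plane | (sqn z <= t)%R].
  rewrite -[X in measurable X]setTI.
  have := measurable_sqn measurableT (measurable_itv `]-oo, t]).
  by congr (measurable _); apply/seteqP; split=> z /=; rewrite in_itv.
rewrite (_ : _ @^-1` _ = [set z : plane | (sqn z <= b)%R] `\` [set z | (sqn z <= a)%R]).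
  rewrite measureD//; last by have := disc_area (le_trans a0 ab) => /= ->; rewrite ltry.
  rewrite (_ : _ `&` _ = [set z : plane | (sqn z <= a)%R]).
    transitivity ((pi * b)%:E - (pi * a)%:E); last by rewrite -EFinD mulrBr.
    by congr (_ - _); apply: disc_area => //; exact: le_trans ab.
  apply/seteqP; split=> z /=; first by case.
  by move=> za; split => //; rewrite (le_trans za).
apply/seteqP; split=> z /=; rewrite in_itv/= ltNge.
  by move=> /andP[/negP].
by move=> [-> /negP ->].
Qed.

Lemma lebesgue2_origin : lam2 ((@sqn R) @^-1` (~` `]0%R, +oo[%classic)) = 0.
Proof.
rewrite (_ : _ @^-1` _ = [set z : plane | (sqn z <= 0)%R]).
  by rewrite disc_area// mulr0.
by apply/seteqP; split=> z /=; rewrite in_itv/= andbT leNgt => /negP.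
Qed.

Lemma measurable_preimage_sqn (A : set (measurableTypeR R)) : measurable A ->
  measurable ((@sqn R : plane -> measurableTypeR R) @^-1` A).
Proof. by move=> mA; rewrite -[X in measurable X]setTI; exact: measurable_sqn. Qed.

Lemma ge0_polar (f : measurableTypeR R -> \bar R) : measurable_fun setT f -> (forall s, 0 <= f s) ->
  \int[lam2]_z f (sqn z) = pi%:E * \int[lam]_(s in `]0%R, +oo[) f s.
Proof.
move=> mf f0; pose D := `]0%R, +oo[%classic : set (measurableTypeR R).
have mD : measurable D by exact: measurable_itv.
have mTD : measurable ((@sqn R : plane -> measurableTypeR R) @^-1` D).
  exact: measurable_preimage_sqn.
have mfT : measurable_fun setT (fun z : plane => f (sqn z)).
  by apply: measurableT_comp => //; exact: measurable_sqn.
rewrite -(setUv ((@sqn R : plane -> measurableTypeR R) @^-1` D)) ge0_integral_setU//; last 3 first.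
- exact: measurableC.
- by rewrite setUv.
- by apply/disj_setPCl.
rewrite [X in _ + X]null_set_integral ?adde0; last 3 first.
- exact: measurableC.
- exact: measurable_funTS.
- exact: lebesgue2_origin.
transitivity (\int[radial_measure]_(y in D) f y).
  by rewrite -[radial_measure : set _ -> _]/(pushforward lam2 (@sqn R)) ge0_integral_pushforward//; [exact: measurable_sqn|exact: measurable_funTS].
rewrite (@eq_measure_integral _ _ _ D (mscale (NngNum (pi_ge0 R)) lam)); last first.
  by move=> A mA AD; rewrite pushforward_sqn.
by rewrite ge0_integral_mscale//; exact: measurable_funTS.
Qed.

Lemma polar_integrable (f : measurableTypeR R -> \bar R) : measurable_fun setT f ->
  lam2.-integrable setT (fun z => f (sqn z)) <-> lam.-integrable `]0%R, +oo[ f.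
Proof.
move=> mf.
have mf' : measurable_fun setT (fun s => `|f s|) by exact: measurableT_comp.
have mfT : measurable_fun setT (fun z : plane => f (sqn z)).
  by apply: measurableT_comp => //; exact: measurable_sqn.
have E := ge0_polar mf' (fun s => abse_ge0 (f s)).
split=> /integrableP[_ h]; apply/integrableP; split=> //; move: h; rewrite /= E.
- by move=> _; exact: measurable_funTS.
- by rewrite !ltey; apply: contraNN => /eqP ->; rewrite gt0_muley ?lte_fin ?pi_gt0.
- by move=> h; rewrite lte_mul_pinfty// lee_fin pi_ge0.
Qed.

Lemma polar (f : measurableTypeR R -> \bar R) : measurable_fun setT f ->
  lam2.-integrable setT (fun z => f (sqn z)) ->
  \int[lam2]_z f (sqn z) = pi%:E * \int[lam]_(s in `]0%R, +oo[) f s.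
Proof.
move=> mf /(polar_integrable mf) fi.
rewrite [LHS]integralE.
rewrite (_ : (fun z => f (sqn z))^\+ = (fun z => f^\+ (sqn z))); last by apply/funext => z; rewrite !funeposE.
rewrite (_ : (fun z => f (sqn z))^\- = (fun z => f^\- (sqn z))); last by apply/funext => z; rewrite !funenegE.
rewrite ge0_polar//; last exact: measurable_funepos.
rewrite ge0_polar//; last exact: measurable_funeneg.
have -> : \int[lam]_(s in `]0%R, +oo[) f s = \int[lam]_(s in `]0%R, +oo[) f^\+ s -
    \int[lam]_(s in `]0%R, +oo[) f^\- s by exact: integralE.
rewrite [RHS]muleBr//; apply: fin_num_adde_defl.
by rewrite fin_numN; apply: integrable_fin_num => //; exact: integrable_funeneg.
Qed.

End polar.

(** * Measurable profiles of radial functions *)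

Section radial_measurable.
Variable R : realType.
Local Notation lam := (@lebesgue_measure R).
Local Notation lam2 := (@lebesgue2 R).
Local Notation plane := (measurableTypeR R * measurableTypeR R)%type.
Local Open Scope ereal_scope.

(* The image of [2 x dx] on the half line under [x |-> x^2 + c] is Lebesgue
   measure; [2 x dx] is realised as the area below the graph of [2 x]. *)
Lemma sqrt_preimage_null (c : R) (N : set (measurableTypeR R)) : measurable N -> lam N = 0 ->
  lam (`]c, +oo[%classic `&` (fun s : measurableTypeR R => Num.sqrt (s - c)%R : measurableTypeR R) @^-1` N) = 0.
Proof.
move=> mN N0.
have mfst : measurable_fun [set: plane] (fst : plane -> measurableTypeR R) by exact: measurable_fst.
have msnd : measurable_fun [set: plane] (snd : plane -> measurableTypeR R) by exact: measurable_snd.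
pose W := [set z : plane | [&& 0 < z.1, 0 < z.2 & z.2 <= 2 * z.1]%R].
have mW : measurable W.
  rewrite [X in measurable X](_ : _ = ((fst : plane -> measurableTypeR R) @^-1` `]0%R, +oo[%classic) `&`
    (((snd : plane -> measurableTypeR R) @^-1` `]0%R, +oo[%classic) `&`
     ((fun z : plane => (z.2 - 2 * z.1)%R : measurableTypeR R) @^-1` `]-oo, 0%R]%classic))); last first.
    apply/seteqP; split=> z /=; rewrite !in_itv/= !andbT subr_le0; first by case/and3P.
    by case=> h1 [h2 h3]; apply/and3P; split.
  apply: measurableI; first by rewrite -[X in measurable X]setTI; exact: mfst.
  apply: measurableI; first by rewrite -[X in measurable X]setTI; exact: msnd.
  rewrite -[X in measurable X]setTI.
  have : measurable_fun [set: plane] (fun z : plane => (z.2 - 2 * z.1)%R : measurableTypeR R).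
    by apply: measurable_funB => //; apply: measurable_funM.
  by apply.
have mphi : measurable_fun [set: plane] (fun z : plane => (z.1 ^+ 2 + c)%R : measurableTypeR R).
  by apply: measurable_funD => //; exact: measurable_funX.
have mphi' := mphi.
pose m : {measure set (measurableTypeR R) -> \bar R} :=
  measure_function_pushforward__canonical__measure_function_Measure (mrestr lam2 mW) mphi.
have mE (A : set (measurableTypeR R)) : m A = lam2 ((fun z : plane => (z.1 ^+ 2 + c)%R : measurableTypeR R) @^-1` A `&` W) by [].
have mI (a b : R) : (c <= a)%R -> (a <= b)%R -> m `]a, b]%classic = (1 * (b - a))%:E.
  move=> ca ab; rewrite mE mul1r /lebesgue2/= /product_measure1.
  rewrite le_eqVlt in ab; case/predU1P : ab => [<-|ab].
    rewrite subrr integral0_eq// => x _ /=; rewrite (_ : xsection _ _ = set0) ?measure0//.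
    rewrite xsectionE; apply/seteqP; split=> y //= -[]; rewrite in_itv/= => /andP[h1 h2] _.
    by move: (lt_le_trans h1 h2); rewrite ltxx.
  have sab : (Num.sqrt (a - c) < Num.sqrt (b - c))%R by rewrite ltr_sqrt; lra.
  transitivity (\int[lam]_(x in `]Num.sqrt (a - c), Num.sqrt (b - c)]%classic) (2 * x)%:E); last first.
    rewrite integral_itv_obnd_cbnd; last first.
      by apply: measurableT_comp => //; apply: measurable_funM.
    rewrite (@continuous_FTC2 _ _ (fun x => x ^+ 2)%R)//.
    - by rewrite !sqr_sqrtr; [rewrite -EFinD; congr EFin; lra|lra|lra].
    - by apply: continuous_subspaceT => x; apply: cvgM => //; exact: cvg_cst.
    - have cX : continuous (fun x : R => x ^+ 2)%R by exact: exprn_continuous.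
      by split=> //; [exact/cvg_at_right_filter/cX|exact/cvg_at_left_filter/cX].
    - by move=> x _; rewrite derive1E exp_derive/= expr1 /GRing.scale/= mulr1.
  rewrite [RHS]integral_mkcond; apply: eq_integral => x _; rewrite patchE /=.
  have [xI|xI] := boolP (x \in `]Num.sqrt (a - c), Num.sqrt (b - c)]%classic).
    have {xI} /andP[ax xb] : (Num.sqrt (a - c) < x <= Num.sqrt (b - c))%R by move: xI; rewrite inE/= in_itv.
    have x0 : (0 < x)%R by rewrite (le_lt_trans _ ax)// sqrtr_ge0.
    rewrite (_ : xsection _ _ = `]0%R, (2 * x)%R]%classic).
      by rewrite lebesgue_measure_itv/= lte_fin mulr_gt0// -EFinD subr0.
    rewrite xsectionE; apply/seteqP; split=> y /=; rewrite !in_itv/=; first by case=> _ /and3P[_ -> ->].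
    move=> /andP[y0 y2x]; split; last by apply/and3P.
    have : (a - c < x ^+ 2)%R.
      rewrite -[ltLHS]sqr_sqrtr; last lra.
      by rewrite ltr_pXn2r// ?nnegrE ?sqrtr_ge0// ltW.
    have : (x ^+ 2 <= b - c)%R.
      rewrite -[leRHS]sqr_sqrtr; last lra.
      by rewrite ler_pXn2r// ?nnegrE ?sqrtr_ge0// ltW.
    by move=> ? ?; lra.
  rewrite (_ : xsection _ _ = set0) ?measure0//.
  rewrite xsectionE; apply/seteqP; split=> y //=; rewrite !in_itv/= => -[/andP[h1 h2] /and3P[x0 _ _]].
  move: xI; rewrite notin_setE/= in_itv/=; apply; apply/andP; split.
    by rewrite -[ltRHS]ger0_norm ?(ltW x0)// -sqrtr_sqr ltr_sqrt ?exprn_gt0//; lra.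
  by rewrite -[leLHS]ger0_norm ?(ltW x0)// -sqrtr_sqr ler_wsqrtr//; lra.
have msq : measurable_fun [set: measurableTypeR R] (fun s : measurableTypeR R => Num.sqrt (s - c)%R : measurableTypeR R).
  apply: continuous_measurable_fun => x.
  apply: (@continuous_comp _ _ _ (fun x : R => (x - c)%R) Num.sqrt); last exact: sqrt_continuous.
  by apply: cvgB => //; exact: cvg_cst.
set A := (X in lam X).
have mA : measurable A.
  apply: measurableI; first exact: measurable_itv.
  by rewrite -[X in measurable X]setTI; exact: msq.
have AE : m A = 1%:E * lam A by apply: (measure_half_line ltr01 mI) => //; exact: subIsetl.
rewrite -[LHS]mul1e -AE mE; apply/eqP; rewrite eq_le measure_ge0 andbT.
apply: (@le_trans _ _ (lam2 (N `*` setT))); last first.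
  have -> : lam2 (N `*` setT) = lam N * lam setT by exact: product_measure1E.
  by rewrite N0 mul0e.
apply: le_measure; rewrite ?inE.
- apply: measurableI => //; rewrite -[X in measurable X]setTI; exact: mphi'.
- exact: measurableX.
- move=> z /= [[_ h] /and3P[z0 _ _]]; split=> //.
  have : N (Num.sqrt (z.1 ^+ 2 + c - c))%R := h.
  by rewrite addrK sqrtr_sqr ger0_norm// ltW.
Qed.

Lemma locally_integrable_measurable (u : R * R -> R) : loc_integrable u ->
  measurable_fun [set: plane] (u : plane -> measurableTypeR R).
Proof.
move=> ui; pose K (n : nat) : set plane := `[(- n%:R)%R, n%:R%R]%classic `*` `[(- n%:R)%R, n%:R%R]%classic.
have -> : [set: plane] = \bigcup_n K n.
  apply/seteqP; split=> // z _.
  have /= [n _ h] : exists2 n : nat, True & (`|z.1| + `|z.2| <= n%:R)%R.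
    have x0 : (0 <= `|z.1| + `|z.2|)%R by rewrite addr_ge0.
    by exists (Num.trunc (`|z.1| + `|z.2|)%R).+1 => //; rewrite ltW// truncnS_gt.
  have h1 := normr_ge0 z.1; have h2 := normr_ge0 z.2.
  by exists n => //; split; rewrite /= in_itv/= -ler_norml; apply: le_trans h; rewrite ?lerDl ?lerDr.
apply/measurable_fun_bigcup => n.
  by apply: measurableX; exact: measurable_itv.
have := ui (K n); move=> /(_ (@compact_square R _))/integrableP[+ _].
by move/measurable_EFinP.
Qed.

(** The w provided by [radial] need not be measurable. On almost every line x = c, however, w(sqrt
    s) = u(c, sqrt(s - c^2)) for almost every s > c^2, and the right side is measurable in s.
    Letting such c decrease to 0 reaches all s > 0. *)
Lemma radial_measurable_profile (u : R * R -> R) :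
  measurable_fun [set: plane] (u : plane -> measurableTypeR R) -> radial u ->
  exists2 g : R -> R, measurable_fun [set: measurableTypeR R] (g : measurableTypeR R -> measurableTypeR R) &
    {ae lam2, forall z, u z = g (sqn z)}.
Proof.
move=> mu [w [N [mN N0 Nw]]].
have Nw' (z : plane) : ~ N z -> u z = w (enorm z).
  by move=> zN; apply: contrapT => h; apply: zN; exact: Nw.
have mxs := measurable_fun_xsection lam mN.
(* Fubini: almost every vertical line meets the exceptional set N in a null set. *)
have aeN : {ae lam, forall x, lam (xsection N x) = 0}.
  have [/(_ _) + _] := @ae_eq_integral_abs _ _ _ lam setT measurableT _ mxs.
  have -> : \int[lam]_x `|(lam \o xsection N) x| = 0.
    rewrite -[RHS]N0 /lebesgue2/= /product_measure1; apply: eq_integral => x _.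
    by rewrite gee0_abs.
  by move=> /(_ erefl); apply: filterS => x /=; exact.
have /choice[x_ x_P] : forall n : nat, exists x : measurableTypeR R,
    ((0 < x < n.+1%:R^-1)%R /\ lam (xsection N x) = 0).
  move=> n.
  apply: contrapT => /forallNP H; have [Z [mZ Z0 subZ]] := aeN.
  have n0 : (0 < n.+1%:R^-1 :> R)%R by rewrite invr_gt0.
  have : lam `]0%R, n.+1%:R^-1%R[%classic <= lam Z.
    apply: le_measure; rewrite ?inE//.
    move=> x /=; rewrite in_itv/= => xn; apply: subZ => /= xN.
    by apply: (H x).
  by rewrite Z0 lebesgue_measure_itv/= lte_fin n0 -EFinD subr0 lee_fin leNgt n0.
pose S_ n : set (measurableTypeR R) := `](x_ n ^+ 2)%R, +oo[%classic `&`
  (fun s : measurableTypeR R => Num.sqrt (s - x_ n ^+ 2)%R : measurableTypeR R) @^-1` (xsection N (x_ n)).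
have msq n : measurable_fun [set: measurableTypeR R] (fun s : measurableTypeR R => Num.sqrt (s - x_ n ^+ 2)%R : measurableTypeR R).
  apply: continuous_measurable_fun => x.
  apply: (@continuous_comp _ _ _ (fun x : R => (x - x_ n ^+ 2)%R) Num.sqrt); last exact: sqrt_continuous.
  by apply: cvgB => //; exact: cvg_cst.
have mS_ n : measurable (S_ n).
  apply: measurableI; first exact: measurable_itv.
  by rewrite -[X in measurable X]setTI; apply: msq => //; exact: measurable_xsection.
have S_0 n : lam (S_ n) = 0.
  by apply: sqrt_preimage_null; [exact: measurable_xsection|case: (x_P n)].
pose S := \bigcup_n S_ n.
have mS : measurable S by exact: bigcup_measurable.
have S0 : lam S = 0.
  apply: measure_negligible; first exact: mS.
  apply: negligible_bigcup => n.
  by exists (S_ n); split; [exact: mS_|exact: S_0|exact: subset_refl].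
have I0 (c t : R) : (t <= c)%R -> (\1_(`]c, +oo[%classic : set (measurableTypeR R)) t = 0 :> R)%R.
  by move=> tc; rewrite indicE memNset//= in_itv/= andbT; apply/negP; rewrite -leNgt.
have I1 (c t : R) : (c < t)%R -> (\1_(`]c, +oo[%classic : set (measurableTypeR R)) t = 1 :> R)%R.
  by move=> tc; rewrite indicE mem_set//= in_itv/= andbT.
pose g (s : R) : R := (\1_(~` S) s * (\1_(`]0%R, +oo[%classic) s * w (Num.sqrt s)))%R.
pose h n (s : measurableTypeR R) : measurableTypeR R := (\1_(~` S) s * (\1_(`](x_ n ^+ 2)%R, +oo[%classic) s *
  u (x_ n, Num.sqrt (s - x_ n ^+ 2))))%R.
exists g.
  apply: (@measurable_fun_cvg _ _ _ setT h).
    move=> n; apply: measurable_funM; first by apply: measurable_indic; exact: measurableC.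
    apply: measurable_funM; first by apply: measurable_indic; exact: measurable_itv.
    have H : measurable_fun [set: measurableTypeR R]
        (fun s : measurableTypeR R => (x_ n, Num.sqrt (s - x_ n ^+ 2)%R) : plane).
      by apply: measurable_fun_pair => //; exact: msq.
    exact: (measurableT_comp mu H).
  (* Off S, the sequence [h n s] is constant and equal to [g s] as soon as [x_ n ^+ 2 < s]; for s <=
     0 both sides are 0. *)
  move=> s _; apply: cvg_near_cst.
  rewrite /h /g; have [sS|sS] := boolP (s \in S).
    by near=> n; rewrite indicE in_setC sS !mul0r.
  have [s0|s0] := leP s 0%R.
    by near=> n; rewrite !I0 ?mul0r// (le_trans s0)// sqr_ge0.
  near=> n.
  have [/andP[xn0 xn1] _] := x_P n.
  have xs : (x_ n ^+ 2 < s)%R.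
    apply: (@le_lt_trans _ _ n.+1%:R^-1%R).
      have x1 : (x_ n <= 1)%R by rewrite (le_trans (ltW xn1))// invf_le1// ler1n.
      by rewrite expr2 (le_trans (ler_piMr (ltW xn0) x1))// ltW.
    by near: n; exact: near_infty_natSinv_lt (PosNum s0).
  rewrite !I1// !mul1r; congr (_ * _)%R.
  have sn : ~ N (x_ n, Num.sqrt (s - x_ n ^+ 2))%R.
    move=> sN; move/negP : sS; apply; rewrite inE; exists n => //; split; first by rewrite /= in_itv/= xs.
    by rewrite /= xsectionE.
  rewrite (Nw' _ sn).
  by rewrite /enorm/= sqr_sqrtr ?subr_ge0 ?ltW// addrC subrK.
have mD : measurable (`]0%R, +oo[%classic : set (measurableTypeR R)) by exact: measurable_itv.
have n1 : lam2.-negligible N by exists N; split.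
have n2 : lam2.-negligible ((@sqn R : plane -> measurableTypeR R) @^-1` (S `&` `]0%R, +oo[%classic)).
  apply/negligibleP; first by apply: measurable_preimage_sqn; exact: measurableI.
  have E := @pushforward_sqn R (S `&` `]0%R, +oo[%classic) (measurableI _ _ mS mD) (@subIsetr _ _ _).
  apply: (eq_trans E); rewrite (_ : lam _ = 0) ?mule0//; apply/eqP; rewrite eq_le measure_ge0 andbT -S0.
  by apply: le_measure; rewrite ?inE//; exact: measurableI.
have n3 : lam2.-negligible ((@sqn R : plane -> measurableTypeR R) @^-1` (~` `]0%R, +oo[%classic)).
  apply/negligibleP; first by apply: measurable_preimage_sqn; exact: measurableC.
  exact: lebesgue2_origin.
apply: (negligibleS _ (negligibleU (negligibleU n1 n2) n3)) => z /= zu.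
have [zN|zN] := pselect (N z); first by left; left.
have [z0|z0] := pselect (`]0%R, +oo[%classic (sqn z)); last by right.
left; right; split=> //; apply: contrapT => zS; apply: zu.
rewrite (Nw' _ zN).
rewrite /g !indicE !mem_set// !mul1r.
by rewrite -sqr_enorm sqrtr_sqr ger0_norm// enorm_ge0.
Unshelve. all: by end_near. Qed.

End radial_measurable.

(** * The radial equation and the Pohozaev quantity *)

(* [v] as a function of [s = |x|^2]: the equation reads [4 (s v')' = - K e^{2v}],
   and [pi * M s] is the mass of the disc [|x|^2 <= s]. *)
Section radial_ode.
Variables (R : realType) (q : R).
Hypothesis q01 : 0 < q < 1.

Definition curv (v : R -> R) (s : R) : R := (1 - s `^ q) * expR (2 * v s).

(** The equation holds on s > 0 only; [ode_M0] is what the planar equation leaves at the origin. A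
    nonzero limit of M there would give v a logarithmic singularity. *)
Record radial_ode (m : R) (v M : R -> R) : Prop := RadialOde {
  ode_v : forall s : R, 0 < s -> is_derive s 1 v (- (M s / (4 * s)));
  ode_M : forall s : R, 0 < s -> is_derive s 1 M (curv v s);
  ode_M0 : M s @[s --> 0^'+] --> 0;
  ode_Moo : M s @[s --> +oo] --> m }.

Variables (m : R) (v M : R -> R) (ode : radial_ode m v M).

Let q0 : 0 < q. Proof. by case/andP: q01. Qed.

(** The form of monotonicity suited to functions without a value at 0: the limit at 0+ replaces the
    initial value. *)
Lemma le_right_limit (f df : R -> R) (b : R) :
  (forall s : R, 0 < s <= b -> is_derive s 1 f (df s)) ->
  (forall s : R, 0 < s < b -> 0 <= df s) ->
  forall (l : R), f s @[s --> 0^'+] --> l -> forall s, 0 < s <= b -> l <= f s.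
Proof.
move=> fdf df0 l fl s /andP[s0 sb].
apply: (cvgr_to_le fl); near=> t; apply: (is_derive_ge0_le (df := df)).
- by near: t; apply: nbhs_right_le.
- move=> x /andP[tx xs]; apply: fdf; rewrite (le_trans xs)// andbT.
  by apply: lt_le_trans tx; near: t; exact: nbhs_right_gt.
- move=> x /andP[tx xs]; apply: df0; rewrite (lt_le_trans xs)// andbT.
  by apply: lt_trans tx; near: t; exact: nbhs_right_gt.
Unshelve. all: by end_near. Qed.

Lemma powq_derive (s : R) : 0 < s -> is_derive s 1 (fun x : R => x `^ q) (q * s `^ (q - 1)).
Proof. by move=> s0; exact: is_derive1_powR. Qed.

Lemma powq_le1 s : s <= 1 -> s `^ q <= 1.
Proof.
have [s0|s0 s1] := leP s 0; last first.
  have E : 1 `^ q = 1 :> R by rewrite powR1.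
  by rewrite -[leRHS]E ge0_ler_powR// ?nnegrE ltW.
(* Conventional values: 0 to the power q is 0, and a negative base has logarithm 0, hence power
   1. *)
rewrite le_eqVlt in s0; case/predU1P: s0 => [-> _|s0 _]; first by rewrite powR0 ?ler01// gt_eqF.
by rewrite /powR lt_eqF// ln0 ?(ltW s0)// mulr0 expR0.
Qed.

Lemma powq_ge1 s : 1 <= s -> 1 <= s `^ q.
Proof.
move=> s1; have E : 1 `^ q = 1 :> R by rewrite powR1.
by rewrite -[leLHS]E ge0_ler_powR// ?nnegrE ?(ltW q0)// (le_trans ler01).
Qed.

Lemma curv_ge0 s : s <= 1 -> 0 <= curv v s.
Proof. by move=> s1; rewrite mulr_ge0 ?expR_ge0// subr_ge0 powq_le1. Qed.

Lemma curv_le0 s : 1 <= s -> curv v s <= 0.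
Proof. by move=> s1; rewrite mulr_le0_ge0 ?expR_ge0// subr_le0 powq_ge1. Qed.

Lemma curv_le s : curv v s <= expR (2 * v s).
Proof. by rewrite /curv ler_piMl ?expR_ge0// gerBl powR_ge0. Qed.

Lemma M_ge0 s : 0 < s <= 1 -> 0 <= M s.
Proof.
apply: (@le_right_limit M (curv v)).
- by move=> t /andP[t0 _]; exact: (ode_M ode).
- by move=> t /andP[_ t1]; rewrite curv_ge0// ltW.
- exact: (ode_M0 ode).
Qed.

Lemma v_nincr s t : 0 < s -> s <= t -> t <= 1 -> v t <= v s.
Proof.
move=> s0 st t1; rewrite -lerN2.
apply: (is_derive_ge0_le (f := fun x => - v x) (df := fun x => M x / (4 * x))); [exact: st| |] => x /andP[sx xt].
  have h := ode_v ode (lt_le_trans s0 sx).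
  by apply: is_derive_eq; rewrite opprK.
have x0 : 0 < x by exact: lt_trans sx.
rewrite divr_ge0 ?mulr_ge0 ?(ltW x0)// M_ge0// x0/=.
exact: le_trans (ltW xt) t1.
Qed.

Lemma cvg_to0_add (f g : R -> R) (l : R) : f s @[s --> 0^'+] --> l -> g s @[s --> 0^'+] --> 0 ->
  (f s + g s) @[s --> 0^'+] --> l.
Proof. by move=> fl g0; rewrite -[X in _ --> X]addr0; exact: cvgD. Qed.

Lemma sqrt_right0 : Num.sqrt s @[s --> (0 : R)^'+] --> 0.
Proof.
apply: cvg_at_right_filter; rewrite -[X in _ --> X](@sqrtr0 R).
exact: sqrt_continuous.
Qed.

(* Once [M <= 1], [v + (log s) / 4] increases, so that [e^{2v} <= C / sqrt s],
   [M <= 2 C sqrt s], and finally [v'] is integrable at [0]. *)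
Lemma v_bounded : exists B, forall s, 0 < s <= 1 -> v s <= B.
Proof.
have [b /andP[b0 b1] Mb] : exists2 b : R, 0 < b <= 1 & forall s, 0 < s <= b -> M s <= 1.
  have /cvgrPdist_le/(_ 1 ltr01) := ode_M0 ode.
  rewrite near_withinE /= => -[e /= e0 He].
  exists (Num.min 1 (e / 2)); first by rewrite lt_min ltr01 divr_gt0//= ge_min lexx.
  move=> s /andP[s0]; rewrite le_min => /andP[s1 se].
  have := He s; rewrite /= sub0r normrN gtr0_norm// => /(_ ltac:(lra) s0).
  by rewrite sub0r normrN => /(le_trans (ler_norm _)).
pose C1 := v b + 4^-1 * ln b.
have H1 s : 0 < s <= b -> v s <= C1 - 4^-1 * ln s.
  move=> /andP[s0 sb]; rewrite lerBrDr.
  apply: (is_derive_ge0_le (f := fun x => v x + 4^-1 * ln x)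
    (df := fun x => - (M x / (4 * x)) + 4^-1 * x^-1)); [exact: sb| |] => x /andP[sx xb].
    have x0 := lt_le_trans s0 sx.
    have h1 := ode_v ode x0; have h2 := is_derive1_ln x0.
    by apply: is_derive_eq; rewrite /GRing.scale/=; ring.
  have x0 := lt_trans s0 sx.
  rewrite addrC subr_ge0 invfM mulrCA ler_pM2l ?invr_gt0// ler_piMl ?invr_ge0 ?(ltW x0)//.
  by apply: Mb; rewrite x0 ltW.
pose C2 := expR (2 * C1).
have H2 s : 0 < s <= b -> expR (2 * v s) <= C2 / Num.sqrt s.
  move=> sb; have s0 : 0 < s by case/andP: sb.
  rewrite -[Num.sqrt s]lnK ?posrE ?sqrtr_gt0// -expRN -expRD ler_expR.
  have -> : ln (Num.sqrt s) = 2^-1 * ln s.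
    have := sqr_sqrtr (ltW s0) => E; rewrite -[in RHS]E lnXn ?sqrtr_gt0//.
    by rewrite -[X in _ = _ * X]mulr_natl mulrA mulVf ?mul1r.
  by have := H1 s sb; lra.
have dsqrt (x : R) : 0 < x -> is_derive x 1 Num.sqrt (2 * Num.sqrt x)^-1 by exact: is_derive1_sqrt.
have H3 s : 0 < s <= b -> M s <= 2 * C2 * Num.sqrt s.
  move=> sb; rewrite -subr_ge0; move: s sb.
  apply: (@le_right_limit (fun x => 2 * C2 * Num.sqrt x - M x) (fun x => C2 / Num.sqrt x - curv v x)).
  - move=> x /andP[x0 xb]; have h1 := dsqrt x x0; have h2 := ode_M ode x0.
    apply: is_derive_eq; rewrite /GRing.scale/= invfM; congr (_ - _); field.
    by rewrite gt_eqF// sqrtr_gt0.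
  - move=> x /andP[x0 xb]; rewrite subr_ge0; apply: le_trans (curv_le x) _.
    by apply: H2; rewrite x0 ltW.
  - rewrite -[X in _ --> X](subr0 0); apply: cvgB; last exact: (ode_M0 ode).
    by rewrite -[X in _ --> X](mulr0 (2 * C2)); apply: cvgM; [exact: cvg_cst|exact: sqrt_right0].
exists (v b + C2 * Num.sqrt b) => s /andP[s0 s1].
have C20 : 0 < C2 by exact: expR_gt0.
have [bs|sb] := leP b s.
  apply: (le_trans (v_nincr b0 bs s1)); rewrite lerDl mulr_ge0// ?sqrtr_ge0//.
  exact: ltW.
apply: (@le_trans _ _ (v s + C2 * Num.sqrt s)); first by rewrite lerDl mulr_ge0// ?sqrtr_ge0// ltW.
apply: (is_derive_ge0_le (f := fun x => v x + C2 * Num.sqrt x)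
    (df := fun x => - (M x / (4 * x)) + C2 * (2 * Num.sqrt x)^-1)); first exact: ltW.
  move=> x /andP[sx xb]; have x0 := lt_le_trans s0 sx.
  have h1 := ode_v ode x0; have h2 := dsqrt x x0.
  by apply: is_derive_eq.
move=> x /andP[sx xb]; have x0 := lt_trans s0 sx.
rewrite addrC subr_ge0 ler_pdivrMr ?mulr_gt0//.
have := H3 x; rewrite x0 (ltW xb) => /(_ isT) /le_trans; apply.
rewrite -[X in 4 * X](sqr_sqrtr (ltW x0)).
have sx0 : 0 < Num.sqrt x by rewrite sqrtr_gt0.
by rewrite le_eqVlt; apply/orP; left; apply/eqP; field; rewrite gt_eqF.
Qed.

(** By monotonicity and [v_bounded]. The limit v0 becomes the value at the origin of the C^1
    representative. *)
Lemma v_cvg0 : exists2 v0, v s @[s --> 0^'+] --> v0 & forall s, 0 < s <= 1 -> v s <= v0.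
Proof.
have [B vB] := v_bounded.
have ndNv : {in `]0, 1[ &, nonincreasing_fun v}.
  move=> x y; rewrite !in_itv/= => /andP[x0 x1] /andP[y0 y1] xy.
  by apply: v_nincr => //; exact: ltW.
have bd : has_ubound (v @` `]0, 1[%classic).
  by exists B => _ [x /= + <-]; rewrite in_itv/= => /andP[x0 x1]; rewrite vB// x0 ltW.
have := @nonincreasing_at_right_cvgr R v 0 (BLeft 1) _ ndNv bd; rewrite bnd_simp => /(_ ltr01) h.
exists (sup (v @` `]0, 1[%classic)) => // s /andP[s0 s1].
rewrite le_eqVlt in s1; case/predU1P: s1 => [->|s1].
  apply: (@le_trans _ _ (v 2^-1)); first by apply: v_nincr => //; lra.
  by apply: ub_le_sup => //; exists 2^-1 => //=; rewrite in_itv/=; lra.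
by apply: ub_le_sup => //; exists s => //=; rewrite in_itv/= s0.
Qed.

Definition pohozaev (s : R) : R := 4 * M s - M s ^+ 2 - 4 * (s * curv v s).

Lemma pohozaev_derive (s : R) : 0 < s -> is_derive s 1 pohozaev (4 * q * (s `^ q * expR (2 * v s))).
Proof.
move=> s0; have h1 := ode_M ode s0; have h2 := ode_v ode s0; have h3 := powq_derive s0.
have h4 : is_derive s 1 (fun x => expR (2 * v x)) (expR (2 * v s) * (2 * - (M s / (4 * s)))).
  have h : is_derive s 1 (fun x => 2 * v x) (2 * - (M s / (4 * s))) by apply: is_derive_eq.
  exact: (@is_derive1_comp R expR _ s _ _ (is_derive_expR _) h).
have h5 : is_derive s 1 (curv v) ((1 - s `^ q) * (expR (2 * v s) * (2 * - (M s / (4 * s))))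
     + expR (2 * v s) * (- (q * s `^ (q - 1)))).
  by apply: is_derive_eq; rewrite /GRing.scale/=; ring.
have sq : s `^ (q - 1) = s `^ q / s by rewrite powRB ?(gt_eqF s0) ?implybT// powRr1// ltW.
apply: is_derive_eq; rewrite /GRing.scale/= sq /curv; field.
by rewrite gt_eqF.
Qed.

(** The curvature is nonpositive beyond s = 1, so M decreases there to its limit. *)
Lemma M_le_oo s : 1 <= s -> m <= M s.
Proof.
move=> s1; apply: (cvgr_to_le (ode_Moo ode)); near=> t.
rewrite -lerN2; apply: (is_derive_ge0_le (f := fun x => - M x) (df := fun x => - curv v x)).
- by near: t; apply: nbhs_pinfty_ge; exact: num_real.
- move=> x /andP[sx _]; have h := ode_M ode (lt_le_trans (lt_le_trans ltr01 s1) sx).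
  exact: is_derive_eq.
- by move=> x /andP[sx _]; rewrite oppr_ge0 curv_le0// (le_trans s1)// ltW.
Unshelve. all: by end_near. Qed.

Lemma pohozaev_ndecr s t : 0 < s -> s <= t -> pohozaev s <= pohozaev t.
Proof.
move=> s0 st; apply: (is_derive_ge0_le (df := fun s => 4 * q * (s `^ q * expR (2 * v s)))); [exact: st| |] => x /andP[sx _].
  exact/pohozaev_derive/(lt_le_trans s0).
by rewrite !mulr_ge0 ?powR_ge0 ?expR_ge0// ltW.
Qed.

(* If [pohozaev] exceeded [m (4 - m)], then [s F <= - e], which would make [M]
   diverge logarithmically. *)
Lemma pohozaev_le s : 0 < s -> pohozaev s <= m * (4 - m).
Proof.
move=> s0; rewrite leNgt; apply/negP => h.
(* The gap is 8 e. Replacing 4 M - M^2 by its limit costs 4 e; the remaining 4 e, divided by the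
   factor 4 in front of [t * curv v t], bounds that product by -e. *)
pose e := (pohozaev s - m * (4 - m)) / 8; have e0 : 0 < e by rewrite divr_gt0// subr_gt0.
have cM : 4 * M t - M t ^+ 2 @[t --> +oo] --> 4 * m - m ^+ 2.
  have := ode_Moo ode => Mm; apply: cvgB; first by apply: cvgM => //; exact: cvg_cst.
  by rewrite !expr2; exact: cvgM.
have [T T1 HT] : exists2 T, Num.max 1 s <= T & forall t, T <= t -> t * curv v t <= - e.
  have /cvgrPdist_le/(_ (4 * e) ltac:(lra))[A [_ HA]] := cM.
  exists (Num.max (Num.max 1 s) (A + 1)); first by rewrite le_max lexx.
  move=> t; rewrite !ge_max => /andP[/andP[t1 st] tA].
  have := HA t ltac:(lra); rewrite /= => /ler_normlP[hh _].
  have := pohozaev_ndecr s0 st; rewrite /pohozaev; have : 8 * e = pohozaev s - m * (4 - m) by rewrite /e; field.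
  rewrite /pohozaev; lra.
have T0 : 0 < T by apply: lt_le_trans T1; rewrite lt_max ltr01.
have H t : T <= t -> M t + e * ln t <= M T + e * ln T.
  move=> Tt; rewrite -lerN2.
  apply: (is_derive_ge0_le (f := fun t => - (M t + e * ln t)) (df := fun t => - (curv v t + e * t^-1))); [exact: Tt| |] => x /andP[Tx xt].
    have x0 := lt_le_trans T0 Tx; have h1 := ode_M ode x0; have h2 := is_derive1_ln x0.
    exact: is_derive_eq.
  have x0 := lt_trans T0 Tx.
  rewrite oppr_ge0 -[curv v x](mulKf (lt0r_neq0 x0)) [x^-1 * _]mulrC -mulrDl mulr_le0_ge0 ?invr_ge0 ?(ltW x0)//.
  by have := HT x (ltW Tx); lra.
(* For this t the logarithmic bound gives M t <= m - e, against [M_le_oo]. *)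
pose t := Num.max T (expR ((M T - m + e * ln T) / e + 1)).
have Tt : T <= t by rewrite le_max lexx.
have t1 : 1 <= t by apply: le_trans Tt; apply: le_trans T1; rewrite le_max lexx.
have := H t Tt; have := M_le_oo t1.
have : (M T - m + e * ln T) / e + 1 <= ln t.
  rewrite -[leLHS]expRK ler_ln ?posrE ?expR_gt0//; first by rewrite le_max lexx orbT.
  exact: lt_le_trans t1.
rewrite -(ler_pM2l e0) mulrDr mulrCA mulfV ?gt_eqF// !mulr1.
by lra.
Qed.

(** For s >= d one has [curv v s] <= e^{2v} <= d^(-q) s^q e^{2v}, and the last term is d^(-q) / (4
    q) times the derivative of the Pohozaev quantity. *)
Lemma mass_tail d : 0 < d -> m - M d <= d `^ (- q) / (4 * q) * (m * (4 - m) - pohozaev d).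
Proof.
move=> d0; set c := d `^ (- q) / (4 * q).
have c0 : 0 <= c by rewrite divr_ge0 ?powR_ge0// mulr_ge0// ltW.
suff H t : d <= t -> M t - M d <= c * (m * (4 - m) - pohozaev d).
  have Hl : M t - M d @[t --> +oo] --> m - M d.
    by apply: cvgB; [exact: (ode_Moo ode)|exact: cvg_cst].
  apply: (cvgr_to_le Hl).
  by near=> t; apply: H; near: t; apply: nbhs_pinfty_ge; exact: num_real.
move=> dt; apply: (@le_trans _ _ (c * (pohozaev t - pohozaev d))); last first.
  by rewrite ler_wpM2l// lerB// pohozaev_le// (lt_le_trans d0).
suff H : c * pohozaev d - M d <= c * pohozaev t - M t by rewrite mulrBr; lra.
apply: (is_derive_ge0_le (f := fun s => c * pohozaev s - M s)
  (df := fun s => c * (4 * q * (s `^ q * expR (2 * v s))) - curv v s)); [exact: dt| |] => x /andP[dx xt].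
  have x0 := lt_le_trans d0 dx; have h1 := pohozaev_derive x0; have h2 := ode_M ode x0.
  exact: is_derive_eq.
rewrite subr_ge0; apply: (le_trans (curv_le x)).
have -> : c * (4 * q * (x `^ q * expR (2 * v x))) = (d `^ q)^-1 * x `^ q * expR (2 * v x).
  by rewrite /c powRN; field; rewrite (gt_eqF q0) gt_eqF// powR_gt0.
rewrite ler_peMl ?expR_ge0// ler_pdivlMl ?powR_gt0// mulr1.
by rewrite ge0_ler_powR ?nnegrE ?(ltW q0)// ltW// (lt_trans d0).
Unshelve. all: by end_near. Qed.

Lemma powq_right0 : s `^ q @[s --> (0 : R)^'+] --> 0.
Proof.
apply/cvgrPdist_le => e e0; near=> s.
have s0 : 0 < s by near: s; exact: nbhs_right_gt.
rewrite sub0r normrN ger0_norm ?powR_ge0//.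
have -> : e = (e `^ q^-1) `^ q by rewrite -powRrM mulVf ?gt_eqF// powRr1// ltW.
rewrite ge0_ler_powR ?nnegrE ?(ltW q0) ?powR_ge0 ?(ltW s0)//.
by near: s; apply: nbhs_right_le; exact: powR_gt0.
Unshelve. all: by end_near. Qed.

Lemma id_right0 : s @[s --> (0 : R)^'+] --> 0.
Proof. exact: cvg_at_right_filter. Qed.

Section at_origin.
Variables (v0 : R) (vv0 : v s @[s --> 0^'+] --> v0) (v_le : forall s, 0 < s <= 1 -> v s <= v0).

Lemma curv_right0 : curv v s @[s --> 0^'+] --> expR (2 * v0).
Proof.
rewrite -[X in _ --> X]mul1r; apply: cvgM.
  by rewrite -[X in _ --> X]subr0; apply: cvgB; [exact: cvg_cst|exact: powq_right0].
have h : 2 * v s @[s --> 0^'+] --> 2 * v0 by apply: cvgM => //; exact: cvg_cst.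
exact: (cvg_comp _ _ h (@continuous_expR R _)).
Qed.

Lemma M_le s : 0 < s <= 1 -> M s <= expR (2 * v0) * s.
Proof.
move=> s01; rewrite -subr_ge0; move: s s01.
apply: (@le_right_limit (fun s => expR (2 * v0) * s - M s) (fun s => expR (2 * v0) - curv v s)).
- move=> x /andP[x0 _]; have h := ode_M ode x0.
  by apply: is_derive_eq; rewrite /GRing.scale/= mulr1.
- move=> x /andP[x0 x1]; rewrite subr_ge0; apply: le_trans (curv_le x) _.
  by rewrite ler_expR ler_pM2l// v_le// x0 ltW.
- rewrite -[X in _ --> X](subr0 0); apply: cvgB; last exact: (ode_M0 ode).
  by rewrite -[X in _ --> X](mulr0 (expR (2 * v0))); apply: cvgM; [exact: cvg_cst|exact: id_right0].
Qed.

Lemma M_div_right0 : M s / s @[s --> 0^'+] --> expR (2 * v0).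
Proof.
apply/cvgrPdist_le => e e0.
have /cvgrPdist_le/(_ e e0) := curv_right0; rewrite near_withinE /= => -[d /= d0 Hd].
pose b := Num.min 1 (d / 2).
have b0 : 0 < b by rewrite lt_min ltr01 divr_gt0.
have Hb s : 0 < s <= b -> (expR (2 * v0) - e) * s <= M s.
  move=> sb; rewrite -subr_ge0; move: s sb.
  apply: (@le_right_limit (fun s => M s - (expR (2 * v0) - e) * s) (fun s => curv v s - (expR (2 * v0) - e))).
  - move=> x /andP[x0 _]; have h := ode_M ode x0.
    by apply: is_derive_eq; rewrite /GRing.scale/= mulr1.
  - move=> x /andP[x0 xb]; have xd : x < d.
      by apply: (lt_le_trans xb); rewrite ge_min; apply/orP; right; lra.
    have := Hd x; rewrite /= sub0r normrN gtr0_norm// => /(_ xd x0) /ler_normlP[_ ?]; lra.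
  - rewrite -[X in _ --> X](subr0 0); apply: cvgB; first exact: (ode_M0 ode).
    by rewrite -[X in _ --> X](mulr0 (expR (2 * v0) - e)); apply: cvgM; [exact: cvg_cst|exact: id_right0].
near=> s.
have s0 : 0 < s by near: s; exact: nbhs_right_gt.
have sb : s <= b by near: s; exact: nbhs_right_le.
have s1 : s <= 1 by apply: (le_trans sb); rewrite ge_min lexx.
have h1 : M s / s <= expR (2 * v0) by rewrite ler_pdivrMr// M_le// s0.
have h2 : expR (2 * v0) - e <= M s / s by rewrite ler_pdivlMr// Hb// s0.
by rewrite ler_norml; apply/andP; split; lra.
Unshelve. all: by end_near. Qed.

Lemma pohozaev_right0 : pohozaev s @[s --> 0^'+] --> 0.
Proof.
rewrite [X in _ --> X](_ : 0 = 4 * 0 - 0 * 0 - 4 * (0 * expR (2 * v0))); last by rewrite !mul0r !mulr0 !subr0.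
have M0 := ode_M0 ode.
apply: cvgB; first apply: cvgB.
- by apply: cvgM => //; exact: cvg_cst.
- by under eq_fun do rewrite expr2; exact: cvgM.
- by apply: cvgM; [exact: cvg_cst|apply: cvgM; [exact: id_right0|exact: curv_right0]].
Qed.

(** The derivative 4 q s^q e^{2v} is nonnegative and, as v <= v0, integrates to at most the right
    side; a factor 1 / (1 + q) is given away. *)
Lemma pohozaev_bounds s : 0 < s <= 1 -> 0 <= pohozaev s <= 4 * q * expR (2 * v0) * (s * s `^ q).
Proof.
move=> s01; apply/andP; split.
  move: s s01; apply: (le_right_limit (df := fun s => 4 * q * (s `^ q * expR (2 * v s)))).
  - by move=> x /andP[x0 _]; exact: pohozaev_derive.
  - by move=> x _; rewrite !mulr_ge0 ?powR_ge0 ?expR_ge0// ltW.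
  - exact: pohozaev_right0.
rewrite -subr_ge0; move: s s01.
set C := 4 * q * expR (2 * v0).
apply: (@le_right_limit (fun s => C * (s * s `^ q) - pohozaev s) (fun s => C * ((1 + q) * s `^ q) - 4 * q * (s `^ q * expR (2 * v s)))).
- move=> x /andP[x0 _]; have h1 := pohozaev_derive x0; have h2 := powq_derive x0.
  apply: is_derive_eq; rewrite /GRing.scale/= mulr1; congr (C * _ - _).
  by rewrite powRB ?(gt_eqF x0) ?implybT// powRr1 ?(ltW x0)//; field; rewrite gt_eqF.
- move=> x /andP[x0 x1]; rewrite subr_ge0 /C -!mulrA !ler_pM2l//.
  rewrite [leRHS]mulrA [leRHS]mulrC; apply: ler_wpM2l; first exact: powR_ge0.
  apply: (@le_trans _ _ (expR (2 * v0))); first by rewrite ler_expR ler_pM2l// v_le// x0 ltW.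
  by rewrite ler_peMr ?expR_ge0// lerDl ltW.
- suff : C * (s * s `^ q) - pohozaev s @[s --> 0^'+] --> C * (0 * 0) - 0 by rewrite !mulr0 subr0.
  apply: cvgB; last exact: pohozaev_right0.
  by apply: cvgM; [exact: cvg_cst|apply: cvgM; [exact: id_right0|exact: powq_right0]].
Qed.

(** For constant curvature 1 the radial solutions are exactly those with e^{-v} affine in s, of
    slope e^{v0} / 4: this makes [yv] the unknown to follow. *)
Definition yv (s : R) : R := expR (- v s).
Definition slope (s : R) : R := M s / (4 * s) * yv s.

Lemma yv_derive (s : R) : 0 < s -> is_derive s 1 yv (slope s).
Proof.
move=> s0; have h1 := ode_v ode s0.
have h : is_derive s 1 (fun x => - v x) (M s / (4 * s)) by apply: is_derive_eq; rewrite opprK.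
have := @is_derive1_comp R expR _ s _ _ (is_derive_expR _) h.
by rewrite mulrC.
Qed.

Lemma slope_derive (s : R) : 0 < s -> is_derive s 1 slope (- (pohozaev s * yv s / (16 * s ^+ 2))).
Proof.
move=> s0; have h1 := ode_M ode s0; have h2 := yv_derive s0.
have h3 : is_derive s 1 (fun x : R => (4 * x)^-1) (- (4 * s) ^- 2 * 4).
  have h : is_derive s 1 (fun x : R => 4 * x) 4 by apply: is_derive_eq; rewrite /GRing.scale/= mulr1.
  by apply: (@is_deriveV R (fun x => 4 * x) s 4 1 _ h); rewrite mulf_neq0// gt_eqF.
apply: is_derive_eq; rewrite /GRing.scale/= /slope /pohozaev; field.
by rewrite gt_eqF.
Qed.

Let r0 : R := expR v0 / 4.

Lemma yv_right0 : yv s @[s --> 0^'+] --> expR (- v0).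
Proof.
have h : - v s @[s --> 0^'+] --> - v0 by exact: cvgN.
exact: (cvg_comp _ _ h (@continuous_expR R _)).
Qed.

Lemma slope_right0 : slope s @[s --> 0^'+] --> r0.
Proof.
have -> : r0 = 4^-1 * expR (2 * v0) * expR (- v0).
  by rewrite -mulrA -expRD /r0 mulrC; congr (_ * expR _); ring.
have -> : slope = (fun s => 4^-1 * (M s / s) * yv s).
  by apply/funext => s; rewrite /slope invfM mulrCA.
apply: cvgM; last exact: yv_right0.
by apply: cvgM; [exact: cvg_cst|exact: M_div_right0].
Qed.

(** The Pohozaev quantity is nonnegative, so [yv] is concave and lies below its tangent at the
    origin. *)
Lemma slope_le s : 0 < s <= 1 -> slope s <= r0.
Proof.
move=> s01; rewrite -lerN2; move: s s01.
apply: (@le_right_limit (fun s => - slope s) (fun s => pohozaev s * yv s / (16 * s ^+ 2))).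
- move=> x /andP[x0 _]; have h := slope_derive x0.
  by apply: is_derive_eq; rewrite opprK.
- move=> x /andP[x0 x1]; have /andP[p0 _] : 0 <= pohozaev x <= 4 * q * expR (2 * v0) * (x * x `^ q).
    by apply: pohozaev_bounds; rewrite x0 ltW.
  by rewrite divr_ge0// mulr_ge0 ?expR_ge0// exprn_ge0// ltW.
- by apply: cvgN; exact: slope_right0.
Qed.

Lemma yv_le s : 0 < s <= 1 -> yv s <= expR (- v0) + r0 * s.
Proof.
move=> s01; rewrite -lerBlDr -lerN2 opprB; move: s s01.
apply: (@le_right_limit (fun s => r0 * s - yv s) (fun s => r0 - slope s)).
- move=> x /andP[x0 _]; have h := yv_derive x0.
  by apply: is_derive_eq; rewrite /GRing.scale/= mulr1.
- by move=> x /andP[x0 x1]; rewrite subr_ge0 slope_le// x0 ltW.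
- rewrite -[X in _ --> X]sub0r; apply: cvgB; last exact: yv_right0.
  by rewrite -[X in _ --> X](mulr0 r0); apply: cvgM; [exact: cvg_cst|exact: id_right0].
Qed.

(** With the blow-up scale mu one has mu^2 = 4 e^{-2 v0}, so the bound on b says that the rescaled
    variable is at most S. There [yv] is at most e^{-v0} (1 + S), and [pohozaev_bounds] bounds the
    derivative of [slope] below by - r0 (1 + S) q s^(q-1), which is integrable at 0. *)
Lemma slope_ge (S b s : R) : 0 <= S -> b <= 1 -> b <= 4 * S * expR (- (2 * v0)) ->
  0 < s <= b -> r0 - r0 * (1 + S) * s `^ q <= slope s.
Proof.
move=> S0 b1 bS sb; have b0 : 0 < b by case/andP: sb => s0 /(lt_le_trans s0).
rewrite lerBlDr; move: s sb.
apply: (@le_right_limit (fun s => slope s + r0 * (1 + S) * s `^ q)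
  (fun s => - (pohozaev s * yv s / (16 * s ^+ 2)) + r0 * (1 + S) * (q * s `^ (q - 1)))).
- move=> x /andP[x0 _]; have h1 := slope_derive x0; have h2 := powq_derive x0.
  exact: is_derive_eq.
- move=> x /andP[x0 xb]; rewrite addrC subr_ge0.
  have x01 : 0 < x <= 1 by rewrite x0 (le_trans (ltW xb)).
  have /andP[p0 p1] := pohozaev_bounds x01.
  have yE : yv x <= expR (- v0) * (1 + S).
    apply: (le_trans (yv_le x01)); rewrite mulrDr mulr1 lerD2l.
    apply: (@le_trans _ _ (r0 * (4 * S * expR (- (2 * v0))))).
      by rewrite ler_wpM2l ?divr_ge0 ?expR_ge0// (le_trans (ltW xb)).
    rewrite /r0 (_ : - (2 * v0) = - v0 - v0); last by ring.
    rewrite expRD (expRN v0) le_eqVlt; apply/orP; left; apply/eqP; field.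
    by rewrite gt_eqF// expR_gt0.
  apply: (@le_trans _ _ (4 * q * expR (2 * v0) * (x * x `^ q) * (expR (- v0) * (1 + S)) / (16 * x ^+ 2))).
    rewrite ler_wpM2r ?invr_ge0 ?mulr_ge0 ?exprn_ge0 ?(ltW x0)//.
    by apply: ler_pM => //; exact: expR_ge0.
  rewrite powRB ?(gt_eqF x0) ?implybT// powRr1 ?(ltW x0)//.
  rewrite (_ : 2 * v0 = v0 + v0); last by ring.
  rewrite expRD (expRN v0) /r0 le_eqVlt; apply/orP; left; apply/eqP; field.
  by rewrite gt_eqF// gt_eqF// expR_gt0.
- apply: cvg_to0_add; first exact: slope_right0.
  by rewrite -[X in _ --> X](mulr0 (r0 * (1 + S))); apply: cvgM; [exact: cvg_cst|exact: powq_right0].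
Qed.

Lemma yv_ge (S s : R) : 0 <= S -> s <= 1 -> s <= 4 * S * expR (- (2 * v0)) -> 0 < s ->
  expR (- v0) + r0 * s - r0 * (1 + S) * s `^ q * s <= yv s.
Proof.
move=> S0 s1 sS s0; have ss : 0 < s <= s by rewrite s0 lexx.
(* The lower bound of [slope_ge] decreases in its variable, so its value at the endpoint bounds the
   slope on the whole interval. *)
set k := r0 - r0 * (1 + S) * s `^ q.
suff : expR (- v0) <= yv s - k * s by rewrite /k; lra.
move: s ss {s1 sS s0} (s1) (sS) (s0) @k => t tt t1 tS t0 k.
have : 0 < t <= t by rewrite t0 lexx.
apply: (@le_right_limit (fun x => yv x - k * x) (fun x => slope x - k)).
- move=> x /andP[x0 _]; have h := yv_derive x0.
  by apply: is_derive_eq; rewrite /GRing.scale/= mulr1.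
- move=> x /andP[x0 xt]; rewrite subr_ge0.
  apply: le_trans (slope_ge S0 t1 tS (s := x) _); last by rewrite x0 ltW.
  rewrite /k lerB// ler_wpM2l ?mulr_ge0 ?divr_ge0 ?expR_ge0 ?addr_ge0//.
  by rewrite ge0_ler_powR ?nnegrE ?(ltW q0)// ltW// ltW.
- rewrite -[X in _ --> X]subr0; apply: cvgB; first exact: yv_right0.
  by rewrite -[X in _ --> X](mulr0 k); apply: cvgM; [exact: cvg_cst|exact: id_right0].
Qed.

End at_origin.

End radial_ode.

(** * From the weak equation to the radial one *)

Section weak_to_ode.
Variable R : realType.
Local Notation lam := (@lebesgue_measure R).
Local Notation lam2 := (@lebesgue2 R).
Local Notation plane := (measurableTypeR R * measurableTypeR R)%type.
Local Notation Rm := (measurableTypeR R).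
Local Notation pos := (`]0%R, +oo[%classic : set Rm).
Local Open Scope ereal_scope.

Lemma ae_lebesgue2S (P Q : R * R -> Prop) : (forall z, P z -> Q z) ->
  {ae lam2, forall z, P z} -> {ae lam2, forall z, Q z}.
Proof.
move=> PQ [N [mN N0 sub]]; exists N; split=> // z nQ; apply: sub => /= Pz.
by apply: nQ; exact: PQ.
Qed.

Lemma ae_eq_integrable d (T : measurableType d) (mu : {measure set T -> \bar R}) (D : set T)
    (f g : T -> \bar R) : measurable D -> measurable_fun D g -> ae_eq mu D f g ->
  mu.-integrable D f -> mu.-integrable D g.
Proof.
move=> mD mg fg /integrableP[mf fi]; apply/integrableP; split=> //.
rewrite -(@ge0_ae_eq_integral _ _ _ mu D (fun x => `|f x|) (fun x => `|g x|))//.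
- exact: measurableT_comp.
- exact: measurableT_comp.
- have [N [mN N0 sub]] := fg; exists N; split=> // x /= h; apply: sub => /= h'.
  by apply: h => Dx; rewrite (h' Dx).
Qed.

Lemma enorm_powR (p : R) z : (enorm z `^ p)%R = (sqn z `^ (p / 2))%R.
Proof. by rewrite /enorm -powR12_sqrt ?sqn_ge0// -powRrM mulrC. Qed.

Lemma bounded_vanishing (th : R -> R) (S : R) : continuous th ->
  (forall s, (S <= s)%R -> th s = 0%R) -> exists2 C : R, (0 <= C)%R & forall s, (0 <= s)%R -> (`|th s| <= C)%R.
Proof.
move=> cth th0.
have /compact_bounded[M [_ HM]] : compact (th @` `[0%R, S]%classic).
  by apply: continuous_compact; [exact: continuous_subspaceT|exact: segment_compact].
exists (Num.max 0 (M + 1))%R; first by rewrite le_max lexx.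
move=> s s0; have [Ss|sS] := leP S s; first by rewrite th0// normr0 le_max lexx.
rewrite le_max; apply/orP; right; apply: HM; first by rewrite ltrDl.
by exists s => //=; rewrite in_itv/= s0 ltW.
Qed.

Lemma integrable_times_vanishing (g th : R -> R) (S : R) :
  measurable_fun [set: Rm] (g : Rm -> Rm) ->
  (forall b, lam.-integrable `]0%R, b]%classic (EFin \o g)) ->
  continuous th -> (forall s, (S <= s)%R -> th s = 0%R) ->
  lam.-integrable pos (fun s => (g s * th s)%:E).
Proof.
move=> mg gi cth th0.
have mth : measurable_fun [set: Rm] (th : Rm -> Rm) by exact: continuous_measurable_fun.
have [C C0 HC] := bounded_vanishing cth th0.
have mgt : measurable_fun [set: Rm] (fun s : Rm => (g s * th s)%R : Rm) by exact: measurable_funM.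
have mS : measurable (`]0%R, S]%classic : set Rm) by exact: measurable_itv.
have mpos : measurable (pos : set Rm) by exact: measurable_itv.
have gS : lam.-integrable pos ((EFin \o g) \_ `]0%R, S]%classic).
  apply: integrableS (measurableT) mpos _ _ => //.
  by apply/(integrable_mkcond _ mS); exact: gi.
apply: (le_integrable mpos _ _ (integrableZl mpos C gS)).
- by apply/measurable_EFinP; exact: measurable_funTS.
- move=> s /=; rewrite in_itv/= andbT => s0; rewrite patchE; case: ifPn => sS.
    by rewrite lee_fin !normrM mulrC ler_wpM2r// (le_trans (HC s (ltW s0)))// ler_norm.
  rewrite th0 ?mulr0 ?normr0 ?mule0 ?abse0//.
  by move: sS; rewrite notin_setE/= in_itv/= s0/= => /negP; rewrite -ltNge => /ltW.
Qed.

(** What [solution] becomes in the variable s; [profile_eq] is the weak equation against E(|z|^2),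
    divided by pi. Integrability of g holds up to the origin, as u is integrable on discs. *)
Record profile (p Lambda : R) (u : R * R -> R) (g : R -> R) : Prop := Profile {
  profile_measurable : measurable_fun [set: Rm] (g : Rm -> Rm);
  profile_ae : {ae lam2, forall z, u z = g (sqn z)};
  profile_loc : forall b, lam.-integrable `]0%R, b]%classic (EFin \o g);
  profile_curv : lam.-integrable pos (fun s => (curv (p / 2) g s)%:E);
  profile_mass : pi%:E * \int[lam]_(s in pos) (curv (p / 2) g s)%:E = Lambda%:E;
  profile_eq : forall E S, derivative_seq E -> (forall s, (S <= s)%R -> E 0%N s = 0%R) ->
    \int[lam]_(s in pos) (g s * - (4 * (E 1%N s + s * E 2%N s)))%:E =
    \int[lam]_(s in pos) (curv (p / 2) g s * E 0%N s)%:E }.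

Lemma measurable_powR_curv (q : R) (g : R -> R) : measurable_fun [set: Rm] (g : Rm -> Rm) ->
  measurable_fun [set: Rm] (curv q g : Rm -> Rm).
Proof.
move=> mg; apply: measurable_funM.
  by apply: measurable_funB => //; exact: measurable_powR.
apply: measurableT_comp; first exact: measurable_expR.
exact: measurable_funM.
Qed.

Lemma solution_profile (p Lambda : R) (u : R * R -> R) :
  solution p Lambda u -> radial u -> exists g, profile p Lambda u g.
Proof.
move=> [ui fi ueq uL] ur.
have mu := locally_integrable_measurable ui.
have [g mg ug] := radial_measurable_profile mu ur.
have mcurv := measurable_powR_curv (p / 2) mg.
have msqn := @measurable_sqn R.
have mgT : measurable_fun [set: plane] (fun z : plane => g (sqn z) : Rm) by exact: (measurableT_comp mg msqn).
have aef : ae_eq lam2 setT (EFin \o curvature_density p u) (fun z => (curv (p / 2) g (sqn z))%:E).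
  move: ug; apply: ae_lebesgue2S => z /= uz _.
  by rewrite /curvature_density /curv enorm_powR uz.
have mcT : measurable_fun [set: plane] (fun z : plane => (curv (p / 2) g (sqn z))%:E).
  by apply/measurable_EFinP; exact: (measurableT_comp mcurv msqn).
have mcE : measurable_fun [set: Rm] (fun s => (curv (p / 2) g s)%:E) by exact/measurable_EFinP.
have fi' : lam2.-integrable setT (fun z => (curv (p / 2) g (sqn z))%:E).
  exact: (ae_eq_integrable measurableT mcT aef fi).
have fi1 := (polar_integrable mcE).1 fi'.
have gloc b : lam.-integrable `]0%R, b]%classic (EFin \o g).
  pose gb (s : Rm) : \bar R := (\1_(`]0%R, b]%classic : set Rm) s * g s)%:E.
  have mgb : measurable_fun [set: Rm] gb.
    by apply/measurable_EFinP; apply: measurable_funM => //; apply: measurable_indic; exact: measurable_itv.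
  have : lam2.-integrable setT (fun z => gb (sqn z)).
    pose K : set (R * R) := `[(- (b + 1))%R, (b + 1)%R]%classic `*` `[(- (b + 1))%R, (b + 1)%R]%classic.
    have mK : measurable (K : set plane) by apply: measurableX; exact: measurable_itv.
    have Ki := ui K (@compact_square R (b + 1)).
    have Ki' : lam2.-integrable setT ((EFin \o u) \_ K) by exact/(integrable_mkcond _ mK).
    have mgK : measurable_fun [set: plane] ((fun z => (g (sqn z))%:E) \_ K).
      by apply/(measurable_restrictT _ mK)/measurable_funTS/measurable_EFinP.
    have : lam2.-integrable setT ((fun z => (g (sqn z))%:E) \_ K).
      apply: (ae_eq_integrable measurableT mgK _ Ki').
      by move: ug; apply: ae_lebesgue2S => z /= uz _; rewrite !patchE /= uz.
    apply: le_integrable => //; first exact: (measurableT_comp mgb msqn).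
    move=> z _; rewrite /gb; have [zb|zb] := boolP (sqn z \in (`]0%R, b]%classic : set Rm)).
      rewrite patchE mem_set; first by rewrite indicE zb mul1r.
      by move: zb; rewrite inE/= in_itv/= => /andP[_]; exact: sqn_le_square.
    by rewrite indicE (negbTE zb) mul0r abse0 abse_ge0.
  move=> /(polar_integrable mgb) h.
  have sb : (`]0%R, b]%classic : set Rm) `<=` pos by move=> x /=; rewrite !in_itv/= andbT => /andP[].
  have mb : measurable (`]0%R, b]%classic : set Rm) by exact: measurable_itv.
  have mpos : measurable (pos : set Rm) by exact: measurable_itv.
  have := integrableS mpos mb sb h.
  by apply: eq_integrable => // s sI; rewrite /gb indicE sI mul1r.
exists g; split => //.
- rewrite -polar// -uL; apply: ae_eq_integral => //.
    by have /integrableP[] := fi.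
  by move: aef; apply: ae_lebesgue2S => z h zT; exact/esym/h.
- move=> E S dE E0.
  have [phit lapE] := radial_test_function dE E0.
  have := ueq _ phit; rewrite lapE.
  have cE n : continuous (E n) by move=> s; exact: (is_derive_continuous (dE n s)).
  pose th (s : R) := (- (4 * (E 1%N s + s * E 2%N s)))%R.
  have cth : continuous th.
    move=> s; apply: cvgN; apply: cvgM; first exact: cvg_cst.
    by apply: cvgD; [exact: cE|apply: cvgM; [exact: cvg_id|exact: cE]].
  have E1 s : (S < s)%R -> E 1%N s = 0%R.
    move=> Ss; have z : is_derive s (1 : R)%R (E 0%N) 0%R.
      apply: (@near_is_derive _ (cst 0%R)).
      by near=> t; rewrite E0//; near: t; apply: filterS (lt_nbhsr Ss) => t /ltW.
    by have [_ <-] := dE 0%N s; have [_ ->] := z.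
  have E2 s : (S < s)%R -> E 2%N s = 0%R.
    move=> Ss; have z : is_derive s (1 : R)%R (E 1%N) 0%R.
      apply: (@near_is_derive _ (cst 0%R)).
      by near=> t; rewrite E1//; near: t; exact: (lt_nbhsr Ss).
    by have [_ <-] := dE 1%N s; have [_ ->] := z.
  (* The derivatives of E are known to vanish on the open half line s > S only, whence the shift to
     S + 1. *)
  have th0 s : (S + 1 <= s)%R -> th s = 0%R.
    move=> Ss; have Ss' : (S < s)%R by apply: lt_le_trans Ss; rewrite ltrDl.
    by rewrite /th E1// E2// !(mulr0, addr0) oppr0.
  have i1 : lam.-integrable pos (fun s => (g s * th s)%:E).
    exact: (integrable_times_vanishing mg gloc cth th0).
  have mth : measurable_fun [set: Rm] (th : Rm -> Rm) by exact: continuous_measurable_fun.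
  have mE0 : measurable_fun [set: Rm] (E 0%N : Rm -> Rm) by exact: continuous_measurable_fun.
  have m1 : measurable_fun [set: Rm] (fun s => (g s * th s)%:E).
    by apply/measurable_EFinP; exact: measurable_funM.
  have m2 : measurable_fun [set: Rm] (fun s => (curv (p / 2) g s * E 0%N s)%:E).
    by apply/measurable_EFinP; exact: measurable_funM.
  have [C C0 HC] := bounded_vanishing (cE 0%N) E0.
  have mpos : measurable (pos : set Rm) by exact: measurable_itv.
  have i2 : lam.-integrable pos (fun s => (curv (p / 2) g s * E 0%N s)%:E).
    apply: (le_integrable mpos _ _ (integrableZl mpos C fi1)).
    - exact: measurable_funTS.
    - move=> s /=; rewrite in_itv/= andbT => s0; rewrite lee_fin !normrM mulrC.
      by rewrite ler_wpM2r// (le_trans (HC s (ltW s0)))// ler_norm.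
  have p1 := polar m1 ((polar_integrable m1).2 i1).
  have p2 := polar m2 ((polar_integrable m2).2 i2).
  rewrite (@ae_eq_integral _ _ _ lam2 setT (fun z => (g (sqn z) * th (sqn z))%:E)) //; last 3 first.
  - apply/measurable_EFinP; apply: measurable_funM => //.
    exact: (measurableT_comp mth msqn).
  - exact: (measurableT_comp m1 msqn).
  - by move: ug; apply: ae_lebesgue2S => z /= uz _; rewrite uz.
  rewrite p1 (@ae_eq_integral _ _ _ lam2 setT (fun z => (curv (p / 2) g (sqn z) * E 0%N (sqn z))%:E)) //; last 3 first.
  - apply/measurable_EFinP; apply: measurable_funM => //.
      by have /integrableP[/measurable_EFinP] := fi.
    exact: (measurableT_comp mE0 msqn).
  - exact: (measurableT_comp m2 msqn).
  - by move: aef; apply: ae_lebesgue2S => z /= h zT; have [->] := h zT.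
  rewrite p2 => H; have pi0 := pi_gt0 R.
  have := congr1 (fun x => (pi^-1)%:E * x) H.
  by rewrite /= !muleA -EFinM mulVf ?gt_eqF// !mul1e.
Unshelve. all: by end_near. Qed.

End weak_to_ode.

Lemma dominated_cvg_real d (T : measurableType d) (R : realType) (mu : {measure set T -> \bar R})
    (f_ : nat -> T -> R) (f h : T -> R) :
  (forall n, measurable_fun setT (f_ n)) -> measurable_fun setT f ->
  (forall x, f_ ^~ x @ \oo --> f x) -> mu.-integrable setT (EFin \o h) ->
  (forall n x, `|f_ n x| <= h x) ->
  (\int[mu]_x (f_ n x)%:E @[n --> \oo] --> \int[mu]_x (f x)%:E)%E.
Proof.
move=> mf_ mf ff hi fh.
have [|||||_ _] := @dominated_convergence _ T R mu setT measurableT (fun n x => (f_ n x)%:E) (fun x => (f x)%:E) (EFin \o h).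
- by move=> n; exact/measurable_EFinP.
- exact/measurable_EFinP.
- by apply: aeW => x _; apply/cvg_EFin; [exact: nearW|exact: ff].
- exact: hi.
- by apply: aeW => x n _; rewrite /= lee_fin.
exact.
Qed.

(** * Approximate Dirac masses at Lebesgue points *)

Section lebesgue_kernel.
Variable R : realType.
Local Notation lam := (@lebesgue_measure R).
Local Notation Rm := (measurableTypeR R).
Local Open Scope ereal_scope.

(** K is at most B and lives on the ball of radius r, whose length 2 r undoes the normalisation of
    the mean deviation [davg]. *)
Lemma Rintegral_kernel_le (f K : R -> R) (a r B : R) : (0 < r)%R -> (0 <= B)%R ->
  measurable_fun [set: Rm] (f : Rm -> Rm) -> measurable_fun [set: Rm] (K : Rm -> Rm) ->
  (forall s, (`|K s| <= B)%R) -> (forall s, (r <= `|s - a|)%R -> K s = 0%R) ->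
  \int[lam]_s `|((f s - f a) * K s)%:E| <= (2 * B * r)%:E * davg f a r.
Proof.
move=> r0 B0 mf mK KB K0.
have mfa : measurable_fun [set: Rm] (fun s : Rm => (f s - f a)%R : Rm) by exact: measurable_funB.
have mball : measurable (ball a r : set Rm) by exact: measurable_ball.
pose h (s : Rm) : \bar R := (B * `|f s - f a|)%:E.
have mh : measurable_fun [set: Rm] h.
  by apply/measurable_EFinP; apply: measurable_funM => //; exact: measurableT_comp.
have -> : (2 * B * r)%:E * davg f a r = \int[lam]_(s in ball a r) h s.
  rewrite /davg /iavg (lebesgue_measure_ball _ (ltW r0)) /h.
  under [RHS]eq_integral do rewrite EFinM.
  rewrite ge0_integralZl//; last first.
    by apply: measurable_funTS; apply/measurable_EFinP; exact: measurableT_comp.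
  rewrite muleA inver mulrn_eq0/= gt_eqF// -EFinM; congr (_%:E * _).
  by field; rewrite gt_eqF.
rewrite [leRHS]integral_mkcond; apply: ge0_le_integral => //.
- by do 2 apply: measurableT_comp => //; exact: measurable_funM.
- by apply/(measurable_restrictT _ mball); exact: measurable_funTS.
move=> s _; rewrite patchE; case: ifPn => sb.
  by rewrite /h lee_fin normrM mulrC ler_wpM2r.
rewrite K0; first by rewrite mulr0 abse0.
by move: sb; rewrite notin_setE/= /ball/= => /negP; rewrite -leNgt distrC.
Qed.

Variables (D : nat -> R -> R) (C : R) (dD : derivative_seq D) (rD : ramp_like D C).

(** The shift by -1 places the transition in [a, a + 2/(n+1)], so that the steps tend everywhere to
    the indicator of s > a, with value 0 at a. Their derivatives [spike] tend to the Dirac mass at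
    a. *)
Definition step (n : nat) (a s : R) : R := (D 1 (n.+1%:R * (s - a) - 1))%R.
Definition spike (n : nat) (a s : R) : R := (n.+1%:R * D 2 (n.+1%:R * (s - a) - 1))%R.

Lemma step_derive n a (s : R) : is_derive s (1 : R)%R (step n a) (spike n a s).
Proof.
have h : is_derive s (1 : R)%R (fun x => n.+1%:R * (x - a) - 1 : R)%R n.+1%:R.
  by apply: is_derive_eq; rewrite /GRing.scale/=; ring.
have := @is_derive1_comp R (D 1) _ s _ _ (dD 1%N _) h.
by rewrite mulrC.
Qed.

Lemma continuous_step n a : continuous (step n a).
Proof. by move=> s; exact: (is_derive_continuous (step_derive n a s)). Qed.

Lemma continuous_spike n a : continuous (spike n a).
Proof.
move=> s; apply: cvgM; first exact: cvg_cst.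
apply: (@continuous_comp _ _ _ (fun x : R => n.+1%:R * (x - a) - 1)%R (D 2)).
  apply: cvgB; last exact: cvg_cst.
  by apply: cvgM; [exact: cvg_cst|apply: cvgB => //; exact: cvg_cst].
exact: (is_derive_continuous (dD 2%N _)).
Qed.

Lemma step_le n a s : (s <= a)%R -> step n a s = 0%R.
Proof.
move=> sa; have [D0 _ _ _ _] := rD; apply: (D0 _ _).2.
by rewrite lerBlDr addNr mulr_ge0_le0// subr_le0.
Qed.

Lemma step_ge n a s : (a + 2 / n.+1%:R <= s)%R -> step n a s = 1%R.
Proof.
move=> sa; have [_ D1 _ _ _] := rD; apply: D1.
by rewrite lerBrDr -ler_pdivrMl// mulrC lerBrDl.
Qed.

Lemma step01 n a s : (0 <= step n a s <= 1)%R.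
Proof. by have [_ _ D01 _ _] := rD; exact: D01. Qed.

Lemma cvg_step a s : (fun n => step n a s) @ \oo --> (if (s <= a)%R then 0%R else 1%R : R).
Proof.
apply: cvg_near_cst; case: ifPn => sa.
  by near=> n; rewrite step_le.
near=> n; apply: step_ge; rewrite -lerBrDl -ler_pdivlMl//.
move: sa; rewrite -ltNge => sa.
rewrite (_ : 2^-1 * (s - a) = (2 / (s - a))^-1)%R; last by rewrite invfM invrK mulrC.
rewrite lef_pV2 ?posrE ?divr_gt0 ?subr_gt0//.
apply: (@le_trans _ _ n%:R%R); last by rewrite ler_nat.
by near: n; exact: nbhs_infty_ger.
Unshelve. all: by end_near. Qed.

Lemma C_ge0 : (0 <= C)%R.
Proof. by have [_ _ _ D2 _] := rD; have /andP[h1 h2] := D2 0%R; exact: le_trans h2. Qed.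

Lemma spike_norm n a s : (`|spike n a s| <= n.+1%:R * C)%R.
Proof.
have [_ _ _ D2 _] := rD; rewrite /spike normrM ger0_norm//.
have /andP[h1 h2] := D2 (n.+1%:R * (s - a) - 1)%R.
by rewrite ler_pM2l// ger0_norm.
Qed.

(** The support lies to the right of a, but [davg] averages over centred balls; radius 3/(n+1)
    contains it with some margin. *)
Lemma spike_out n a s : (3 / n.+1%:R <= `|s - a|)%R -> spike n a s = 0%R.
Proof.
have [_ _ _ _ D20] := rD => h; rewrite /spike D20 ?mulr0//.
have {}h : (3 <= `|n.+1%:R * (s - a)|)%R by rewrite normrM ger0_norm// mulrC -ler_pdivrMr.
have := ler_normD (n.+1%:R * (s - a) - 1)%R 1%R; rewrite subrK normr1; lra.
Qed.

Lemma integral_spike n a : \int[lam]_s (spike n a s)%:E = 1%:E.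
Proof.
have n0 : (0 < 3 / n.+1%:R :> R)%R by rewrite divr_gt0.
rewrite (_ : 1%:E = (step n a (a + 3 / n.+1%:R))%:E - (step n a (a - 3 / n.+1%:R))%:E); last first.
  rewrite step_ge ?step_le ?sube0//; first by rewrite gerBl ltW.
  by rewrite lerD2l ler_pM2r ?invr_gt0// ler_nat.
rewrite -(@continuous_FTC2 _ (spike n a)); last 4 first.
- by move: (3 / n.+1%:R)%R n0 => x x0; lra.
- by apply: continuous_subspaceT; exact: continuous_spike.
- have cs := @continuous_step n a; split.
  + by move=> x _; have [] := step_derive n a x.
  + exact/cvg_at_right_filter/cs.
  + exact/cvg_at_left_filter/cs.
- by move=> x _; rewrite derive1E; have [] := step_derive n a x.
rewrite [RHS]integral_mkcond; apply: eq_integral => s _; rewrite patchE; case: ifPn => //.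
rewrite notin_setE/= in_itv/= => /negP h; rewrite spike_out//.
by move: h; rewrite -ler_distlC distrC -ltNge => /ltW.
Qed.

Lemma spike_out_itv n a (h : R -> R) s :
  s \notin (`[(a - 3 / n.+1%:R)%R, (a + 3 / n.+1%:R)%R]%classic : set Rm) -> (h s * spike n a s = 0)%R.
Proof.
rewrite notin_setE/= in_itv/= => /negP h1; rewrite spike_out ?mulr0//.
by move: h1; rewrite -ler_distlC distrC -ltNge => /ltW.
Qed.

Lemma integrable_spike n a (h : R -> R) : measurable_fun [set: Rm] (h : Rm -> Rm) ->
  (forall x y, lam.-integrable `[x, y]%classic (EFin \o h)) ->
  lam.-integrable setT (fun s => (h s * spike n a s)%:E).
Proof.
move=> mh hi; set J := (`[(a - 3 / n.+1%:R)%R, (a + 3 / n.+1%:R)%R]%classic : set Rm).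
have mJ : measurable J by exact: measurable_itv.
have mspike : measurable_fun [set: Rm] (spike n a : Rm -> Rm).
  exact: (continuous_measurable_fun (@continuous_spike n a)).
have hJ : lam.-integrable setT ((EFin \o h) \_ J) by apply/(integrable_mkcond _ mJ); exact: hi.
apply: (le_integrable measurableT _ _ (integrableZl measurableT (n.+1%:R * C) hJ)).
- by apply/measurable_EFinP; exact: (measurable_funM mh mspike).
- move=> s _; rewrite patchE; case: ifPn => sJ.
    have h1 := spike_norm n a s.
    rewrite /= lee_fin (normrM (h s)) (normrM _ (h s)) mulrC; apply: ler_wpM2r => //.
    by rewrite [leRHS]ger0_norm ?mulr_ge0 ?C_ge0.
  by rewrite spike_out_itv// abse0 abse_ge0.
Qed.

(** The height (n+1) C times the diameter 6/(n+1) of the ball stays equal to 6 C. The error is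
    therefore at most 6 C times the mean deviation of f over shrinking balls, which tends to 0 at a
    Lebesgue point. *)
Lemma spike_lebesgue_pt (f : R -> R) a : measurable_fun [set: Rm] (f : Rm -> Rm) ->
  (forall x y, lam.-integrable `[x, y]%classic (EFin \o f)) ->
  lebesgue_pt f a ->
  (\int[lam]_s (f s * spike n a s)%:E) @[n --> \oo] --> (f a)%:E.
Proof.
move=> mf fi fa.
have mspike n : measurable_fun [set: Rm] (spike n a : Rm -> Rm).
  exact: (continuous_measurable_fun (@continuous_spike n a)).
have r0 n : (0 < 3 / n.+1%:R :> R)%R by rewrite divr_gt0.
have ci c x y : lam.-integrable `[x, y]%classic (EFin \o (cst c)).
  apply: continuous_compact_integrable; first exact: segment_compact.
  by apply: continuous_subspaceT => z; exact: cvg_cst.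
have E n : \int[lam]_s (f s * spike n a s)%:E - (f a)%:E = \int[lam]_s ((f s - f a) * spike n a s)%:E.
  have -> : (f a)%:E = \int[lam]_s (f a * spike n a s)%:E.
    under eq_integral do rewrite EFinM.
    rewrite integralZl//; first by rewrite integral_spike mule1.
    have := @integrable_spike n a (cst 1%R) (measurable_cst _) (ci 1%R).
    by apply: eq_integrable => // s _ /=; rewrite mul1r.
  rewrite -integralB//; [|exact: integrable_spike|exact: (@integrable_spike n a (cst (f a)) (measurable_cst _) (ci (f a)))].
  by apply: eq_integral => s _; rewrite -EFinB mulrBl.
have davg0 : (6 * C)%:E * davg f a (3 / n.+1%:R) @[n --> \oo] --> 0.
  rewrite -[X in _ --> X](mule0 (6 * C)%:E); apply: cvgeZl => //.
  apply: (cvg_comp _ _ _ fa).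
  move=> P [e /= e0 He]; exists (Num.trunc (3 / e)).+1 => // n /= nn.
  apply: He; last exact: r0.
  rewrite /= sub0r normrN gtr0_norm ?r0// ltr_pdivrMr// mulrC -ltr_pdivrMr//.
  by apply: lt_le_trans (truncnS_gt _) _; rewrite ler_nat ltnW.
apply/sube_cvg0 => //; apply/cvg_abse0P.
apply: (@squeeze_cvge _ _ _ _ (cst 0) _ (fun n => (6 * C)%:E * davg f a (3 / n.+1%:R))) => //; last exact: cvg_cst.
apply: nearW => n; rewrite abse_ge0/= E.
have mfs : measurable_fun [set: Rm] (fun s => ((f s - f a) * spike n a s)%:E).
  by apply/measurable_EFinP; exact: (measurable_funM (measurable_funB mf (measurable_cst _)) (mspike n)).
apply: (le_trans (le_abse_integral _ measurableT mfs)).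
have -> : (6 * C = 2 * (n.+1%:R * C) * (3 / n.+1%:R))%R by field.
apply: Rintegral_kernel_le => //.
- by rewrite mulr_ge0// C_ge0.
- by move=> s; exact: spike_norm.
- by move=> s; exact: spike_out.
Qed.

End lebesgue_kernel.

(** * The du Bois-Reymond argument *)

Section du_bois_reymond.
Variable R : realType.
Local Notation lam := (@lebesgue_measure R).
Local Notation Rm := (measurableTypeR R).
Local Notation pos := (`]0%R, +oo[%classic : set Rm).
Variables (p Lambda : R) (u : R * R -> R) (g : R -> R).
Hypothesis prof : profile p Lambda u g.
Local Notation q := (p / 2)%R.

(** Extension by 0 to s <= 0 allows integration over the whole line. In the weak equation E' is
    tested against g and E'' against s g, whence [sgp]. *)
Definition gp (s : R) : R := (\1_pos s * g s)%R.
Definition Fp (s : R) : R := (\1_pos s * curv q g s)%R.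
Definition sgp (s : R) : R := (s * gp s)%R.

Lemma indic_pos1 (s : R) : 0 < s -> \1_pos s = 1 :> R.
Proof. by move=> s0; rewrite indicE mem_set//= in_itv/= s0. Qed.

Lemma indic_pos0 (s : R) : s <= 0 -> \1_pos s = 0 :> R.
Proof. by move=> s0; rewrite indicE memNset//= in_itv/= andbT; apply/negP; rewrite -leNgt. Qed.

Let mpos : measurable pos. Proof. exact: measurable_itv. Qed.

Lemma measurable_gp : measurable_fun [set: Rm] (gp : Rm -> Rm).
Proof. by apply: measurable_funM; [exact: measurable_indic|exact: (profile_measurable prof)]. Qed.

Lemma measurable_Fp : measurable_fun [set: Rm] (Fp : Rm -> Rm).
Proof.
apply: measurable_funM; first exact: measurable_indic.
by apply: measurable_powR_curv; exact: (profile_measurable prof).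
Qed.

Lemma measurable_sgp : measurable_fun [set: Rm] (sgp : Rm -> Rm).
Proof. by apply: measurable_funM; [exact: measurable_id|exact: measurable_gp]. Qed.

Local Open Scope ereal_scope.

Lemma integrable_gp x y : lam.-integrable `[x, y]%classic (EFin \o gp).
Proof.
have mJ : measurable (`]0%R, y]%classic : set Rm) by exact: measurable_itv.
have mxy : measurable (`[x, y]%classic : set Rm) by exact: measurable_itv.
have h : lam.-integrable setT ((EFin \o g) \_ (`]0%R, y]%classic : set Rm)).
  by apply/(integrable_mkcond _ mJ); exact: (profile_loc prof).
have := integrableS measurableT mxy (@subsetT _ _) h.
apply: eq_integrable => // s; rewrite inE/= in_itv/= => /andP[_ sy]; rewrite patchE /= /gp.
have [s0|s0] := ltP 0%R s; first by rewrite mem_set ?indic_pos1 ?mul1r//= in_itv/= s0.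
by rewrite memNset ?indic_pos0 ?mul0r//= in_itv/= ltNge s0.
Qed.

Lemma integrable_sgp x y : lam.-integrable `[x, y]%classic (EFin \o sgp).
Proof.
have mxy : measurable (`[x, y]%classic : set Rm) by exact: measurable_itv.
apply: (le_integrable mxy _ _ (integrableZl mxy (`|x| + `|y|)%R (integrable_gp x y))).
  by apply/measurable_EFinP/measurable_funTS; exact: measurable_sgp.
move=> s /=; rewrite in_itv/= => /andP[xs sy]; rewrite lee_fin !normrM; apply: ler_wpM2r => //.
rewrite [leRHS]ger0_norm ?addr_ge0// ler_norml; apply/andP; split.
  by have := ler_norm (- x)%R; have := normr_ge0 y; rewrite normrN; lra.
by have := ler_norm y; have := normr_ge0 x; lra.
Qed.

Lemma integrable_Fp : lam.-integrable setT (EFin \o Fp).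
Proof.
have := (integrable_mkcond (mu := lam) (fun s => (curv q g s)%:E) mpos).1 (profile_curv prof).
apply: eq_integrable => // s _; rewrite patchE /= /Fp indicE.
by case: ifPn => _; rewrite /= ?mul1r ?mul0r.
Qed.

Lemma integral_pos_indic (f : R -> R) : \int[lam]_s (\1_pos s * f s)%:E = \int[lam]_(s in pos) (f s)%:E.
Proof.
rewrite [RHS]integral_mkcond; apply: eq_integral => s _; rewrite patchE indicE.
by case: ifPn => _; rewrite ?mul1r ?mul0r.
Qed.

Lemma integral_Fp : \int[lam]_s (Fp s)%:E = (Lambda / pi)%:E.
Proof.
rewrite integral_pos_indic.
have h := profile_mass prof; have pi0 := pi_gt0 R.
have := congr1 (fun x => (pi^-1)%:E * x) h.
by rewrite muleA -!EFinM mulVf ?gt_eqF// mul1e => ->; rewrite mulrC.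
Qed.

Lemma profile_eq_setT E S : derivative_seq E -> (forall s, (S <= s)%R -> E 0%N s = 0%R) ->
  \int[lam]_s (gp s * - (4 * (E 1%N s + s * E 2%N s)))%:E = \int[lam]_s (Fp s * E 0%N s)%:E.
Proof.
move=> dE E0; have := profile_eq prof dE E0; rewrite -!integral_pos_indic => h.
under eq_integral do rewrite /gp -mulrA.
by rewrite h; apply: eq_integral => s _; rewrite /Fp mulrA.
Qed.

Variables (D : nat -> R -> R) (C : R) (dD : derivative_seq D) (rD : ramp_like D C).

(** The k-th derivative of a smoothed max(s - a, 0) - max(s - b, 0) - (b - a), the powers of n + 1
    coming from the chain rule. Subtracting b - a, at order 0 only, makes the function vanish for
    large s, as a test function must, and leaves it nonzero near the origin. *)
Definition pot (n : nat) (a b : R) (k : nat) (s : R) : R :=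
  (n.+1%:R ^+ k / n.+1%:R * (D k (n.+1%:R * (s - a) - 1) - D k (n.+1%:R * (s - b) - 1))
   - (if k == 0%N then b - a else 0))%R.

Lemma pot_derive n a b : derivative_seq (pot n a b).
Proof.
move=> k s; rewrite /pot.
have dk c : is_derive s (1 : R)%R (fun s => D k (n.+1%:R * (s - c) - 1)%R) (n.+1%:R * D k.+1 (n.+1%:R * (s - c) - 1))%R.
  have h : is_derive s (1 : R)%R (fun x => n.+1%:R * (x - c) - 1 : R)%R n.+1%:R.
    by apply: is_derive_eq; rewrite /GRing.scale/=; ring.
  have := @is_derive1_comp R (D k) _ s _ _ (dD k _) h.
  by rewrite mulrC.
have h1 := dk a; have h2 := dk b.
by apply: is_derive_eq; rewrite /GRing.scale/= [(_ ^+ k.+1)%R]exprS; ring.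
Qed.

Lemma pot1 n a b s : pot n a b 1 s = (step D n a s - step D n b s)%R.
Proof. by rewrite /pot /= expr1 mulfV// mul1r subr0. Qed.

Lemma pot2 n a b s : pot n a b 2 s = (spike D n a s - spike D n b s)%R.
Proof. by rewrite /pot /= /spike subr0 expr2 mulfK// mulrBr. Qed.

Lemma D0_right : exists c, forall t, (1 <= t)%R -> D 0%N t = (t - c)%R.
Proof.
exists (1 - D 0%N 1)%R => t t1; have [_ D1 _ _ _] := rD.
suff : (t - D 0%N t = 1 - D 0%N 1)%R by lra.
apply/esym; apply: (@is_derive_eq0_const _ (fun x => x - D 0%N x)%R (fun x => 1 - D 1%N x)%R _ _ t1).
  by move=> x _; have h := dD 0%N x; exact: is_derive_eq.
by move=> x /andP[x1 _]; rewrite D1 ?subrr// ltW.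
Qed.

Lemma pot0_right n a b s : (a <= b)%R -> (b + 2 / n.+1%:R <= s)%R -> pot n a b 0 s = 0%R.
Proof.
move=> ab bs; have [c Dc] := D0_right.
have h t : (t <= b)%R -> (1 <= n.+1%:R * (s - t) - 1)%R.
  move=> tb; rewrite lerBrDr -ler_pdivrMl// mulrC lerBrDl (le_trans _ bs)// lerD2r//.
rewrite /pot /= expr0 !Dc ?h//; field.
by rewrite nat1r pnatr_eq0.
Qed.

Lemma pot0_dist n a b s :
  (`|pot n a b 0 s - (Num.max (a - s) 0 - Num.max (b - s) 0)| <= 6 / n.+1%:R)%R.
Proof.
have n0 : (0 < n.+1%:R :> R)%R by [].
(* In 3, 2 comes from [ramp_like_dist] and 1 from the shift of the argument by -1; the two ramps
   together give 6. *)
have h c : (`|D 0%N (n.+1%:R * (s - c) - 1) / n.+1%:R - Num.max (s - c) 0| <= 3 / n.+1%:R)%R.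
  have -> : (D 0%N (n.+1%:R * (s - c) - 1) / n.+1%:R - Num.max (s - c) 0 =
    (D 0%N (n.+1%:R * (s - c) - 1) - Num.max (n.+1%:R * (s - c)) 0) / n.+1%:R)%R.
    have -> : (Num.max (n.+1%:R * (s - c)) 0 = n.+1%:R * Num.max (s - c) 0)%R.
      by rewrite maxr_pMr ?mulr0.
    by field; rewrite nat1r pnatr_eq0.
  rewrite normrM [X in (_ * X)%R]gtr0_norm ?invr_gt0// ler_pM2r ?invr_gt0//.
  have := ramp_like_dist (n.+1%:R * (s - c) - 1)%R dD rD.
  move: (n.+1%:R * (s - c))%R => t /ler_normlP[h1 h2]; rewrite ler_norml.
  move: h1 h2; case: (leP t 0%R) => t0; case: (leP (t - 1)%R 0%R) => t1; lra.
have := h a; have := h b.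
have E c : Num.max (s - c)%R 0%R = (s - c + Num.max (c - s) 0)%R.
  by case: (leP (s - c)%R 0%R) => ?; case: (leP (c - s)%R 0%R) => ?; lra.
rewrite /pot /= expr0 !E => /ler_normlP[h1 h2] /ler_normlP[h3 h4].
rewrite mulrBr !(mulrC (1 / n.+1%:R)%R) !mulrA !mulr1.
have -> : (6 / n.+1%:R = 3 / n.+1%:R + 3 / n.+1%:R :> R)%R by field.
move: h1 h2 h3 h4; rewrite ler_norml.
move: (D 0%N _ / _)%R (D 0%N (_ * (s - b) - 1) / _)%R (3 / _)%R (Num.max (b - s) 0)%R (Num.max (a - s) 0)%R.
move=> ? ? ? ? ?; lra.
Qed.

Definition tent (b s : R) : R := Num.max (b - s)%R 0%R.
(** The second primitive of [Fp] vanishing on s <= 0, written as a single integral so that it makes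
    sense before any regularity is known. *)
Definition Npot (b : R) : R := (\int[lam]_s (Fp s * tent b s))%R.

Lemma continuous_tent b : continuous (tent b).
Proof.
move=> s; apply: (@continuous_max _ _ (fun s : R => (b - s)%R) (cst 0%R)); last exact: cvg_cst.
by apply: cvgB; [exact: cvg_cst|exact: cvg_id].
Qed.

Lemma tent_lip a b s : (`|tent a s - tent b s| <= `|a - b|)%R.
Proof.
rewrite /tent ler_norml; have := ler_norm (a - b)%R; have := ler_norm (b - a)%R.
rewrite distrC; move: `|_|%R => y h1 h2.
by case: (leP (a - s)%R 0%R) => ?; case: (leP (b - s)%R 0%R) => ?; apply/andP; split; lra.
Qed.

(* The test functions [pot n a b 0] approximate the difference of the tents at [a]
   and [b], and their second derivatives a difference of Dirac masses. *)
Lemma du_bois_reymond a b : (0 < a)%R -> (a < b)%R -> lebesgue_pt sgp a -> lebesgue_pt sgp b ->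
  \int[lam]_(s in `]a, b]) (gp s)%:E = (sgp b - sgp a)%:E +
   (4^-1)%:E * \int[lam]_s (Fp s * (tent b s - tent a s))%:E.
Proof.
move=> a0 ab la lb.
have mgp := measurable_gp; have mFp := measurable_Fp; have msgp := measurable_sgp.
have cpot n k : continuous (pot n a b k) by move=> s; exact: (is_derive_continuous (pot_derive n a b k s)).
have mpot n k : measurable_fun [set: Rm] (pot n a b k : Rm -> Rm) by exact: continuous_measurable_fun.
(* The transitions end at b + 2/(n+1) <= b + 2, so J contains the support of [pot n a b 1] for all n
   and provides one dominating function. *)
pose J : set Rm := `[a, (b + 2)%R]%classic.
have mJ : measurable J by exact: measurable_itv.
have gJ : lam.-integrable setT (abse \o ((EFin \o gp) \_ J)).
  by apply: integrable_abse => //; apply/(integrable_mkcond _ mJ); exact: integrable_gp.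
have pot1_bound n s : `|(gp s * pot n a b 1 s)%:E| <= (abse \o ((EFin \o gp) \_ J)) s.
  rewrite /= patchE; case: ifPn => sJ.
    rewrite lee_fin normrM ler_piMr// pot1.
    have /andP[h1 h2] := step01 rD n a s; have /andP[h3 h4] := step01 rD n b s.
    by rewrite ler_norml; apply/andP; split; lra.
  have : (s < a)%R \/ (b + 2 < s)%R.
    move: sJ; rewrite /J notin_setE/= in_itv/= => /negP; rewrite negb_and -!ltNge.
    by case/orP; [left|right].
  rewrite pot1; case=> h.
    have -> : (step D n a s - step D n b s = 0)%R by rewrite !(step_le rD) ?subrr//; lra.
    by rewrite mulr0 normr0 abse_ge0.
  have n1 : (2 / n.+1%:R <= 2 :> R)%R by rewrite ler_piMr// invf_le1// ler1n.
  have hs c : (c <= b)%R -> step D n c s = 1%R.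
    by move=> cb; apply: (step_ge rD); apply: (le_trans (lerD cb n1)); exact: ltW.
  have -> : (step D n a s - step D n b s = 0)%R by rewrite !hs ?subrr// ltW.
  by rewrite mulr0 normr0 abse_ge0.
have mg1 n : measurable_fun [set: Rm] (fun s => (gp s * pot n a b 1 s)%:E).
  by apply/measurable_EFinP; exact: (measurable_funM mgp (mpot n 1%N)).
have ig1 n : lam.-integrable setT (fun s => (gp s * pot n a b 1 s)%:E).
  apply: (le_integrable measurableT (mg1 n) _ gJ) => s _.
  by rewrite (le_trans (pot1_bound n s))// /= abse_id.
have lim1 : \int[lam]_s (gp s * pot n a b 1 s)%:E @[n --> \oo] --> \int[lam]_(s in `]a, b]) (gp s)%:E.
  have -> : \int[lam]_(s in `]a, b]) (gp s)%:E =
      \int[lam]_s (gp s * \1_(`]a, b]%classic : set Rm) s)%:E.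
    rewrite [LHS]integral_mkcond; apply: eq_integral => s _; rewrite patchE indicE.
    by case: ifPn => _; rewrite ?mulr1 ?mulr0.
  apply: (@dominated_cvg_real _ _ R lam (fun n s => gp s * pot n a b 1 s)%R
     (fun s => gp s * \1_(`]a, b]%classic : set Rm) s)%R (fun s => `|gp s * \1_J s|)%R).
  - by move=> n; exact: (measurable_funM mgp (mpot n 1%N)).
  - by apply: (measurable_funM mgp); apply: measurable_indic; exact: measurable_itv.
  - move=> s; apply: cvgM; first exact: cvg_cst.
    have -> : (\1_(`]a, b]%classic : set Rm) s = (if (s <= a)%R then 0%R else 1%R : R) - (if (s <= b)%R then 0%R else 1%R : R) :> R)%R.
      have [sab|sab] := boolP (s \in (`]a, b]%classic : set Rm)); rewrite indicE.
        rewrite sab; move: sab; rewrite inE/= in_itv/= => /andP[h1 h2].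
        by rewrite h2 leNgt h1 /= subr0.
      rewrite (negbTE sab); move: sab; rewrite notin_setE/= in_itv/= => /negP.
      rewrite negb_and -leNgt -ltNge => /orP[h|h].
        by rewrite h (le_trans h (ltW ab)) subrr.
      by rewrite !leNgt h (lt_trans ab h) /= subrr.
    rewrite (_ : (fun n => pot n a b 1 s) = (fun n => step D n a s - step D n b s)%R); last first.
      by apply/funext => n; rewrite pot1.
    by apply: cvgB; exact: (cvg_step rD).
  - apply: eq_integrable gJ => // s _; rewrite /= patchE indicE.
    by case: ifPn => _; rewrite ?mulr1 ?mulr0 ?normr0 /= ?normr0.
  - move=> n s; have := pot1_bound n s; rewrite /= patchE indicE.
    by case: ifPn => _; rewrite ?mulr1 ?mulr0 ?normr0 /= ?normr0 lee_fin.
have lim2 c : lebesgue_pt sgp c -> \int[lam]_s (sgp s * spike D n c s)%:E @[n --> \oo] --> (sgp c)%:E.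
  by move=> lc; apply: (spike_lebesgue_pt dD rD) => //; exact: integrable_sgp.
have is2 n c : lam.-integrable setT (fun s => (sgp s * spike D n c s)%:E).
  by apply: (integrable_spike dD rD) => //; exact: integrable_sgp.
have Fabs : lam.-integrable setT (fun s => ((6 + (b - a))%:E * (abse \o (EFin \o Fp)) s)).
  by apply: integrableZl => //; apply: integrable_abse => //; exact: integrable_Fp.
have mFt : measurable_fun [set: Rm] (fun s => (Fp s * (tent a s - tent b s))%:E).
  apply/measurable_EFinP; apply: (measurable_funM mFp); apply: measurable_funB.
    exact: (continuous_measurable_fun (@continuous_tent a)).
  exact: (continuous_measurable_fun (@continuous_tent b)).
have lim0 : \int[lam]_s (Fp s * pot n a b 0 s)%:E @[n --> \oo] --> \int[lam]_s (Fp s * (tent a s - tent b s))%:E.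
  apply: (@dominated_cvg_real _ _ R lam (fun n s => Fp s * pot n a b 0 s)%R
     (fun s => Fp s * (tent a s - tent b s))%R (fun s => (6 + (b - a)) * `|Fp s|)%R).
  - by move=> n; exact: (measurable_funM mFp (mpot n 0%N)).
  - exact/measurable_EFinP.
  - move=> s; apply: cvgM; first exact: cvg_cst.
    apply/cvgrPdist_le => e e0; near=> n.
    rewrite distrC (le_trans (pot0_dist n a b s))// ler_pdivrMr// mulrC -ler_pdivrMr//.
    apply: (@le_trans _ _ n%:R%R); last by rewrite ler_nat.
    by near: n; exact: nbhs_infty_ger.
  - exact: Fabs.
  - move=> n s; rewrite /= normrM mulrC ler_wpM2r//.
    have h1 := pot0_dist n a b s; have h2 := tent_lip a b s.
    have n1 : (6 / n.+1%:R <= 6 :> R)%R by rewrite ler_piMr// invf_le1// ler1n.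
    have h3 := ler_normD (pot n a b 0 s - (tent a s - tent b s))%R (tent a s - tent b s)%R.
    rewrite subrK in h3; have h4 : (`|a - b| = b - a)%R by rewrite ler0_norm; lra.
    rewrite h4 in h2; apply: (le_trans h3); apply: lerD => //.
    exact: le_trans h1 n1.
(* The weak equation for [pot n a b], with s moved from E'' onto g so that the spikes act on
   [sgp]. *)
have H n : (-4)%:E * (\int[lam]_s (gp s * pot n a b 1 s)%:E +
   (\int[lam]_s (sgp s * spike D n a s)%:E - \int[lam]_s (sgp s * spike D n b s)%:E)) =
   \int[lam]_s (Fp s * pot n a b 0 s)%:E.
  rewrite -(@profile_eq_setT (pot n a b) (b + 2 / n.+1%:R)%R (@pot_derive n a b)); last first.
    by move=> s; apply: pot0_right; exact: ltW.
  rewrite -integralB// -integralD//; last exact: integrableB.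
  rewrite -integralZl//; last by apply: integrableD => //; exact: integrableB.
  apply: eq_integral => s _; rewrite /= -!EFinD -EFinM; congr EFin.
  by rewrite pot2 /sgp; ring.
have fin1 : \int[lam]_(s in `]a, b]) (gp s)%:E \is a fin_num.
  apply: integrable_fin_num => //.
  apply: (integrableS _ _ _ (integrable_gp a b)) => //; exact: subset_itv_oc_cc.
have lim3 : (-4)%:E * (\int[lam]_s (gp s * pot n a b 1 s)%:E +
   (\int[lam]_s (sgp s * spike D n a s)%:E - \int[lam]_s (sgp s * spike D n b s)%:E)) @[n --> \oo] -->
   (-4)%:E * (\int[lam]_(s in `]a, b]) (gp s)%:E + ((sgp a)%:E - (sgp b)%:E)).
  apply: cvgeZl => //; apply: cvgeD; [by rewrite fin_num_adde_defr|exact: lim1|].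
  by apply: cvgeB; [by []|exact: lim2|exact: lim2].
rewrite (funext H) in lim3.
have iFt : lam.-integrable setT (fun s => (Fp s * (tent a s - tent b s))%:E).
  apply: (le_integrable measurableT mFt _ Fabs) => s _.
  rewrite /= lee_fin normrM [leRHS]ger0_norm; last by rewrite mulr_ge0//; lra.
  rewrite mulrC ler_wpM2r// (le_trans (tent_lip a b s))// ler0_norm; lra.
have EL := cvg_unique (@ereal_hausdorff R) lim3 lim0.
have {}EL := EL (fmap_proper_filter _ eventually_filter).
have -> : \int[lam]_s (Fp s * (tent b s - tent a s))%:E = (-1)%:E * \int[lam]_s (Fp s * (tent a s - tent b s))%:E.
  rewrite -(integralZl measurableT iFt).
  by apply: eq_integral => s _; rewrite -EFinM; congr EFin; ring.
have [X EX] : exists X, \int[lam]_(s in `]a, b]) (gp s)%:E = X%:E.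
  by exists (fine (\int[lam]_(s in `]a, b]) (gp s)%:E)); rewrite fineK.
rewrite -EL EX -[RHS]/((sgp b - sgp a + 4^-1 * (-1 * (-4 * (X + (sgp a - sgp b)))))%R%:E).
congr EFin; field.
Unshelve. all: by end_near. Qed.

End du_bois_reymond.

(** * From the integrated identity to the differential equation *)

Section profile_ode.
Variable R : realType.
Local Notation lam := (@lebesgue_measure R).
Local Notation Rm := (measurableTypeR R).
Local Notation pos := (`]0%R, +oo[%classic : set Rm).

(* Running integrals from [-1]: the integrands vanish on [s <= 0]. *)
Definition running (f : R -> R) (x : R) : R := (\int[lam]_(s in `[(-1)%R, x]) f s)%R.

Section running.
Variables (f : R -> R).
Hypothesis fi : forall x y, lam.-integrable `[x, y]%classic (EFin \o f).
Hypothesis f0 : forall s, s <= 0 -> f s = 0.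

Lemma running_le0 x : x <= 0 -> running f x = 0.
Proof.
move=> x0; rewrite /running (@eq_Rintegral _ _ _ _ _ (cst 0)) ?Rintegral_cst ?mul0r// => t.
by rewrite inE/= in_itv/= => /andP[_ tx]; rewrite f0// (le_trans tx).
Qed.

Lemma continuous_running : continuous (running f).
Proof.
move=> x; have [x0|x0] := ltP x 0.
  have : {near x, cst 0 =1 running f}.
    near=> y; rewrite /= running_le0//; near: y.
    by apply: filterS (lt_nbhsl x0) => y /ltW.
  move=> /near_eq_cvg h; rewrite /continuous_at (running_le0 (ltW x0)).
  by apply: cvg_trans h _; exact: cvg_cst.
have h := @parameterized_integral_continuous R (-1) (x + 1) f ltac:(lra) (fi _ _).
have oI : open (`](-1)%R, (x + 1)%R[%classic : set R) by exact: interval_open.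
have {}h : {within `](-1)%R, (x + 1)%R[, continuous (running f)}.
  by apply: continuous_subspaceW h; exact: subset_itv_oo_cc.
move: h; rewrite continuous_open_subspace//; apply.
by rewrite inE/= in_itv/=; apply/andP; split; lra.
Unshelve. all: by end_near. Qed.

Lemma running_derive (x : R) : 0 < x -> {for x, continuous f} -> is_derive x 1 (running f) (f x).
Proof.
move=> x0 cf; have x1 : x < x + 1 by rewrite ltrDl.
have xm : -1 < x by lra.
have := @continuous_FTC1_closed R f (-1) x (x + 1) x1 (fi _ _) xm cf.
rewrite -[fun _ => _]/(running f) => -[dP PE]; split; first exact: dP.
by rewrite -derive1E.
Qed.

Lemma running_diff x y : 0 < x -> x <= y ->
  running f y - running f x = (\int[lam]_(s in `]x, y]) f s)%R.
Proof.
move=> x0 xy; rewrite /running; apply: Rintegral_itvB; first exact: fi.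
  by rewrite bnd_simp; lra.
by rewrite bnd_simp.
Qed.

End running.

Lemma running_cvgy (f : R -> R) : lam.-integrable setT (EFin \o f) ->
  (forall s, s <= 0 -> f s = 0) ->
  running f x @[x --> +oo] --> (\int[lam]_s f s)%R.
Proof.
move=> fi f0; apply/cvg_pinftyP => w wy.
have mf : measurable_fun [set: Rm] (f : Rm -> Rm) by have /integrableP[/measurable_EFinP] := fi.
pose J n : set Rm := `[(-1)%R, w n]%classic.
have mJ n : measurable (J n) by exact: measurable_itv.
have h : (\int[lam]_s (f s * \1_(J n) s)%:E)%E @[n --> \oo] --> (\int[lam]_s (f s)%:E)%E.
  apply: (@dominated_cvg_real _ _ R lam (fun n s => f s * \1_(J n) s) f (fun s => `|f s|)) => //.
  - by move=> n; apply: (measurable_funM mf); exact: measurable_indic.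
  - move=> s; apply: cvg_near_cst; near=> n.
    rewrite indicE; have [sJ|] := boolP (s \in J n); first by rewrite mulr1.
    rewrite /J notin_setE/= in_itv/= => /negP.
    rewrite negb_and -!ltNge => /orP[s1|ws]; first by rewrite f0 ?mul0r//; lra.
    suff : s <= w n by rewrite leNgt ws.
    by near: n; apply: (cvgryPge _).1.
  - exact: (integrable_abse fi).
  - move=> n s; rewrite normrM ler_piMr// indicE.
    by case: (_ \in _); rewrite ?normr1 ?normr0.
have Jint n : lam.-integrable (J n) (EFin \o f) by apply: integrableS fi.
rewrite /Rintegral.
apply: (fine_cvg _); rewrite fineK; last exact: integrable_fin_num.
suff -> : (fun n => \int[lam]_(s in `[(-1)%R, w n]) (f s)%:E)%E = (fun n => \int[lam]_s (f s * \1_(J n) s)%:E)%E by [].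
apply/funext => n; rewrite [LHS]integral_mkcond; apply: eq_integral => s _; rewrite patchE indicE.
by case: ifPn => _; rewrite ?mulr1 ?mulr0.
Unshelve. all: by end_near. Qed.

Variables (p Lambda : R) (u : R * R -> R) (g : R -> R).
Hypothesis prof : profile p Lambda u g.
Local Notation q := (p / 2)%R.
Local Notation gp := (gp g).
Local Notation sgp := (sgp g).
Local Notation Fp := (Fp p g).

Lemma sgp_lebesgue_pts : {ae lam, forall x, lebesgue_pt sgp x}.
Proof.
apply: lebesgue_differentiation; split.
- exact: (measurable_sgp prof).
- exact: openT.
- move=> K _ cK; have [M [_ HM]] := compact_bounded cK.
  have mK : measurable (K : set Rm) by exact: compact_measurable.
  have h := HM (M + 1) ltac:(lra).
  pose J : set Rm := `[(- (M + 1))%R, (M + 1)%R]%classic.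
  have mJ : measurable J by exact: measurable_itv.
  have /integrableP[_] := integrable_sgp prof (- (M + 1)) (M + 1).
  apply: le_lt_trans; apply: ge0_subset_integral => //.
    by apply/measurable_funTS; do 2 apply: measurableT_comp => //; exact: (measurable_sgp prof).
  by move=> x Kx; rewrite /J /= in_itv/= -ler_norml; exact: h.
Qed.

Lemma integrable_Fp_tent b : lam.-integrable setT (fun s => (Fp s * tent b s)%:E).
Proof.
have mFp := measurable_Fp prof.
have h := integrableZl measurableT (Num.max b 0) (integrable_abse (integrable_Fp prof)).
apply: (le_integrable measurableT _ _ h).
  apply/measurable_EFinP; apply: measurable_funM => //.
  exact: (continuous_measurable_fun (@continuous_tent R b)).
move=> s _; rewrite /= lee_fin normrM mulrC.
have b0 : 0 <= Num.max b 0 by rewrite le_max lexx orbT.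
rewrite [leRHS]ger0_norm ?mulr_ge0//.
have [s0|s0] := ltP 0 s; last by rewrite /Fp indic_pos0// mul0r normr0 !mulr0.
rewrite ler_wpM2r// ger0_norm ?/tent ?le_max ?lexx ?orbT//.
by case: (leP (b - s) 0) => ?; case: (leP b 0) => ?; lra.
Qed.

Lemma continuous_Npot : continuous (Npot p g).
Proof.
move=> b; pose L := (\int[lam]_s `|Fp s|)%R.
have L0 : 0 <= L by apply: Rintegral_ge0.
have lip x y : `|Npot p g x - Npot p g y| <= L * `|x - y|.
  have mT := @measurableT _ Rm.
  have iF : lam.-integrable setT (EFin \o (fun s => `|Fp s|)) by exact: (integrable_abse (integrable_Fp prof)).
  rewrite /Npot -RintegralB//; [|exact: integrable_Fp_tent|exact: integrable_Fp_tent].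
  have iD : lam.-integrable setT (EFin \o (fun s => Fp s * tent x s - Fp s * tent y s)).
    have := integrableB mT (integrable_Fp_tent x) (integrable_Fp_tent y).
    by apply: eq_integrable.
  apply: (le_trans (le_normr_Rintegral mT iD)).
  rewrite /L -RintegralZr//; apply: le_Rintegral => //.
  - exact: (integrable_abse iD).
  - have := integrableZr mT `|x - y| iF; by apply: eq_integrable.
  - by move=> s _; rewrite -mulrBr normrM ler_wpM2l// tent_lip.
apply/cvgrPdist_le => e e0; near=> x.
apply: (le_trans (lip b x)); apply: (@le_trans _ _ ((L + 1) * `|b - x|)).
  by rewrite ler_wpM2r// lerDl.
rewrite -ler_pdivlMl ?ltr_wpDl//.
near: x; apply: (@cvgr_dist_le _ _ _ (nbhs b) _ id b); first exact: cvg_id.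
by rewrite mulr_gt0// invr_gt0 ltr_wpDl.
Unshelve. all: by end_near. Qed.

(** With one Lebesgue point a0 fixed, the du Bois-Reymond identity reads s g = c0 + I - N / 4 at
    every Lebesgue point s > 0, with I and N continuous. The right side thus defines a continuous
    representative v. Putting v for g inside I and N changes neither, but now makes both
    differentiable. *)
Lemma profile_ode : exists v M, radial_ode q (Lambda / pi) v M /\
  {ae @lebesgue2 R, forall z, u z = v (sqn z)}.
Proof.
have [D [C [dD rD]]] := smooth_ramp_exists R.
have mT := @measurableT _ Rm.
have mpos : measurable pos by exact: measurable_itv.
have mgp := measurable_gp prof; have mFp := measurable_Fp prof.
have gpi := integrable_gp prof.
have gp0 s : s <= 0 -> gp s = 0 by move=> s0; rewrite /gp indic_pos0// mul0r.
pose I := running gp; pose N := Npot p g.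
have dbr a b : 0 < a -> a < b -> lebesgue_pt sgp a -> lebesgue_pt sgp b ->
    I b - I a = sgp b - sgp a + 4^-1 * (N b - N a).
  move=> a0 ab la lb; rewrite /I running_diff ?ltW//.
  have := du_bois_reymond prof dD rD a0 ab la lb => /(congr1 fine).
  have i1 := integrable_Fp_tent b; have i2 := integrable_Fp_tent a.
  have fE : (\int[lam]_s (Fp s * (tent b s - tent a s))%:E = (N b - N a)%:E)%E.
    rewrite /N /Npot -RintegralB// /Rintegral fineK.
      by apply: eq_integral => s _; rewrite mulrBr.
    exact: (integrable_fin_num mT (integrableB mT i1 i2)).
  by rewrite fE.
have Ic : continuous I by exact: (continuous_running gpi gp0).
have Nc : continuous N by exact: continuous_Npot.
have [a0 a00 la0] : exists2 a0 : R, 0 < a0 & lebesgue_pt sgp a0.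
  apply: contrapT => H; have [Z [mZ Z0 subZ]] := sgp_lebesgue_pts.
  have : (lam `]0%R, 1%R[ <= lam Z)%E.
    apply: le_measure; rewrite ?inE//.
    move=> x /=; rewrite in_itv/= => /andP[x0 _]; apply: subZ => /= xl.
    by apply: H; exists x.
  by rewrite Z0 lebesgue_measure_itv/= lte_fin ltr01 -EFinD subr0 lee_fin ler10.
pose c0 := sgp a0 - I a0 + 4^-1 * N a0.
pose v (s : R) := (c0 + I s - 4^-1 * N s) / s.
pose vp (s : R) := \1_pos s * v s.
have vcont s : 0 < s -> {for s, continuous v}.
  move=> s0; apply: cvgM; last by apply: cvgV; [rewrite gt_eqF|exact: cvg_id].
  apply: cvgB; first by apply: cvgD; [exact: cvg_cst|exact: Ic].
  by apply: cvgM; [exact: cvg_cst|exact: Nc].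
have mvp : measurable_fun [set: Rm] (vp : Rm -> Rm).
  have -> : vp = (fun s => (c0 + I s - 4^-1 * N s) * (\1_pos s * s `^ (-1))).
    apply/funext => s; rewrite /vp /v; have [s0|s0] := ltP 0 s; last by rewrite indic_pos0// !mul0r mulr0.
    by rewrite indic_pos1// !mul1r powR_inv1// ltW.
  apply: measurable_funM.
    apply: measurable_funB; first by apply: measurable_funD => //; exact: (continuous_measurable_fun Ic).
    by apply: measurable_funM => //; exact: (continuous_measurable_fun Nc).
  by apply: measurable_funM; [exact: measurable_indic|exact: measurable_powR].
have aegv : {ae lam, forall s, gp s = vp s}.
  have [Z [mZ Z0 subZ]] := sgp_lebesgue_pts; exists Z; split=> // s /= gs; apply: subZ => /= ls; apply: gs.
  rewrite /vp; have [s0|s0] := ltP 0 s; last by rewrite gp0// indic_pos0// mul0r.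
  rewrite indic_pos1// mul1r /v; apply: (mulIf (lt0r_neq0 s0)).
  rewrite divfK ?gt_eqF// mulrC -[s * gp s]/(sgp s) /c0.
  have [sa|sa|<-] := ltgtP s a0; last by ring.
    by have := dbr _ _ s0 sa ls la0; lra.
  by have := dbr _ _ a00 sa la0 ls; lra.
have aeD (D' : set Rm) (f1 f2 : Rm -> \bar R) : (forall s, gp s = vp s -> f1 s = f2 s) -> ae_eq lam D' f1 f2.
  move=> f12; have [Z [mZ Z0 subZ]] := aegv; exists Z; split=> // s /= gs; apply: subZ => /= ls.
  by apply: gs => _; exact: f12.
have vpi x y : lam.-integrable `[x, y]%classic (EFin \o vp).
  apply: (ae_eq_integrable _ _ _ (gpi x y)).
  - exact: measurable_itv.
  - by apply/measurable_EFinP/measurable_funTS.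
  - by apply: aeD => s /= ->.
have vp0 s : s <= 0 -> vp s = 0 by move=> s0; rewrite /vp indic_pos0// mul0r.
have near_pos (s : R) : 0 < s -> \forall t \near s, 0 < t by move=> s0; exact: lt_nbhsr.
have vpE (s : R) : 0 < s -> vp s = v s by move=> s0; rewrite /vp indic_pos1// mul1r.
have cvp s : 0 < s -> {for s, continuous vp}.
  move=> s0; rewrite /prop_for /continuous_at vpE//.
  apply: cvg_trans (vcont s s0); apply: near_eq_cvg; near=> t.
  by rewrite vpE//; near: t; exact: near_pos.
(* I only depends on the almost everywhere class of g; with the continuous integrand the fundamental
   theorem applies. *)
have Ivp : I = running vp.
  apply/funext => x; rewrite /I /running /Rintegral; congr fine.
  apply: ae_eq_integral; first exact: measurable_itv.
  - by apply/measurable_EFinP/measurable_funTS.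
  - by apply/measurable_EFinP/measurable_funTS.
  - by apply: aeD => s /= ->.
pose Fv (s : R) := \1_pos s * curv q vp s.
have mFv : measurable_fun [set: Rm] (Fv : Rm -> Rm).
  by apply: measurable_funM; [exact: measurable_indic|exact: measurable_powR_curv].
have FvE s : gp s = vp s -> Fp s = Fv s.
  rewrite /Fp /Fv; have [s0|s0] := ltP 0 s; last by rewrite !indic_pos0// !mul0r.
  by move=> E; rewrite /curv -E /gp !indic_pos1// !mul1r.
have Fvi : lam.-integrable setT (EFin \o Fv).
  apply: (ae_eq_integrable mT _ _ (integrable_Fp prof)); first exact/measurable_EFinP.
  by apply: aeD => s /= /FvE ->.
have Fv0 s : s <= 0 -> Fv s = 0 by move=> s0; rewrite /Fv indic_pos0// mul0r.
have Fvii x y : lam.-integrable `[x, y]%classic (EFin \o Fv) by apply: integrableS Fvi.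
have FvE' (s : R) : 0 < s -> Fv s = curv q vp s by move=> s0; rewrite /Fv indic_pos1// mul1r.
have cFv s : 0 < s -> {for s, continuous Fv}.
  move=> s0; rewrite /prop_for /continuous_at FvE'//.
  have H : curv q vp t @[t --> s] --> curv q vp s.
    apply: cvgM.
      apply: cvgB; first exact: cvg_cst.
      exact: (is_derive_continuous (is_derive1_powR _ s0)).
    have h : 2 * vp t @[t --> s] --> 2 * vp s by apply: cvgM; [exact: cvg_cst|exact: cvp].
    exact: (cvg_comp _ _ h (@continuous_expR R _)).
  apply: cvg_trans H; apply: near_eq_cvg; near=> t.
  by rewrite FvE'//; near: t; exact: near_pos.
pose sF (s : R) := s * Fv s.
have sFi x y : lam.-integrable `[x, y]%classic (EFin \o sF).
  have mxy : measurable (`[x, y]%classic : set Rm) by exact: measurable_itv.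
  apply: (le_integrable mxy _ _ (integrableZl mxy (`|x| + `|y|) (Fvii x y))).
    by apply/measurable_EFinP/measurable_funTS; apply: measurable_funM.
  move=> s /=; rewrite in_itv/= => /andP[xs sy]; rewrite lee_fin !normrM; apply: ler_wpM2r => //.
  rewrite [leRHS]ger0_norm ?addr_ge0// ler_norml; apply/andP; split.
    by have := ler_norm (- x); have := normr_ge0 y; rewrite normrN; lra.
  by have := ler_norm y; have := normr_ge0 x; lra.
have csF s : 0 < s -> {for s, continuous sF}.
  by move=> s0; apply: cvgM; [exact: cvg_id|exact: cFv].
(* Splitting b - s under the integral gives N = b M - (integral of s F), from which N' = M because
   the two terms b F cancel. *)
have NE b : 0 < b -> N b = b * running Fv b - running sF b.
  move=> b0; rewrite /N /Npot /running.
  have mb : measurable (`[(-1)%R, b]%classic : set Rm) by exact: measurable_itv.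
  have ib := integrableZl mb b (Fvii (-1) b).
  rewrite -RintegralZl// -RintegralB//.
  rewrite [RHS]Rintegral_mkcond /Rintegral; congr fine.
  apply: ae_eq_integral => //.
  - apply/measurable_EFinP; apply: (measurable_funM (measurable_Fp prof)).
    exact: (continuous_measurable_fun (@continuous_tent R b)).
  - apply/measurable_EFinP/(measurable_restrictT _ mb)/measurable_funTS.
    by apply: measurable_funB; apply: measurable_funM.
  - apply: aeD => s /= /FvE ->; rewrite patchE; case: ifPn; rewrite ?inE ?notin_setE/= in_itv/=.
      by move=> /andP[_ sb]; rewrite /tent max_l ?subr_ge0// /sF; congr EFin; ring.
    move=> /negP; rewrite negb_and -!ltNge => /orP[s1|bs].
      by rewrite Fv0 ?mul0r//; lra.
    by rewrite /tent max_r ?mulr0// subr_le0 ltW.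
pose M := running Fv.
have dM (s : R) : 0 < s -> is_derive s 1 M (Fv s).
  by move=> s0; apply: (running_derive Fvii s0); exact: cFv.
have dN (s : R) : 0 < s -> is_derive s 1 N (M s).
  move=> s0; have h1 := dM s s0; have h2 := running_derive sFi s0 (csF s s0).
  apply: (@near_is_derive _ (fun b => b * M b - running sF b)).
    by near=> t; rewrite NE//; near: t; exact: near_pos.
  by apply: is_derive_eq; rewrite /GRing.scale/= mulr1 /sF; ring.
(* Differentiating s v = c0 + I - N / 4 gives v + s v' = v - M / 4. *)
have dv (s : R) : 0 < s -> is_derive s 1 v (- (M s / (4 * s))).
  move=> s0; have h1 := dN s s0.
  have h2 : is_derive s 1 I (vp s) by rewrite Ivp; apply: (running_derive vpi s0); exact: cvp.
  have h3 : is_derive s 1 (fun x : R => x^-1) (- s ^- 2 * 1).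
    by apply: (@is_deriveV R id s 1 1); rewrite ?gt_eqF.
  apply: is_derive_eq; rewrite /GRing.scale/= vpE// /v; field.
  by rewrite gt_eqF.
exists v, M; split; last first.
  have [Z [mZ Z0 subZ]] := aegv.
  have n1 : (@lebesgue2 R).-negligible ((@sqn R : _ -> Rm) @^-1` (Z `&` pos)).
    apply/negligibleP; first by apply: measurable_preimage_sqn; exact: measurableI.
    have E := @pushforward_sqn R (Z `&` pos) (measurableI _ _ mZ mpos) (@subIsetr _ _ _).
    apply: (eq_trans E); rewrite (_ : lam _ = 0%E) ?mule0//; apply/eqP; rewrite eq_le measure_ge0 andbT -Z0.
    by apply: le_measure; rewrite ?inE//; exact: measurableI.
  have n2 : (@lebesgue2 R).-negligible ((@sqn R : _ -> Rm) @^-1` (~` pos)).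
    apply/negligibleP; first by apply: measurable_preimage_sqn; exact: measurableC.
    exact: lebesgue2_origin.
  have n3 := profile_ae prof.
  apply: (negligibleS _ (negligibleU (negligibleU n1 n2) n3)) => z /= zv.
  have [uz|uz] := pselect (u z = g (sqn z)); last by right.
  have [z0|z0] := pselect (pos (sqn z)); last by left; right.
  left; left; split=> //; apply: subZ => /= gv; apply: zv.
  have s0 : 0 < sqn z by move: z0; rewrite /= in_itv/= andbT.
  by move: gv; rewrite /gp /vp indic_pos1// !mul1r uz.
split.
- exact: dv.
- by move=> s s0; have := dM s s0; rewrite FvE'// /curv vpE.
- have := continuous_running Fvii Fv0 (x := 0) => h.
  by apply: cvg_at_right_filter; rewrite -[X in _ --> X](running_le0 Fv0 (lexx 0)).
- have := running_cvgy Fvi Fv0; rewrite (_ : (\int[lam]_s Fv s)%R = Lambda / pi)//.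
  apply: EFin_inj; rewrite -(integral_Fp prof) /Rintegral fineK; last exact: integrable_fin_num.
  apply: ae_eq_integral => //; [exact/measurable_EFinP|exact/measurable_EFinP|].
  by apply: aeD => s /= /FvE ->.
Unshelve. all: by end_near. Qed.

End profile_ode.

(** * The C^1 representative and its blow-up *)

Section C1_functions.
Variable R : realType.
Implicit Types f : R * R -> R.

Lemma continuous_coord i : continuous (@coord R i).
Proof. by case: i => z; [exact: cvg_snd|exact: cvg_fst]. Qed.

Lemma coord_le_sqn i (z : R * R) : coord i z ^+ 2 <= sqn z.
Proof. by case: i; rewrite /coord /sqn ?lerDl ?lerDr sqr_ge0. Qed.

Lemma of_class_C1_slice f (g : bool -> R * R -> R) : continuous f ->
  (forall i, continuous (g i)) ->
  (forall i z, is_derive (coord i z) 1 (slice i f z) (g i z)) ->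
  of_class_C 1 f /\ forall i, partial i f = g i.
Proof.
move=> cf cg df; have pE i : partial i f = g i.
  by apply/funext => z; have [] := is_derive_slice (df i z).
split=> //; split=> // i; split; first by move=> z; have [] := is_derive_slice (df i z).
by rewrite pE; exact: cg.
Qed.

Lemma is_derive_slice_radial i (V : R -> R) (dV : R) (z : R * R) :
  is_derive (sqn z) 1 V dV -> is_derive (coord i z) 1 (slice i (fun w => V (sqn w)) z) (2 * coord i z * dV).
Proof.
move=> hV; have h c (x : R) : x ^+ 2 + c = sqn z ->
    is_derive x 1 (fun t => V (t ^+ 2 + c)) (2 * x * dV).
  move=> E; have h : is_derive x 1 (fun t => t ^+ 2 + c) (2 * x).
    by apply: is_derive_eq; rewrite /GRing.scale/=; ring.
  have hV' : is_derive (x ^+ 2 + c) 1 V dV by rewrite E.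
  by have := @is_derive1_comp R V _ x _ _ hV' h; rewrite mulrC.
case: i; rewrite /slice /coord /sqn /=.
  rewrite (_ : (fun t => _) = (fun t => V (t ^+ 2 + z.1 ^+ 2))); last first.
    by apply/funext => t; rewrite addrC.
  by apply: h; rewrite addrC.
exact: h.
Qed.

(** On an axis s = t^2, so a Lipschitz bound in s is quadratic in t: the partial derivatives vanish
    although V need not be differentiable at 0. *)
Lemma is_derive_slice_origin i (V : R -> R) (C : R) (z : R * R) : sqn z = 0 ->
  (forall s, 0 <= s <= 1 -> `|V s - V 0| <= C * s) ->
  is_derive (coord i z) 1 (slice i (fun w => V (sqn w)) z) 0.
Proof.
move=> z0 HC.
have /andP[/eqP z1 /eqP z2] : (z.1 == 0) && (z.2 == 0).
  by move: z0 => /eqP; rewrite /sqn paddr_eq0 ?sqr_ge0// !sqrf_eq0.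
have -> : slice i (fun w => V (sqn w)) z = (fun t => V (t ^+ 2)).
  by apply/funext => t; rewrite /slice /sqn; case: i => /=; rewrite ?z1 ?z2 expr0n/= ?add0r ?addr0.
have -> : coord i z = 0 by case: i; rewrite /coord.
have C0 : 0 <= C by have := HC 1; rewrite mulr1 ler01 lexx => /(_ isT); exact: le_trans.
have d0 : h^-1 *: (V ((h *: (1 : R) + 0) ^+ 2) - V (0 ^+ 2)) @[h --> 0^'] --> (0 : R).
  apply/cvgrPdist_le => e e0; near=> h.
  rewrite sub0r normrN /GRing.scale/= mulr1 addr0 expr0n/=.
  have h0 : h != 0 by near: h; exact: nbhs_dnbhs_neq.
  have h1 : `|h| <= 1 by near: h; exact: dnbhs0_le.
  have hh : `|h| ^+ 2 = h ^+ 2 by rewrite real_normK ?num_real.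
  rewrite normrM normfV ler_pdivrMl ?normr_gt0//.
  apply: (le_trans (HC _ _)); first by rewrite sqr_ge0 -hh expr_le1.
  rewrite -hh expr2 mulrA mulrC ler_pM2l ?normr_gt0//.
  apply: (@le_trans _ _ ((C + 1) * `|h|)); first by rewrite ler_wpM2r// lerDl.
  rewrite -ler_pdivlMl ?ltr_wpDl//.
  by near: h; apply: dnbhs0_le; rewrite mulr_gt0// invr_gt0 ltr_wpDl.
by split; [apply/cvg_ex; exists 0|apply/cvg_lim].
Unshelve. all: by end_near. Qed.

Lemma of_class_C1_rescale f (c d : R) : of_class_C 1 f ->
  of_class_C 1 (fun x => f (c *: x) + d) /\
  forall i, partial i (fun x => f (c *: x) + d) = (fun x => c * partial i f (c *: x)).
Proof.
move=> [cf df].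
have cs : continuous (fun x : R * R => c *: x) by exact: scaler_continuous.
apply: of_class_C1_slice.
- move=> x; apply: cvgD; last exact: cvg_cst.
  by apply: (@continuous_comp _ _ _ (fun x : R * R => c *: x) f); [exact: cs|exact: cf].
- move=> i x; apply: cvgM; first exact: cvg_cst.
  have [_ cp] := df i.
  by apply: (@continuous_comp _ _ _ (fun x : R * R => c *: x) (partial i f)); [exact: cs|exact: cp].
move=> i z; have [dp _] := df i.
have h1 : is_derive (c * coord i z) 1 (slice i f (c *: z)) (partial i f (c *: z)).
  have := dp (c *: z); rewrite /partial /derivable /derive.
  set v : R * R := if i then _ else _ => h.
  have E : (fun h : R => h^-1 *: (f (h *: v + c *: z) - f (c *: z))) =
     (fun h : R => h^-1 *: (slice i f (c *: z) (h *: (1 : R) + c * coord i z) - slice i f (c *: z) (c * coord i z))).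
    apply/funext => t; rewrite /slice /coord /v; case: i {dp h} v => v; congr (_ *: (f _ - f _)).
    - by apply: injective_projections => //=; rewrite -[LHS]/(t * 0 + c * z.1) mulr0 add0r.
    - by apply: injective_projections => //=; rewrite -[LHS]/(t * 0 + c * z.2) mulr0 add0r.
  by rewrite E in h *; split.
have h2 : is_derive (coord i z) 1 (fun t : R => c * t) c.
  by apply: is_derive_eq; rewrite /GRing.scale/= mulr1.
have h3 := @is_derive1_comp R (slice i f (c *: z)) _ (coord i z) _ _ h1 h2.
have E : slice i (fun x => f (c *: x) + d) z = (fun t => slice i f (c *: z) (c * t) + d).
  by apply/funext => t; rewrite /slice; case: i {dp h1 h2 h3}.
rewrite E; have h4 := is_deriveD h3 (is_derive_cst d (coord i z) 1).
by move: h4; rewrite addr0 mulrC.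
Qed.

Lemma family_compact_cvg (F : nat -> R * R -> R) f :
  (forall S e, 0 <= S -> 0 < e -> \forall n \near \oo, forall z, sqn z <= S -> `|f z - F n z| <= e) ->
  {family compact, F @ \oo --> f}.
Proof.
move=> H; apply/fam_cvgP => K cK P /uniform_nbhs[E [entE EP]].
have [S S0 KS] : exists2 S, 0 <= S & forall z, K z -> sqn z <= S.
  have /compact_bounded[M [_ HM]] : compact (@sqn R @` K).
    by apply: continuous_compact => //; apply: continuous_subspaceT; exact: continuous_sqn.
  exists (Num.max 0 (M + 1)); first by rewrite le_max lexx.
  move=> z Kz; rewrite le_max; apply/orP; right.
  apply: le_trans (ler_norm _) _; apply: HM; first by rewrite ltrDl.
  by exists z.
move: entE; rewrite -entourage_ballE => -[e /= e0 He].
have := H S (e / 2) S0 ltac:(by rewrite divr_gt0).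
apply: filterS => n Hn; apply: EP => z Kz /=; apply: He => /=.
rewrite /ball/=; apply: (le_lt_trans (Hn z (KS z Kz))).
by rewrite ltr_pdivrMr// ltr_pMr// ltr1n.
Qed.

End C1_functions.

Section radial_representative.
Variables (R : realType) (q : R).
Hypothesis q01 : 0 < q < 1.
Variables (m : R) (v M : R -> R) (ode : radial_ode q m v M).
Variables (v0 : R) (vv0 : v s @[s --> 0^'+] --> v0) (v_le : forall s, 0 < s <= 1 -> v s <= v0).

Definition radial_ext (s : R) : R := if 0 < s then v s else v0.
(** The value 0 at the origin is a convenience: in the gradient this function is multiplied by a
    coordinate, which vanishes there. *)
Definition radial_dext (s : R) : R := if 0 < s then - (M s / (4 * s)) else 0.

Let C : R := expR (2 * v0) / 4.

Lemma radial_dext_bound s : s <= 1 -> `|radial_dext s| <= C.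
Proof.
move=> s1; rewrite /radial_dext; case: ifPn => s0; last by rewrite normr0 divr_ge0 ?expR_ge0.
have s01 : 0 < s <= 1 by rewrite s0.
rewrite normrN ger0_norm; last first.
  by rewrite divr_ge0 ?mulr_ge0 ?(ltW s0)// (M_ge0 q01 ode).
rewrite ler_pdivrMr ?mulr_gt0// /C mulrA divfK//.
exact: (M_le ode v_le s01).
Qed.

Lemma radial_ext_lip s : 0 <= s <= 1 -> `|radial_ext s - radial_ext 0| <= C * s.
Proof.
move=> /andP[s0 s1]; rewrite /radial_ext ltxx; case: ifPn => [s0'|]; last first.
  by rewrite -leNgt subrr normr0 => _; rewrite mulr_ge0// divr_ge0 ?expR_ge0.
have s01 : 0 < s <= 1 by rewrite s0'.
rewrite ler0_norm ?subr_le0 ?v_le// opprB lerBlDl.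
move: s s01 {s0 s1 s0'}.
apply: (@le_right_limit R (fun s => v s + C * s) (fun s => - (M s / (4 * s)) + C)).
- move=> x /andP[x0 _]; have h := ode_v ode x0.
  by apply: is_derive_eq; rewrite /GRing.scale/= mulr1.
- move=> x /andP[x0 x1]; have := radial_dext_bound (ltW x1).
  by rewrite /radial_dext x0 => /ler_normlP[]; lra.
- rewrite -[X in _ --> X]addr0; apply: cvgD => //.
  by rewrite -[X in _ --> X](mulr0 C); apply: cvgM; [exact: cvg_cst|exact: id_right0].
Qed.

Lemma radial_ext_derive (s : R) : 0 < s -> is_derive s 1 radial_ext (radial_dext s).
Proof.
move=> s0; have h := ode_v ode s0; rewrite /radial_dext s0; apply: (near_is_derive _ h).
by near=> t; rewrite /radial_ext (_ : 0 < t)//; near: t; exact: lt_nbhsr.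
Unshelve. all: by end_near. Qed.

Lemma radial_dext_continuous (s : R) : 0 < s -> {for s, continuous radial_dext}.
Proof.
move=> s0; have H : - (M t / (4 * t)) @[t --> s] --> radial_dext s.
  rewrite /radial_dext s0; apply: cvgN; apply: cvgM.
    exact: (is_derive_continuous (ode_M ode s0)).
  apply: cvgV; first by rewrite mulf_neq0// gt_eqF.
  by apply: cvgM; [exact: cvg_cst|exact: cvg_id].
apply: cvg_trans H; apply: near_eq_cvg; near=> t.
by rewrite /radial_dext (_ : 0 < t)//; near: t; exact: lt_nbhsr.
Unshelve. all: by end_near. Qed.

Definition radial_rep (z : R * R) : R := radial_ext (sqn z).

Lemma sqn_small_continuous (z : R * R) (h : R * R -> R) (K : R) : sqn z = 0 -> 0 <= K -> h z = 0 ->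
  (forall w, sqn w <= 1 -> `|h w| <= K * Num.sqrt (sqn w)) -> {for z, continuous h}.
Proof.
move=> z0 K0 hz hK; rewrite /prop_for /continuous_at hz.
have cs : Num.sqrt (sqn w) @[w --> z] --> 0.
  rewrite -[X in _ --> X](@sqrtr0 R) -z0.
  by apply: (@continuous_comp _ _ _ (@sqn R) Num.sqrt); [exact: continuous_sqn|exact: sqrt_continuous].
apply/cvgrPdist_le => e e0; near=> w; rewrite sub0r normrN.
have w1 : Num.sqrt (sqn w) <= 1.
  by near: w; apply: (@cvgr_le _ _ _ _ _ _ cs); exact: ltr01.
have w2 : sqn w <= 1 by rewrite -[leLHS]sqr_sqrtr ?sqn_ge0// expr_le1// sqrtr_ge0.
apply: (le_trans (hK w w2)); apply: (@le_trans _ _ ((K + 1) * Num.sqrt (sqn w))).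
  by rewrite ler_wpM2r ?sqrtr_ge0// lerDl.
rewrite -ler_pdivlMl ?ltr_wpDl//.
by near: w; apply: (@cvgr_le _ _ _ _ _ _ cs); rewrite mulr_gt0// invr_gt0 ltr_wpDl.
Unshelve. all: by end_near. Qed.

Lemma sqn_gt0_or (z : R * R) : sqn z = 0 \/ 0 < sqn z.
Proof. by have := sqn_ge0 z; rewrite le_eqVlt => /predU1P[<-|]; [left|right]. Qed.

Lemma radial_rep_C1 : of_class_C 1 radial_rep /\ forall i, partial i radial_rep = (fun z => 2 * coord i z * radial_dext (sqn z)).
Proof.
have C0 : 0 <= C by rewrite divr_ge0 ?expR_ge0.
apply: of_class_C1_slice.
- move=> z; have [z0|z0] := sqn_gt0_or z; last first.
    apply: (@continuous_comp _ _ _ (@sqn R) radial_ext); first exact: continuous_sqn.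
    exact: (is_derive_continuous (radial_ext_derive z0)).
  have H : {for z, continuous (fun w => radial_rep w - v0)}.
    apply: (@sqn_small_continuous _ _ C z0 C0); first by rewrite /radial_rep /radial_ext z0 ltxx subrr.
    move=> w w1; have := @radial_ext_lip (sqn w); rewrite sqn_ge0 w1 {2}/radial_ext ltxx => /(_ isT) /le_trans; apply.
    rewrite ler_wpM2l// -[leLHS]sqr_sqrtr ?sqn_ge0// expr2 ler_piMl ?sqrtr_ge0//.
    by rewrite -[leRHS]sqrtr1 ler_wsqrtr.
  have -> : radial_rep = (fun w => (radial_rep w - v0) + v0) by apply/funext => w; rewrite subrK.
  by apply: cvgD; [exact: H|exact: cvg_cst].
- move=> i z; have [z0|z0] := sqn_gt0_or z; last first.
    apply: cvgM; first by apply: cvgM; [exact: cvg_cst|exact: continuous_coord].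
    by apply: (@continuous_comp _ _ _ (@sqn R) radial_dext); [exact: continuous_sqn|exact: radial_dext_continuous].
  have C20 : 0 <= 2 * C by rewrite mulr_ge0.
  apply: (@sqn_small_continuous _ _ (2 * C) z0 C20); first by rewrite /radial_dext z0 ltxx mulr0.
  move=> w w1; rewrite !normrM [`|2|]ger0_norm// -mulrA -[leRHS]mulrA ler_pM2l// mulrC.
  apply: ler_pM => //; first exact: radial_dext_bound.
  by rewrite -sqrtr_sqr ler_wsqrtr// coord_le_sqn.
- move=> i z; have [z0|z0] := sqn_gt0_or z; last first.
    exact/is_derive_slice_radial/radial_ext_derive.
  by rewrite z0 /radial_dext ltxx mulr0; apply: (@is_derive_slice_origin R i radial_ext C) => //; exact: radial_ext_lip.
Qed.

End radial_representative.

(** * Estimates for a single solution *)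

Section single_solution.
Variables (R : realType) (q : R).
Hypothesis q01 : 0 < q < 1.
Variables (m : R) (v M : R -> R) (ode : radial_ode q m v M).
Variables (v0 : R) (vv0 : v s @[s --> 0^'+] --> v0) (v_le : forall s, 0 < s <= 1 -> v s <= v0).

Lemma pohozaev_ge0 s : 0 < s -> 0 <= pohozaev q v M s.
Proof.
move=> s0; have [s1|s1] := leP s 1.
  by have /andP[] := pohozaev_bounds q01 ode vv0 v_le (s := s) ltac:(by rewrite s0).
have /andP[h _] := pohozaev_bounds q01 ode vv0 v_le (s := 1) ltac:(by rewrite ltr01 lexx).
exact: (le_trans h (pohozaev_ndecr q01 ode ltr01 (ltW s1))).
Qed.

(** The disc |x|^2 <= d carries at least m minus the tail bound, and at most e^{2 v0} d because v <=
    v0. A small deficit m (4 - m) therefore makes v0 large. *)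
Lemma mass_le_height d : 0 < d <= 1 ->
  m - d `^ (- q) / (4 * q) * (m * (4 - m)) <= expR (2 * v0) * d.
Proof.
move=> d01; have /andP[d0 d1] := d01; have /andP[q0 _] := q01.
have h1 := mass_tail q01 ode d0; have h2 := M_le ode v_le d01; have h3 := pohozaev_ge0 d0.
have h4 : 0 <= d `^ (- q) / (4 * q) * pohozaev q v M d.
  by rewrite !mulr_ge0 ?powR_ge0// invr_ge0 mulr_ge0// ltW.
rewrite mulrBr in h1; lra.
Qed.

(** The integrand is the derivative of the Pohozaev quantity over 4 q, which grows from 0 to a limit
    at most m (4 - m) / (4 q). *)
Lemma weighted_mass : exists2 l : R, l <= m * (4 - m) / (4 * q) &
  (\int[@lebesgue_measure R]_(s in `]0%R, +oo[) (s `^ q * expR (2 * v s))%:E = l%:E)%E.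
Proof.
have /andP[q0 q1] := q01.
have q40 : 4 * q != 0 by rewrite mulf_neq0// gt_eqF.
have q4 : 0 < 4 * q by rewrite mulr_gt0.
(* W and F are extended so that W is continuous up to 0 and F is nondecreasing on the whole line,
   which gives F a limit at infinity. *)
pose W s := s `^ q * expR (2 * radial_ext v v0 s).
pose F (s : R) : R := if 0 < s then pohozaev q v M s / (4 * q) else 0.
have WE s : 0 < s -> W s = s `^ q * expR (2 * v s) by rewrite /W /radial_ext => ->.
have dv s : 0 < s -> {for s, continuous v} by move=> s0; exact: is_derive_continuous (ode_v ode s0).
have Wc s : 0 < s -> {for s, continuous (fun s => s `^ q * expR (2 * v s))}.
  move=> s0; apply: cvgM; first exact: (is_derive_continuous (powq_derive q s0)).
  apply: continuous_comp; last exact: continuous_expR.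
  by apply: cvgM; [exact: cvg_cst|exact: dv].
have nearpos (s : R) : 0 < s -> \forall t \near s, 0 < t by exact: lt_nbhsr.
have Wcont : {within `[0, +oo[, continuous W}.
  apply/continuous_within_itvcyP; split.
    move=> s; rewrite in_itv/= andbT => s0.
    have := Wc s s0; rewrite /prop_for /continuous_at -WE//; apply: cvg_trans.
    by apply: near_eq_cvg; near=> t; rewrite WE//; near: t; exact: nearpos.
  have -> : W 0 = 0 * expR (2 * v0) by rewrite /W powR0 ?gt_eqF// !mul0r.
  have H : s `^ q * expR (2 * v s) @[s --> 0^'+] --> 0 * expR (2 * v0).
    apply: cvgM; first exact: powq_right0 q01.
    have h : 2 * v s @[s --> 0^'+] --> 2 * v0 by apply: cvgM; [exact: cvg_cst|exact: vv0].
    exact: (cvg_comp _ _ h (@continuous_expR R _)).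
  by apply: cvg_trans H; apply: near_eq_cvg; near=> t; rewrite WE.
have F0 s : 0 <= F s.
  by rewrite /F; case: ifPn => // s0; rewrite divr_ge0 ?pohozaev_ge0// ltW.
have Fb s : F s <= m * (4 - m) / (4 * q).
  have H t : 0 < t -> F t <= m * (4 - m) / (4 * q).
    by move=> t0; rewrite /F t0 ler_pM2r ?invr_gt0// (pohozaev_le q01 ode).
  case: (ltP 0 s) => [/H//|s0]; apply: le_trans (H 1 ltr01).
  by rewrite {1}/F ltNge s0 F0.
have Fnd : {homo F : s t / s <= t}.
  move=> s t st; rewrite {1}/F; case: ifPn => // s0.
  rewrite /F (lt_le_trans s0 st) ler_pM2r ?invr_gt0//.
  exact: (pohozaev_ndecr q01 ode).
have Fub : has_ubound (range F) by exists (m * (4 - m) / (4 * q)) => _ [s _ <-].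
have Fl := nondecreasing_cvgr Fnd Fub.
have Fd (s : R) : 0 < s -> is_derive s 1 F (W s).
  move=> s0; have h := pohozaev_derive ode s0.
  have h2 : is_derive s 1 (fun t => (4 * q)^-1 * pohozaev q v M t) (W s).
    apply: is_derive_eq; rewrite /GRing.scale/= WE//.
    exact: mulKf.
  have hn : \forall t \near s, (4 * q)^-1 * pohozaev q v M t = F t.
    near=> t; have t0 : 0 < t by near: t; exact: nearpos.
    by rewrite /F t0; exact: mulrC.
  exact: near_is_derive hn h2.
exists (sup (range F)); first by apply: ge_sup => [|_ [s _ <-]//]; exists (F 0); exists 0.
have -> : (\int[@lebesgue_measure R]_(s in `]0%R, +oo[) (s `^ q * expR (2 * v s))%:E =
   \int[@lebesgue_measure R]_(s in `]0%R, +oo[) (W s)%:E)%E.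
  by apply: eq_integral => s; rewrite inE/= in_itv/= andbT => s0; rewrite WE.
rewrite integral_itv_obnd_cbnd; last first.
  apply/measurable_EFinP; apply: open_continuous_measurable_fun; first exact: interval_open.
  move=> s; rewrite inE => /= ; have [h _] := (continuous_within_itvcyP _ _).1 Wcont; exact: h.
rewrite (@ge0_continuous_FTC2y _ W F 0 (sup (range F)))//.
- by rewrite /F ltxx sube0.
- by move=> s s0; rewrite mulr_ge0 ?powR_ge0 ?expR_ge0.
- by move=> s s0; have [] := Fd s s0.
- have -> : F 0 = 0 / (4 * q) by rewrite /F ltxx mul0r.
  have H : pohozaev q v M s / (4 * q) @[s --> 0^'+] --> 0 / (4 * q).
    by apply: cvgM; [exact: (pohozaev_right0 q01 ode vv0)|exact: cvg_cst].
  by apply: cvg_trans H; apply: near_eq_cvg; near=> t; rewrite /F (_ : 0 < t).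
- by move=> s; rewrite in_itv/= andbT => s0; rewrite derive1E; have [_ ->] := Fd s s0.
Unshelve. all: by end_near. Qed.

Let w := radial_rep v v0.

Lemma rep0 : w 0 = v0.
Proof. by rewrite /w /radial_rep /radial_ext /sqn /= expr0n/= addr0 ltxx. Qed.

Lemma sqnZ (c : R) (z : R * R) : sqn (c *: z) = c ^+ 2 * sqn z.
Proof. by rewrite /sqn -[(c *: z).1]/(c * z.1) -[(c *: z).2]/(c * z.2); ring. Qed.

Lemma coordZ i (c : R) (z : R * R) : coord i (c *: z) = c * coord i z.
Proof. by case: i. Qed.

Lemma blowup_scale2 : blowup_scale w ^+ 2 = 4 * expR (- (2 * v0)).
Proof. by rewrite /blowup_scale rep0 exprMn -expRM_natl; congr (_ * expR _); ring. Qed.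

Lemma blowupE z : blowup w z = radial_ext v v0 (4 * expR (- (2 * v0)) * sqn z) - v0 + ln 2.
Proof. by rewrite /blowup rep0 {1}/w /radial_rep sqnZ blowup_scale2. Qed.

Lemma partial_blowup : of_class_C 1 (blowup w) /\ forall i, partial i (blowup w) =
  (fun z => 8 * expR (- (2 * v0)) * coord i z * radial_dext M (4 * expR (- (2 * v0)) * sqn z)).
Proof.
have [c1 dE] := radial_rep_C1 q01 ode vv0 v_le.
have [h1 h2] := of_class_C1_rescale (blowup_scale w) (- w 0 + ln 2) c1.
have E : blowup w = (fun x => radial_rep v v0 (blowup_scale w *: x) + (- w 0 + ln 2)).
  by apply/funext => x; rewrite /blowup addrA.
rewrite E; split=> // i; rewrite h2; apply/funext => z; rewrite dE sqnZ coordZ blowup_scale2.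
transitivity (2 * blowup_scale w ^+ 2 * coord i z * radial_dext M (4 * expR (- (2 * v0)) * sqn z)); first by ring.
by rewrite blowup_scale2; ring.
Qed.

(* With [Y = e^{-blowup}], the blow-up argument compares [Y] with its limit [(1 + s) / 2]. *)
Lemma blowup_close (S : R) : 0 <= S -> let b := 4 * S * expR (- (2 * v0)) in
  let d := (1 + S) ^+ 2 * b `^ q / 2 in b <= 1 -> d <= 1 / 4 ->
  forall z, sqn z <= S ->
    `|ln (2 / (1 + sqn z)) - blowup w z| <= 4 * d /\
    forall i, `|- (2 * coord i z / (1 + sqn z)) - partial i (blowup w) z| <= 8 * (1 + S) * d.
Proof.
move=> S0 b d b1 d1 z zS; have /andP[q0 q1] := q01.
have b0 : 0 <= b by rewrite !mulr_ge0 ?expR_ge0.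
have d0 : 0 <= d by rewrite divr_ge0// mulr_ge0 ?sqr_ge0 ?powR_ge0.
have Sd0 : 0 <= 8 * (1 + S) * d by apply: mulr_ge0 => //; apply: mulr_ge0 => //; exact: addr_ge0.
set s := sqn z in zS *.
have [s0|s0] := sqn_gt0_or z; rewrite -/s in s0.
  have z0 i : coord i z = 0.
    by apply/eqP; rewrite -sqrf_eq0 eq_le sqr_ge0 andbT -s0 coord_le_sqn.
  split; last by move=> i; rewrite partial_blowup.2 z0 !(mulr0, mul0r, oppr0, addr0, normr0).
  by rewrite blowupE -/s s0 mulr0 /radial_ext ltxx subrr add0r addr0 divr1 subrr normr0 mulr_ge0.
set t := 4 * expR (- (2 * v0)) * s.
have tb : t <= b by rewrite /t /b mulrAC ler_wpM2r ?expR_ge0// ler_wpM2l.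
have t0 : 0 < t by rewrite !mulr_gt0 ?expR_gt0.
have t01 : 0 < t <= 1 by rewrite t0 (le_trans tb).
have tq : t `^ q <= b `^ q by rewrite ge0_ler_powR ?nnegrE// ltW.
have bq0 := powR_ge0 b q.
have h1 := yv_le q01 ode vv0 v_le t01.
have h2 := yv_ge q01 ode vv0 v_le S0 (le_trans tb b1) tb t0.
have h3 := slope_le q01 ode vv0 v_le t01.
have tb' : 0 < t <= b by rewrite t0.
have h4 := slope_ge q01 ode vv0 v_le S0 b1 (lexx b) tb'.
set e := expR v0 in h1 h2 h3 h4.
have e0 : 0 < e by exact: expR_gt0.
have eV : expR (- v0) = e^-1 by rewrite expRN.
have e2V : expR (- (2 * v0)) = e^-1 ^+ 2 by rewrite -eV -expRM_natl; congr expR; ring.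
(* Y is the exponential of minus the blow-up at z, and P its derivative in the rescaled variable s.
   Their limits are (1 + s) / 2 and 1 / 2; d bounds both errors. *)
pose Y := e * yv v t / 2; pose P := 2 * slope v M t / e.
have tE : t = 4 * e^-1 ^+ 2 * s by rewrite /t e2V.
have Y1 : Y <= (1 + s) / 2.
  rewrite /Y ler_pM2r// -ler_pdivlMl//; apply: le_trans h1 _.
  by rewrite eV tE le_eqVlt; apply/orP; left; apply/eqP; field; rewrite gt_eqF.
have d2 : 2 * d = (1 + S) ^+ 2 * b `^ q by rewrite /d; field.
have key : (1 + S) * t `^ q * s <= 2 * d.
  rewrite d2 expr2 -!mulrA ler_wpM2l ?addr_ge0// mulrC.
  by apply: ler_pM => //; [exact: ltW|exact: powR_ge0|lra].
have Y2 : (1 + s) / 2 - d <= Y.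
  have : e * (expR (- v0) + e / 4 * t - e / 4 * (1 + S) * t `^ q * t) / 2 <= Y.
    by rewrite ler_pM2r// ler_pM2l.
  have -> : e * (expR (- v0) + e / 4 * t - e / 4 * (1 + S) * t `^ q * t) / 2 =
      (1 + s) / 2 - (1 + S) * t `^ q * s / 2.
    by rewrite eV; move: (t `^ q) => X; rewrite tE; field; rewrite gt_eqF.
  move: key; lra.
have P1 : P <= 1 / 2.
  by rewrite /P ler_pdivrMr//; lra.
have key2 : (1 + S) * t `^ q <= 2 * d.
  rewrite d2; apply: ler_pM => //; [by rewrite addr_ge0|exact: powR_ge0|].
  by rewrite expr2 ler_peMl ?addr_ge0// lerDl.
have P2 : 1 / 2 - d <= P.
  rewrite /P ler_pdivlMr//.
  have : e * ((1 + S) * t `^ q) <= e * (2 * d) by rewrite ler_pM2l.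
  lra.
(* The assumption d <= 1/4 serves here: it keeps Y away from 0, so errors on Y pass to logarithms
   and quotients with a factor 4. *)
have Y0 : 1 / 4 <= Y by lra.
split.
  rewrite blowupE -/s -/t /radial_ext t0.
  have EB : expR (- (v t - v0 + ln 2)) = Y.
    have -> : - (v t - v0 + ln 2) = v0 + - v t + - ln 2 by ring.
    by rewrite !expRD [expR (- ln 2)]expRN lnK ?posrE.
  have EL : expR (- ln (2 / (1 + s))) = (1 + s) / 2.
    by rewrite expRN lnK ?invf_div// posrE divr_gt0// addr_gt0.
  set a := v t - v0 + ln 2 in EB *; set l := ln _ in EL *.
  have al : l <= a by rewrite -lerN2 -ler_expR EB EL.
  rewrite ler0_norm ?subr_le0// opprB.
  (* From 1 + x <= e^x one gets (a - l) Y <= (1 + s) / 2 - Y <= d. *)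
  have E1 : 1 + (a - l) <= expR (a - l) by exact: expR_ge1Dx.
  have E2 : expR (a - l) * Y = (1 + s) / 2.
    by rewrite -EB -EL -expRD; congr expR; ring.
  have E3 : (1 + (a - l)) * Y <= (1 + s) / 2 by rewrite -E2 ler_wpM2r//; lra.
  have E4 : (a - l) * (1 / 4) <= (a - l) * Y by rewrite ler_wpM2l// subr_ge0.
  rewrite mulrDl mul1r in E3; lra.
move=> i; rewrite partial_blowup.2 -/s -/t /radial_dext t0.
have Y00 : 0 < Y by lra.
have E : 8 * expR (- (2 * v0)) * coord i z * - (M t / (4 * t)) = - (2 * coord i z) * (P / Y).
  have yv0 : yv v t != 0 by rewrite /yv gt_eqF ?expR_gt0.
  rewrite /P /Y /slope e2V; field.
  by rewrite yv0 !gt_eqF.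
rewrite E.
have c1 : `|coord i z| <= 1 + S.
  have := coord_le_sqn i z; rewrite -/s => h.
  rewrite -(@ler_pXn2r _ 2) ?nnegrE ?addr_ge0// real_normK ?num_real// (le_trans h)// (le_trans zS)//.
  by rewrite expr2; nra.
have -> : - (2 * coord i z / (1 + s)) - - (2 * coord i z) * (P / Y) =
   2 * coord i z * (P / Y - (1 + s)^-1) by ring.
rewrite !normrM [`|2|]ger0_norm//.
have D : `|P / Y - (1 + s)^-1| <= 4 * d.
  have s1 : 0 < 1 + s by lra.
  (* The numerator lies between - d (1 + s) and d, and the denominator is at least (1 + s) / 4. *)
  have EE : P / Y - (1 + s)^-1 = (P * (1 + s) - Y) / (Y * (1 + s)).
    by field; rewrite !gt_eqF.
  have U0 : 0 < Y * (1 + s) by rewrite mulr_gt0.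
  have U1 : 1 + s <= 4 * (Y * (1 + s)) by nra.
  have U2 : d * (1 + s) <= d * (4 * (Y * (1 + s))) by rewrite ler_wpM2l.
  have U3 : P * (1 + s) <= 1 / 2 * (1 + s) by rewrite ler_wpM2r// ltW.
  have U4 : (1 / 2 - d) * (1 + s) <= P * (1 + s) by rewrite ler_wpM2r// ltW.
  have U5 : d <= d * (1 + s) by rewrite ler_peMr//; lra.
  rewrite EE; apply/ler_normlP; split.
    by rewrite -mulNr ler_pdivrMr//; lra.
  by rewrite ler_pdivrMr//; lra.
have := ler_pM (normr_ge0 _) (normr_ge0 _) c1 D; lra.
Qed.

End single_solution.

(** * Convergence *)

Section sequences_of_profiles.
Variables (R : realType) (q : R).
Hypothesis q01 : 0 < q < 1.
Variables (m : nat -> R) (v M : nat -> R -> R) (v0 : nat -> R).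
Hypothesis ode : forall k, radial_ode q (m k) (v k) (M k).
Hypothesis vv0 : forall k, v k s @[s --> 0^'+] --> v0 k.
Hypothesis v_le : forall k s, 0 < s <= 1 -> v k s <= v0 k.
Hypothesis m4 : m k @[k --> \oo] --> (4 : R).

Lemma deficit_cvg0 (c : R) : c * (m k * (4 - m k)) @[k --> \oo] --> 0.
Proof.
have -> : (0 : R) = c * (4 * (4 - 4)) by rewrite subrr !mulr0.
apply: cvgM; first exact: cvg_cst.
by apply: cvgM => //; apply: cvgB => //; exact: cvg_cst.
Qed.

(** For fixed d the left side of [mass_le_height] tends to 4, so it is eventually at least 1, which
    leaves e^{-2 v0} <= d. *)
Lemma height_cvg (e : R) : 0 < e -> \forall k \near \oo, expR (- (2 * v0 k)) <= e.
Proof.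
move=> e0; pose d := Num.min 1 e.
have d0 : 0 < d by rewrite lt_min ltr01.
have d1 : d <= 1 by rewrite ge_min lexx.
have H : m k - d `^ (- q) / (4 * q) * (m k * (4 - m k)) @[k --> \oo] --> (4 - 0 : R).
  by apply: cvgB => //; exact: deficit_cvg0.
have H1 : \forall k \near \oo, 1 <= m k - d `^ (- q) / (4 * q) * (m k * (4 - m k)).
  by apply: (@cvgr_ge _ _ _ _ _ _ H); rewrite subr0 ltr1n.
apply: filterS H1 => k Hk.
have d01 : 0 < d <= 1 by rewrite d0.
have h := le_trans Hk (mass_le_height q01 (ode k) (@vv0 k) (@v_le k) d01).
rewrite expRN -[leLHS]mul1r ler_pdivrMr ?expR_gt0//; apply: (le_trans h).
by rewrite mulrC ler_wpM2r ?expR_ge0// ge_min lexx orbT.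
Qed.

Lemma blowup_cvg : C1_loc_cvg (fun k => blowup (radial_rep (v k) (v0 k))) (fun x => ln (2 / (1 + enorm x ^+ 2))).
Proof.
have /andP[q0 q1] := q01.
have close (S e : R) : 0 <= S -> 0 < e -> \forall k \near \oo, forall z, sqn z <= S ->
    `|ln (2 / (1 + sqn z)) - blowup (radial_rep (v k) (v0 k)) z| <= e /\
    forall i, `|- (2 * coord i z / (1 + sqn z)) - partial i (blowup (radial_rep (v k) (v0 k))) z| <= e.
  move=> S0 e0; have S1 : 0 < 1 + S by lra.
  (* The target for the error d of [blowup_close]: 1/4 meets its hypothesis, the other entry makes
     its conclusion at most e. *)
  pose h := Num.min (1 / 4) (e / (8 * (1 + S))).
  have h0 : 0 < h by rewrite lt_min !divr_gt0// mulr_gt0.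
  have h1 : h <= 1 / 4 by rewrite ge_min lexx.
  have h2 : 8 * (1 + S) * h <= e.
    by rewrite mulrC -ler_pdivlMr ?mulr_gt0// ge_min lexx orbT.
  (* The value of b^q for which the error of [blowup_close] equals h. *)
  pose eta := 2 * h / (1 + S) ^+ 2.
  have eta0 : 0 < eta by rewrite !divr_gt0 ?mulr_gt0 ?exprn_gt0.
  pose c := Num.min 1 (eta `^ q^-1).
  have c0 : 0 < c by rewrite lt_min ltr01 powR_gt0.
  have c1 : c <= 1 by rewrite ge_min lexx.
  (* 4 S + 1 instead of 4 S, since S may be 0. *)
  have S4 : 0 < 4 * S + 1 by lra.
  have := height_cvg (divr_gt0 c0 S4); apply: filterS => k Hk z zS.
  have bc : 4 * S * expR (- (2 * v0 k)) <= c.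
    have x0 := expR_ge0 (- (2 * v0 k)).
    by move: Hk; rewrite ler_pdivlMr// mulrC; apply: le_trans; rewrite ler_wpM2r//; lra.
  have b0 : 0 <= 4 * S * expR (- (2 * v0 k)) by rewrite !mulr_ge0 ?expR_ge0.
  have bq : (4 * S * expR (- (2 * v0 k))) `^ q <= eta.
    have -> : eta = (eta `^ q^-1) `^ q by rewrite -powRrM mulVf ?gt_eqF// powRr1// ltW.
    apply: ge0_ler_powR; rewrite ?nnegrE ?powR_ge0 ?(ltW q0)//.
    by apply: (le_trans bc); rewrite ge_min lexx orbT.
  have dh : (1 + S) ^+ 2 * (4 * S * expR (- (2 * v0 k))) `^ q / 2 <= h.
    rewrite ler_pdivrMr// mulrC -ler_pdivlMr ?exprn_gt0//.
    by rewrite [h * 2]mulrC.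
  have [||E1 E2] := blowup_close q01 (ode k) (@vv0 k) (@v_le k) S0 _ _ zS; [lra|lra|].
  split=> [|i].
    apply: (le_trans E1); apply: le_trans h2; apply: ler_pM => //; last lra.
    by rewrite divr_ge0// mulr_ge0 ?sqr_ge0 ?powR_ge0.
  by apply: (le_trans (E2 i)); apply: le_trans h2; rewrite ler_pM2l// mulr_gt0.
have enorm2 : (fun x : R * R => ln (2 / (1 + enorm x ^+ 2))) = (fun x => ln (2 / (1 + sqn x))).
  by apply/funext => x; rewrite sqr_enorm.
have s1 (z : R * R) : 0 < 1 + sqn z by have := sqn_ge0 z; lra.
have csqn := @continuous_sqn R.
have dL (s : R) : 0 < 1 + s -> is_derive s 1 (fun s => ln (2 / (1 + s))) (- (1 + s)^-1).
  move=> s0; have h : is_derive s 1 (fun s => ln 2 - ln (1 + s)) (- (1 + s)^-1).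
    have h1 : is_derive (1 + s) 1 (@ln R) (1 + s)^-1 by exact: is_derive1_ln.
    have h2 : is_derive s 1 (fun s : R => 1 + s) 1.
      by have := is_deriveD (is_derive_cst (1 : R) s 1) (is_derive_id s 1); rewrite add0r.
    have h3 := @is_derive1_comp R (@ln R) _ s _ _ h1 h2.
    by have := is_deriveB (is_derive_cst (ln 2 : R) s 1) h3; rewrite sub0r mulr1.
  apply: (near_is_derive _ h); near=> t.
  have t0 : 0 < 1 + t.
    have : - 1 < t by near: t; apply: lt_nbhsr; lra.
    lra.
  by rewrite ln_div ?posrE.
have LL : of_class_C 1 (fun x : R * R => ln (2 / (1 + sqn x))) /\
    forall i, partial i (fun x : R * R => ln (2 / (1 + sqn x))) = (fun z => - (2 * coord i z / (1 + sqn z))).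
  apply: (@of_class_C1_slice R _ (fun i z => - (2 * coord i z / (1 + sqn z)))).
  - move=> z; apply: (@continuous_comp _ _ _ (@sqn R) (fun s => ln (2 / (1 + s)))); first exact: csqn.
    exact: (is_derive_continuous (dL _ (s1 z))).
  - move=> i z.
    have c1 : 2 * coord i w @[w --> z] --> 2 * coord i z.
      by apply: cvgM; [exact: cvg_cst|exact: continuous_coord].
    have c2 : 1 + sqn w @[w --> z] --> 1 + sqn z by apply: cvgD; [exact: cvg_cst|exact: csqn].
    have c3 : (1 + sqn w)^-1 @[w --> z] --> (1 + sqn z)^-1.
      by apply: cvgV => //; exact: lt0r_neq0 (s1 z).
    have c4 : 2 * coord i w * (1 + sqn w)^-1 @[w --> z] --> 2 * coord i z * (1 + sqn z)^-1.
      by apply: cvgM.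
    have c5 : - (2 * coord i w * (1 + sqn w)^-1) @[w --> z] --> - (2 * coord i z * (1 + sqn z)^-1).
      by apply: cvgN.
    exact: c5.
  - move=> i z; rewrite -mulrN; exact: is_derive_slice_radial (dL _ (s1 z)).
have [L1 Ld] := LL.
have pb k := partial_blowup q01 (ode k) (@vv0 k) (@v_le k).
rewrite enorm2; split=> //.
- by move=> k; have [] := pb k.
- apply: family_compact_cvg => S e S0 e0; have := close S e S0 e0.
  by apply: filterS => k Hk z zS; have [] := Hk z zS.
- move=> i; apply: family_compact_cvg => S e S0 e0; have := close S e S0 e0.
  by apply: filterS => k Hk z zS; rewrite Ld; have [_] := Hk z zS.
Unshelve. all: by end_near. Qed.

End sequences_of_profiles.

(** * Weak convergence of the densities *)

Section weak_convergence.
Variable R : realType.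
Local Notation lam := (@lebesgue_measure R).
Local Notation lam2 := (@lebesgue2 R).
Local Notation plane := (measurableTypeR R * measurableTypeR R)%type.
Local Notation Rm := (measurableTypeR R).

(* Rounding the first coordinate to a grid turns [f] into a countable gluing of
   continuous functions of the second one. *)
Lemma continuous_measurable_plane (f : R * R -> R) : continuous f ->
  measurable_fun [set: plane] (f : plane -> Rm).
Proof.
move=> cf; pose N (n : nat) : R := n.+1%:R.
have N0 n : 0 < N n by rewrite ltr0n.
pose fn n (z : plane) : Rm := f ((Num.floor (N n * z.1))%:~R / N n, z.2).
apply: (@measurable_fun_cvg _ plane R setT fn f) => [n|z _].
  move=> _ Y mY; rewrite setTI.
  pose box (c : int) : set plane :=
    [set x : Rm | Num.floor (N n * x : R) = c] `*` [set y : Rm | Y (f (c%:~R / N n, y))].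
  have mbox c : measurable (box c).
    apply: measurableX.
      rewrite (_ : [set _ | _] = (fun x : Rm => N n * x : Rm) @^-1` `[c%:~R, (c + 1)%:~R[%classic); last first.
        apply/seteqP; split=> x /=; rewrite in_itv/=; last exact: Num.Theory.floor_def.
        by move=> <-; exact: Num.Theory.floor_itv.
      have mN : measurable_fun [set: Rm] (fun x : Rm => N n * x : Rm).
        exact: measurable_funM.
      by rewrite -[X in measurable X]setTI; apply: mN => //; exact: measurable_itv.
    have cy : continuous (fun y : R => f (c%:~R / N n, y)).
      move=> y; apply: (@continuous_comp _ _ _ (fun y : R => (c%:~R / N n, y)) f); last exact: cf.
      by apply: (@cvg_pair _ _ _ _ (nbhs (c%:~R / N n : R)) (nbhs (y : R)) _ _ _ (fun=> _) id); [exact: cvg_cst|exact: cvg_id].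
    have mcy := continuous_measurable_fun cy.
    by rewrite -[X in measurable X]setTI; exact: mcy.
  rewrite (_ : _ @^-1` _ = (\bigcup_(k in [set: nat]) box (Posz k)) `|` (\bigcup_(k in [set: nat]) box (Negz k))).
    by apply: measurableU; apply: bigcup_measurable => k _; exact: mbox.
  apply/seteqP; split=> z.
    rewrite /fn /= => Yz; case E : (Num.floor (N n * z.1 : R)) => [k|k]; [left|right]; exists k => //; split=> //=.
      by rewrite -E.
    by rewrite -E.
  by case=> -[k _ [/= E]]; rewrite /fn /= E.
have H : ((Num.floor (N n * z.1))%:~R / N n, z.2) @[n --> \oo] --> ((z.1, z.2) : R * R).
  apply: (@cvg_pair _ _ _ _ (nbhs (z.1 : R)) (nbhs (z.2 : R)) _ _ _
    (fun n => (Num.floor (N n * z.1))%:~R / N n) (fun=> z.2 : R)); last exact: cvg_cst.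
  apply/cvgrPdist_le => e e0; near=> n.
  have /andP[h1 h2] := Num.Theory.floor_itv (N n * z.1 : R).
  set k := Num.floor _ in h1 h2 *; rewrite intrD mulr1z in h2.
  have -> : z.1 - k%:~R / N n = (N n * z.1 - k%:~R) / N n.
    by rewrite mulrBl mulrAC mulfV ?mul1r// gt_eqF.
  rewrite normrM [X in _ * X]ger0_norm ?invr_ge0 ?(ltW (N0 n))//.
  rewrite ler_pdivrMr// ger0_norm ?subr_ge0//.
  apply: (@le_trans _ _ 1); first by rewrite lerBlDl ltW.
  rewrite -ler_pdivrMl//.
  apply: (@le_trans _ _ n%:R); last by rewrite ler_nat.
  by near: n; exact: nbhs_infty_ger.
have := cf z; case: z H => x y H cz.
exact: (cvg_comp _ _ H cz).
Unshelve. all: by end_near. Qed.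

Lemma compactly_supported_bounded (f : R * R -> R) : continuous f -> compactly_supported f ->
  exists2 C : R, 0 <= C & forall z, `|f z| <= C.
Proof.
move=> cf sf; have /compact_bounded[B [_ HB]] : compact (f @` closure [set x | f x != 0]).
  by apply: continuous_compact => //; apply: continuous_subspaceT; exact: cf.
exists (Num.max 0 (B + 1)); first by rewrite le_max lexx.
move=> z; have [->|z0] := eqVneq (f z) 0; first by rewrite normr0 le_max lexx.
rewrite le_max; apply/orP; right; apply: HB; first by rewrite ltrDl.
by exists z => //; apply: subset_closure.
Qed.

Lemma integral_scaled_dirac (k : {nonneg R}) (f : R * R -> R) : measurable_fun [set: plane] (f : plane -> Rm) ->
  (\int[mscale k (dirac (0%R : plane))]_x (f x)%:E = (k%:num * f 0%R)%:E)%E.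
Proof.
move=> mf; have mEf : measurable_fun [set: plane] (fun x => (f x)%:E) by exact/measurable_EFinP.
have -> : (\int[mscale k (dirac (0%R : plane))]_x (f x)%:E =
    \int[mscale k (dirac (0%R : plane))]_x ((fun x => (f x)%:E)^\+ x) -
    \int[mscale k (dirac (0%R : plane))]_x ((fun x => (f x)%:E)^\- x))%E by exact: integralE.
rewrite !ge0_integral_mscale//; [|exact: measurable_funeneg|exact: measurable_funepos].
rewrite !integral_dirac//; [|exact: measurable_funeneg|exact: measurable_funepos].
rewrite !diracT !mul1e funeposE funenegE -EFinN -!EFin_max -!EFinM -EFinB.
congr EFin; have [h|h] := leP (f 0) 0.
  have -> : Num.max (- f 0) 0 = - f 0 by apply/max_idPl; rewrite oppr_ge0.
  by ring.
have -> : Num.max (- f 0) 0 = 0 by apply/max_idPr; rewrite oppr_le0 ltW.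
by ring.
Qed.

Lemma weighted_plane_mass (p m : R) (u : R * R -> R) (v M : R -> R) (v0 : R) : 0 < p < 2 ->
  measurable_fun [set: plane] (u : plane -> Rm) ->
  radial_ode (p / 2) m v M -> v s @[s --> 0^'+] --> v0 -> (forall s, 0 < s <= 1 -> v s <= v0) ->
  {ae lam2, forall z, u z = v (sqn z)} ->
  exists2 T : R, T <= pi * (m * (4 - m) / (4 * (p / 2))) &
    (\int[lam2]_z (enorm z `^ p * expR (2 * u z))%:E = T%:E)%E.
Proof.
move=> p02 mu ode vv0 v_le uv.
have q01 : 0 < p / 2 < 1 by lra.
have [l ll intl] := weighted_mass q01 ode vv0 v_le.
exists (pi * l); first by rewrite ler_wpM2l ?pi_ge0.
pose pos : set Rm := `]0%R, +oo[%classic.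
have mpos : measurable pos by exact: measurable_itv.
pose W (s : Rm) : \bar R := ((fun s => (s `^ (p / 2) * expR (2 * v s))%:E) \_ pos) s.
have W0 s : (0 <= W s)%E.
  by rewrite /W patchE; case: ifPn => // _; rewrite lee_fin mulr_ge0 ?powR_ge0 ?expR_ge0.
have mW : measurable_fun [set: Rm] W.
  apply/(measurable_restrictT _ mpos); apply/measurable_EFinP.
  apply: open_continuous_measurable_fun; first exact: interval_open.
  move=> s; rewrite inE /pos /= in_itv/= andbT => s0.
  apply: cvgM; first exact: (is_derive_continuous (powq_derive (p / 2) s0)).
  apply: continuous_comp; last exact: continuous_expR.
  by apply: cvgM; [exact: cvg_cst|exact: (is_derive_continuous (ode_v ode s0))].
have mWp : measurable_fun [set: plane] (fun z : plane => W (sqn z)).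
  exact: (measurableT_comp mW (@measurable_sqn R)).
have mE : measurable_fun [set: plane] (fun z : plane => (enorm z `^ p * expR (2 * u z))%:E).
  apply/measurable_EFinP; apply: measurable_funM.
    under eq_fun do rewrite enorm_powR.
    have mp : measurable_fun [set: Rm] (fun s : Rm => s `^ (p / 2) : Rm) by exact: measurable_powR.
    exact: (measurableT_comp mp (@measurable_sqn R)).
  by apply: measurableT_comp; [exact: measurable_expR|exact: measurable_funM].
rewrite (@ge0_ae_eq_integral _ _ _ lam2 setT _ (fun z => W (sqn z)))//.
- rewrite (ge0_polar mW W0) EFinM; congr (_ * _)%E; rewrite -intl.
  apply: eq_integral => s; rewrite inE/= in_itv/= andbT => s0.
  by rewrite /W patchE /pos mem_set//= in_itv/= s0.
- by move=> z _; rewrite lee_fin mulr_ge0 ?powR_ge0 ?expR_ge0.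
- have mO : measurable ((@sqn R : plane -> Rm) @^-1` (~` pos)).
    by apply: measurable_preimage_sqn; exact: measurableC.
  have [A [mA A0 sub]] := uv; exists (A `|` (@sqn R @^-1` (~` pos))); split.
  + exact: measurableU.
  + by rewrite measureU0//; exact: lebesgue2_origin.
  + move=> z /= h; have [zpos|zn] := pselect (pos (sqn z)); last by right.
    left; apply: sub => /= uz; apply: h => _.
    by rewrite enorm_powR uz /W patchE mem_set.
Qed.

(* Since [|(phi - phi 0) (1 - w)| <= e + K w], the error is controlled by the masses
   of [e^{2u} = f + w e^{2u}] and [w e^{2u}], where [w = |x|^p]. *)
Lemma weak_estimate (p Lambda : R) (u phi : R * R -> R) (C T : R) :
  solution p Lambda u -> measurable_fun [set: plane] (u : plane -> Rm) ->
  measurable_fun [set: plane] (phi : plane -> Rm) ->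
  0 <= C -> (forall z, `|phi z| <= C) ->
  (\int[lam2]_z (enorm z `^ p * expR (2 * u z))%:E = T%:E)%E ->
  exists I : R, (\int[lam2]_z (phi z * curvature_density p u z)%:E = I%:E)%E /\
    forall e K, 0 <= e -> 0 <= K ->
      (forall z, `|phi z - phi 0| * `|1 - enorm z `^ p| <= e + K * enorm z `^ p) ->
      `|phi 0 * Lambda - I| <= e * Lambda + (e + K) * T.
Proof.
move=> [_ fi _ fL] mu mphi C0 phiC WT.
pose f := curvature_density p u; pose W (z : R * R) : R := enorm z `^ p * expR (2 * u z).
have W0 z : 0 <= W z by rewrite mulr_ge0 ?powR_ge0 ?expR_ge0.
have mE : measurable_fun [set: plane] (fun z : plane => expR (2 * u z) : Rm).
  by apply: measurableT_comp; [exact: measurable_expR|exact: measurable_funM].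
have mw : measurable_fun [set: plane] (fun z : plane => enorm z `^ p : Rm).
  rewrite (funext (enorm_powR p)).
  have mp : measurable_fun [set: Rm] (fun s : Rm => s `^ (p / 2) : Rm) by exact: measurable_powR.
  exact: (measurableT_comp mp (@measurable_sqn R)).
have mW : measurable_fun [set: plane] (W : plane -> Rm) by exact: measurable_funM mw mE.
have mEW : measurable_fun [set: plane] (fun z : plane => (W z)%:E) by exact/measurable_EFinP.
have mf : measurable_fun [set: plane] (f : plane -> Rm).
  by apply: (measurable_funM _ mE); exact: measurable_funB.
have Wi : lam2.-integrable setT (fun z => (W z)%:E).
  apply/integrableP; split=> //; under eq_integral do rewrite /= ger0_norm//.
  by rewrite WT ltry.
have fi' : lam2.-integrable setT (fun z => (f z)%:E) by exact: fi.
have pfi : lam2.-integrable setT (fun z => (phi z * f z)%:E).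
  apply: (le_integrable measurableT _ _ (integrableZl measurableT C fi')).
    by apply/measurable_EFinP; exact: measurable_funM mphi mf.
  by move=> z _; rewrite -EFinM lee_fin !normrM [`|C|]ger0_norm// ler_wpM2r.
have [I HI] : exists I, (\int[lam2]_z (phi z * f z)%:E = I%:E)%E.
  by exists (fine (\int[lam2]_z (phi z * f z)%:E)%E); rewrite fineK// integrable_fin_num.
exists I; split=> // e K e0 K0 H; rewrite -lee_fin.
have -> : (`|phi 0 * Lambda - I|%:E = `|\int[lam2]_z (phi 0 * f z - phi z * f z)%:E|)%E.
  have -> : (\int[lam2]_z (phi 0 * f z - phi z * f z)%:E = \int[lam2]_z ((phi 0)%:E * (f z)%:E - (phi z * f z)%:E))%E.
    by apply: eq_integral.
  rewrite integralB//; last exact: integrableZl.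
  by rewrite (integralZl measurableT fi') fL HI.
have mg : measurable_fun [set: plane] (fun z : plane => phi 0 * f z - phi z * f z : Rm).
  by apply: measurable_funB; [exact: measurable_funM|exact: measurable_funM mphi mf].
apply: le_trans (le_abse_integral lam2 measurableT _) _; first exact/measurable_EFinP.
have -> : ((e * Lambda + (e + K) * T)%:E = \int[lam2]_z (e * f z + (e + K) * W z)%:E)%E.
  have -> : (\int[lam2]_z (e * f z + (e + K) * W z)%:E = \int[lam2]_z (e%:E * (f z)%:E + (e + K)%:E * (W z)%:E))%E.
    by apply: eq_integral.
  rewrite integralD//; [|exact: integrableZl|exact: integrableZl].
  by rewrite (integralZl measurableT fi') (integralZl measurableT Wi) fL WT.
apply: ge0_le_integral => //.
- by apply: measurableT_comp => //; exact/measurable_EFinP.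
- apply/measurable_EFinP; apply: measurable_funD; exact: measurable_funM.
move=> z _; rewrite lee_fin -mulrBl normrM distrC.
rewrite /f /curvature_density normrM [X in _ * (_ * X)]ger0_norm ?expR_ge0// mulrA.
apply: (@le_trans _ _ ((e + K * enorm z `^ p) * expR (2 * u z))).
  by rewrite ler_wpM2r ?expR_ge0.
by rewrite le_eqVlt /W; apply/orP; left; apply/eqP; ring.
Qed.

(** Write w = |z|^p. Where |z|^2 < r, continuity makes the first factor at most e, and the second is
    at most 1 + w. Elsewhere w >= c, so every constant is absorbed into a multiple of w. *)
Lemma weight_majorant (p C e : R) (phi : R * R -> R) : 0 < p -> 0 <= C -> 0 < e -> continuous phi ->
  (forall z, `|phi z| <= C) -> exists2 K : R, 0 <= K &
    forall z, `|phi z - phi 0| * `|1 - enorm z `^ p| <= e + K * enorm z `^ p.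
Proof.
move=> p0 C0 e0 cphi phiC.
have [r r0 Hr] : exists2 r : R, 0 < r & forall z, sqn z < r -> `|phi z - phi 0| <= e.
  have /cvgrPdist_le/(_ e e0)/nbhs_ballP[d /= d0 Hd] := cphi 0.
  exists (d ^+ 2); first exact: exprn_gt0.
  move=> z zd; rewrite distrC; apply: Hd.
  have h i : `|coord i z| < d.
    rewrite -(@ltr_pXn2r _ 2) ?nnegrE ?(ltW d0)// real_normK ?num_real//.
    exact: le_lt_trans (coord_le_sqn i z) zd.
  by split; rewrite /ball/= sub0r normrN; [exact: (h false)|exact: (h true)].
pose c := r `^ (p / 2); have c0 : 0 < c by exact: powR_gt0.
exists (e + 2 * C * (c^-1 + 1)).
  by rewrite addr_ge0 ?(ltW e0)// !mulr_ge0// addr_ge0 ?invr_ge0 ?(ltW c0).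
move=> z; rewrite enorm_powR; set w := sqn z `^ (p / 2).
have w0 : 0 <= w by exact: powR_ge0.
have w1 : `|1 - w| <= 1 + w by rewrite (le_trans (ler_normB _ _))// normr1 ger0_norm.
have c1 : 0 < c^-1 by rewrite invr_gt0.
have [zr|rz] := ltP (sqn z) r.
  apply: (@le_trans _ _ (e * (1 + w))); first by apply: ler_pM => //; exact: Hr.
  have : 0 <= 2 * C * (c^-1 + 1) * w by rewrite !mulr_ge0// addr_ge0 ?ltW.
  lra.
have cw : 1 <= c^-1 * w.
  rewrite ler_pdivlMl// mulr1; apply: ge0_ler_powR; rewrite ?nnegrE ?(ltW r0)//.
    by rewrite divr_ge0 ?ltW.
  exact: sqn_ge0.
apply: (@le_trans _ _ (2 * C * (1 + w))).
  apply: ler_pM => //; apply: (le_trans (ler_normB _ _)).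
  by have := phiC z; have := phiC 0; lra.
have : 2 * C * 1 <= 2 * C * (c^-1 * w) by rewrite ler_wpM2l ?mulr_ge0.
have : 0 <= e * w by exact: mulr_ge0 (ltW e0) w0.
lra.
Qed.

Lemma densities_cvg (p : R) (m Lambda : nat -> R) (u : nat -> R * R -> R) : 0 < p < 2 ->
  (forall k, solution p (Lambda k) (u k)) -> (forall k, measurable_fun [set: plane] (u k : plane -> Rm)) ->
  (forall k, exists2 T : R, T <= pi * (m k * (4 - m k) / (4 * (p / 2))) &
    (\int[lam2]_z (enorm z `^ p * expR (2 * u k z))%:E = T%:E)%E) ->
  m k @[k --> \oo] --> (4 : R) -> Lambda k @[k --> \oo] --> 4 * (pi : R) ->
  densities_cvg_weakly (fun k => curvature_density p (u k))
    (mscale (NngNum (four_pi_ge0 R)) (dirac (0 : plane))).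
Proof.
move=> p02 sol mu HT m4 L4 phi cphi sphi; have /andP[p0 p2] := p02.
have [C C0 phiC] := compactly_supported_bounded cphi sphi.
have mphi := continuous_measurable_plane cphi.
rewrite integral_scaled_dirac//=.
pose T' k := pi * (m k * (4 - m k) / (4 * (p / 2))).
have /choice[I HI] : forall k, exists I : R, (\int[lam2]_z (phi z * curvature_density p (u k) z)%:E = I%:E)%E /\
    forall e K, 0 <= e -> 0 <= K -> (forall z, `|phi z - phi 0| * `|1 - enorm z `^ p| <= e + K * enorm z `^ p) ->
      `|phi 0 * Lambda k - I| <= e * Lambda k + (e + K) * T' k.
  move=> k; have [T hT ET] := HT k.
  have [I [EI HI]] := weak_estimate (sol k) (mu k) mphi C0 phiC ET.
  exists I; split=> // e K e0 K0 H; apply: (le_trans (HI e K e0 K0 H)).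
  by rewrite lerD2l ler_wpM2l ?addr_ge0.
have IL : I k @[k --> \oo] --> 4 * pi * phi 0.
  apply/cvgrPdist_le => d d0; have pi0 : 0 < (pi : R) by exact: pi_gt0.
  (* In the limit only e times the total mass survives, namely 4 pi e = d / 4, which is strictly
     below d. *)
  pose e := d / (16 * pi); have e0 : 0 < e by rewrite divr_gt0// mulr_gt0.
  have [K K0 HK] := weight_majorant p0 C0 e0 cphi phiC.
  have T0 : T' k @[k --> \oo] --> pi * (4 * (4 - 4) / (4 * (p / 2))).
    apply: cvgM; first exact: cvg_cst.
    apply: cvgM; last exact: cvg_cst.
    by apply: cvgM => //; apply: cvgB => //; exact: cvg_cst.
  have G : `|4 * pi * phi 0 - phi 0 * Lambda k| + (e * Lambda k + (e + K) * T' k) @[k --> \oo] -->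
      `|4 * pi * phi 0 - phi 0 * (4 * pi)| + (e * (4 * pi) + (e + K) * (pi * (4 * (4 - 4) / (4 * (p / 2))))).
    apply: cvgD.
      by apply: cvg_norm; apply: cvgB; [exact: cvg_cst|apply: cvgM => //; exact: cvg_cst].
    by apply: cvgD; apply: cvgM => //; exact: cvg_cst.
  have Gd : \forall k \near \oo, `|4 * pi * phi 0 - phi 0 * Lambda k| + (e * Lambda k + (e + K) * T' k) <= d.
    apply: (@cvgr_le _ _ _ _ _ _ G).
    rewrite [phi 0 * _]mulrC !subrr normr0 mulr0 mul0r !mulr0 add0r addr0.
    by rewrite /e mulrAC ltr_pdivrMr ?mulr_gt0// ltr_pM2l// ltr_pM2r// ltr_nat.
  apply: filterS Gd => k; apply: le_trans.
  have -> : 4 * pi * phi 0 - I k = (4 * pi * phi 0 - phi 0 * Lambda k) + (phi 0 * Lambda k - I k) by ring.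
  apply: (le_trans (ler_normD _ _)); rewrite lerD2l.
  by have [_] := HI k; apply => //; exact: ltW.
apply: cvg_EFin.
  by apply: nearW => k; have [-> _] := HI k.
rewrite (_ : _ \o _ = I)//; apply/funext => k /=.
by have [-> _] := HI k.
Qed.

End weak_convergence.

Theorem theorem1p4 (R : realType) (p : R) (p_gt0 : 0 < p) (p_lt2 : p < 2)
    (Lambda : nat -> R) (u : nat -> R * R -> R)
    (u_sol : forall k, solution p (Lambda k) (u k))
    (u_radial : forall k, radial (u k))
    (Lambda_nondecreasing : {homo Lambda : m n / (m <= n)%N >-> m <= n})
    (Lambda_cvg : Lambda k @[k --> \oo] --> 4 * pi) :
  densities_cvg_weakly (fun k => curvature_density p (u k))
    (mscale (NngNum (four_pi_ge0 R))
       (dirac (0 : measurableTypeR R * measurableTypeR R)))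
  /\ exists v : nat -> R * R -> R,
       (forall k, C1_representative (u k) (v k)) /\
       C1_loc_cvg (fun k => blowup (v k))
         (fun x => ln (2 / (1 + enorm x ^+ 2))).
Proof.
have p02 : 0 < p < 2 by rewrite p_gt0.
have q01 : 0 < p / 2 < 1 by lra.
have mu k := locally_integrable_measurable (let: And4 ui _ _ _ := u_sol k in ui).
have m4 : Lambda k / pi @[k --> \oo] --> (4 : R).
  rewrite -[X in _ --> X](@mulfK _ (pi : R)) ?gt_eqF ?pi_gt0//.
  by apply: cvgM => //; exact: cvg_cst.
have /choice[vM HvM] : forall k, exists vM : (R -> R) * (R -> R),
    radial_ode (p / 2) (Lambda k / pi) vM.1 vM.2 /\ {ae @lebesgue2 R, forall z, u k z = vM.1 (sqn z)}.
  move=> k; have [g gp] := solution_profile (u_sol k) (u_radial k).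
  by have [v [M vM]] := profile_ode gp; exists (v, M).
pose v k := (vM k).1; pose M k := (vM k).2.
have ode k : radial_ode (p / 2) (Lambda k / pi) (v k) (M k) by have [] := HvM k.
have uv k : {ae @lebesgue2 R, forall z, u k z = v k (sqn z)} by have [] := HvM k.
have /choice[v0 Hv0] : forall k, exists v0 : R,
    v k s @[s --> 0^'+] --> v0 /\ forall s, 0 < s <= 1 -> v k s <= v0.
  by move=> k; have [v0 h1 h2] := v_cvg0 q01 (ode k); exists v0.
have vv0 k : v k s @[s --> 0^'+] --> v0 k by have [] := Hv0 k.
have v_le k s : 0 < s <= 1 -> v k s <= v0 k by have [_] := Hv0 k; exact.
split.
  apply: (densities_cvg p02 u_sol mu _ m4 Lambda_cvg) => k.
  exact: weighted_plane_mass p02 (mu k) (ode k) (@vv0 k) (@v_le k) (uv k).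
exists (fun k => radial_rep (v k) (v0 k)); split; last exact: (blowup_cvg q01 ode (@vv0) (@v_le) m4).
move=> k; split; first by have [] := radial_rep_C1 q01 (ode k) (@vv0 k) (@v_le k).
pose pos : set (measurableTypeR R) := `]0%R, +oo[%classic.
have mpos : measurable pos by exact: measurable_itv.
(* The origin is added to the null set, since [radial_ext] replaces v by its limit v0 there. *)
have [A [mA A0 sub]] := uv k; exists (A `|` (@sqn R @^-1` (~` pos))); split.
- by apply: measurableU => //; apply: measurable_preimage_sqn; exact: measurableC.
- by rewrite measureU0//; [apply: measurable_preimage_sqn; exact: measurableC|exact: lebesgue2_origin].
- move=> z /= h; have [zpos|zn] := pselect (pos (sqn z)); last by right.
  left; apply: sub => /= uz; apply: h; rewrite uz /radial_rep /radial_ext.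
  by move: zpos; rewrite /pos /= in_itv/= andbT => ->.
Qed.
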